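(* Let $\vec p=(\infty,p_2)$ with $1<p_2<\infty$, and let $\vec a,\vec b,\vec c\in\mathbb{R}^2$, $\vec\alpha\in(-1,\infty)^2$. Then the following are equivalent: (1) $S_{\vec a,\vec b,\vec c}$ is bounded from $L^{\vec p}_{\vec\alpha}(T_B\times T_B)$ to $L^\infty(T_B\times T_B)$; (2) $T_{\vec a,\vec b,\vec c}$ is bounded from $L^{\vec p}_{\vec\alpha}(T_B\times T_B)$ to $L^\infty(T_B\times T_B)$; (3) $a_1>0$, $a_2>0$, $b_1>-1$, $p_2(b_2+1)>\alpha_2+1$, $c_1=n+1+a_1+b_1$, and $c_2=n+1+a_2+b_2-\frac{n+1+\alpha_2}{p_2}$.
   Context: Let $n$ be a positive integer. For $z=(z_1,\dots,z_n)\in\mathbb{C}^n$ write $z=x+iy$ with $x,y\in\mathbb{R}^n$, $z'=(z_1,\dots,z_{n-1})$, $y'=(y_1,\dots,y_{n-1})$. Let $B=\{y\in\mathbb{R}^n: |y'|^2<y_n\}$ and $T_B=\{x+iy: x\in\mathbb{R}^n, y\in B\}$. For $z\in T_B$ put $\rho(z)=y_n-|y'|^2>0$, and for $z,u\in T_B$ put $\rho(z,u)=\frac14\big(\sum_{j=1}^{n-1}(z_j-\overline{u_j})^2-2i(z_n-\overline{u_n})\big)$; this has positive real part, and complex powers $\rho(z,u)^c$ are taken with the principal branch. $dV$ is Lebesgue measure on $\mathbb{C}^n$ and $dV_\alpha(z)=\rho(z)^\alpha dV(z)$. For $\vec p=(p_1,p_2)\in[1,\infty]^2$ and $\vec\alpha=(\alpha_1,\alpha_2)$,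 $L^{\vec p}_{\vec\alpha}(T_B\times T_B)$ is the space of measurable $f$ on $T_B\times T_B$ with finite mixed norm $\|f\|_{\vec p,\vec\alpha}=\big\{\int_{T_B}\big(\int_{T_B}|f(z,w)|^{p_1}dV_{\alpha_1}(z)\big)^{p_2/p_1}dV_{\alpha_2}(w)\big\}^{1/p_2}$, with the inner (resp. outer) integral replaced by an essential supremum in $z$ (resp. $w$) when $p_1=\infty$ (resp. $p_2=\infty$); when $\vec p=(\infty,\infty)$ this is $L^\infty(T_B\times T_B)$. For $\vec a=(a_1,a_2),\vec b=(b_1,b_2),\vec c=(c_1,c_2)\in\mathbb{R}^2$, $T_{\vec a,\vec b,\vec c}f(z,w)=\rho(z)^{a_1}\rho(w)^{a_2}\int_{T_B}\int_{T_B}\frac{\rho(u)^{b_1}\rho(\eta)^{b_2}}{\rho(z,u)^{c_1}\rho(w,\eta)^{c_2}}f(u,\eta)\,dV(u)\,dV(\eta)$ and $S_{\vec a,\vec b,\vec c}f(z,w)=\rho(z)^{a_1}\rho(w)^{a_2}\int_{T_B}\int_{T_B}\frac{\rho(u)^{b_1}\rho(\eta)^{b_2}}{|\rho(z,u)|^{c_1}|\rho(w,\eta)|^{c_2}}f(u,\eta)\,dV(u)\,dV(\eta)$. An operator is bounded from $X$ to $Y$ if for every $f\in X$ the defining integral converges for a.e. $(z,w)$ and $\|Tf\|_Y\le C\|f\|_X$ with $C$ independent of $f$. *)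

(* Defs.v *)
From HB Require Import structures.
From mathcomp Require Import all_boot all_order all_algebra.
From mathcomp Require Import all_classical all_reals all_analysis.
From mathcomp Require Import complex.
Set Implicit Arguments. Unset Strict Implicit. Unset Printing Implicit Defensive.
Import Order.TTheory GRing.Theory Num.Theory.
Import numFieldNormedType.Exports.
Local Open Scope classical_set_scope.
Local Open Scope ring_scope.
Local Open Scope complex_scope.

Section TubeDefs.
Context (R : realType).

(** Iterated Lebesgue integral over R^k (k.-tuple R), for [0,+oo]-valued functions.
    For nonnegative Borel functions this is the integral w.r.t. Lebesgue measure
    on R^k (Tonelli). *)
Fixpoint iint (k : nat) : (k.-tuple R -> \bar R) -> \bar R :=
  match k return (k.-tuple R -> \bar R) -> \bar R with
  | 0 => fun g => g [tuple]
  | k'.+1 => fun g =>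
      (\int[@lebesgue_measure R]_(t in setT)
          iint (fun v : k'.-tuple R => g [tuple of t :: v]))%E
  end.

Variable n : nat.

(** A point z = x + i y of C^n is represented by the pair (x, y) of real n-tuples. *)
Definition Pt := (n.-tuple R * n.-tuple R)%type.

Definition xco (z : Pt) (j : nat) : R := nth 0 (val z.1) j.
Definition yco (z : Pt) (j : nat) : R := nth 0 (val z.2) j.
(** complex coordinate z_j (0-based: z_1 ... z_n of the paper are j = 0 .. n-1) *)
Definition zco (z : Pt) (j : nat) : R[i] := Complex (xco z j) (yco z j).

Definition intV (g : Pt -> \bar R) : \bar R :=
  iint (fun x : n.-tuple R => iint (fun y : n.-tuple R => g (x, y))).

Definition rho (z : Pt) : R :=
  yco z n.-1 - \sum_(j < n.-1) (yco z j) ^+ 2.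

Definition TB : set Pt := [set z | 0 < rho z].

Definition rho2 (z u : Pt) : R[i] :=
  (Complex (4^-1) 0) *
  (\sum_(j < n.-1) (zco z j - conjc (zco u j)) ^+ 2
   - (Complex 0 2) * (zco z n.-1 - conjc (zco u n.-1))).

(** principal-branch power w^c, for w in the open right half-plane Re w > 0
    (the only place where it is used): |w|^c e^{i c Arg w}, Arg w = atan(Im w / Re w). *)
Definition cpow (w : R[i]) (c : R) : R[i] :=
  let r := Num.sqrt (@complex.Re R w ^+ 2 + @complex.Im R w ^+ 2) in
  let th := atan (@complex.Im R w / @complex.Re R w) in
  Complex (powR r c * cos (c * th)) (powR r c * sin (c * th)).

Definition cabs (w : R[i]) : R := Num.sqrt (@complex.Re R w ^+ 2 + @complex.Im R w ^+ 2).

Definition wnullV (al : R) (N : set Pt) : Prop :=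
  exists M : set Pt, measurable M /\ N `<=` M /\
    intV (fun z => ((\1_(TB `&` M) z : R) * powR (rho z) al)%:E) = 0%E.

Definition nullVV (N : set (Pt * Pt)) : Prop :=
  exists M : set (Pt * Pt), measurable M /\ N `<=` M /\
    intV (fun z => intV (fun w => ((\1_M (z, w) : R))%:E)) = 0%E.

Definition esssupV (al : R) (h : Pt -> \bar R) : \bar R :=
  ereal_inf [set M : \bar R | wnullV al [set z | TB z /\ (M < h z)%E]].

Definition esssupVV (h : Pt -> Pt -> \bar R) : \bar R :=
  ereal_inf [set M : \bar R | nullVV [set zw | TB zw.1 /\ TB zw.2 /\ (M < h zw.1 zw.2)%E]].

Definition mixnorm_inf (p2 al1 al2 : R) (f : Pt -> Pt -> R[i]) : \bar R :=
  ((intV (fun w =>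
      (\1_TB w : R)%:E * (esssupV al1 (fun z => (cabs (f z w))%:E)) `^ p2
        * (powR (rho w) al2)%:E)) `^ (p2^-1))%E.

Definition cmeasurable (f : Pt -> Pt -> R[i]) : Prop :=
  measurable_fun [set: Pt * Pt] (fun p => @complex.Re R (f p.1 p.2)) /\
  measurable_fun [set: Pt * Pt] (fun p => @complex.Im R (f p.1 p.2)).

(** real Lebesgue integral over T_B x T_B of a real function (meaningful when integrable) *)
Definition rintVV (h : Pt -> Pt -> R) : R :=
  fine (intV (fun u => intV (fun e => ((\1_TB u * \1_TB e : R) * Num.max (h u e) 0)%:E)))
  - fine (intV (fun u => intV (fun e => ((\1_TB u * \1_TB e : R) * Num.max (- h u e) 0)%:E))).

Definition cintVV (h : Pt -> Pt -> R[i]) : R[i] :=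
  Complex (rintVV (fun u e => @complex.Re R (h u e))) (rintVV (fun u e => @complex.Im R (h u e))).

Definition integrableVV (h : Pt -> Pt -> R[i]) : Prop :=
  (intV (fun u => intV (fun e => ((\1_TB u * \1_TB e : R) * cabs (h u e))%:E)) < +oo)%E.

Definition kerT (a1 a2 b1 b2 c1 c2 : R) (z w u e : Pt) : R[i] :=
  ((powR (rho z) a1 * powR (rho w) a2 * powR (rho u) b1 * powR (rho e) b2)%:C)
  / (cpow (rho2 z u) c1 * cpow (rho2 w e) c2).

Definition kerS (a1 a2 b1 b2 c1 c2 : R) (z w u e : Pt) : R[i] :=
  ((powR (rho z) a1 * powR (rho w) a2 * powR (rho u) b1 * powR (rho e) b2)
   / (powR (cabs (rho2 z u)) c1 * powR (cabs (rho2 w e)) c2))%:C.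

Definition applyK (K : Pt -> Pt -> Pt -> Pt -> R[i]) (f : Pt -> Pt -> R[i]) (z w : Pt) : R[i] :=
  cintVV (fun u e => K z w u e * f u e).

Definition bounded_inf (K : Pt -> Pt -> Pt -> Pt -> R[i]) (p2 al1 al2 : R) : Prop :=
  exists C : R, forall f : Pt -> Pt -> R[i],
    cmeasurable f -> (mixnorm_inf p2 al1 al2 f < +oo)%E ->
    nullVV [set zw | TB zw.1 /\ TB zw.2 /\
                     ~ integrableVV (fun u e => K zw.1 zw.2 u e * f u e)] /\
    (esssupVV (fun z w => (cabs (applyK K f z w))%:E)
       <= C%:E * mixnorm_inf p2 al1 al2 f)%E.

End TubeDefs.

(* Main.v *)
(* For u = s + it and z = x + iy one has
   4 Re rho(z,u) = 2 rho(z) + 2 rho(u) + |x'-s'|^2 + |y'-t'|^2, and, up to a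
   multiple of the last two terms, 2 Im rho(z,u) = s_n - psi(z,s') for some psi
   not depending on t.  Hence |rho(z,u)| dominates each of rho(z) + rho(u),
   rho(z) + (x_j-s_j)^2, rho(z) + (y_j-t_j)^2 and rho(z) + |s_n - psi(z,s')|.
   Splitting the exponent c among these 2n factors bounds the integral of
   rho(u)^b |rho(z,u)|^-c by an iterated product of one-dimensional integrals,
   taken in the order of the coordinates; this gives C rho(z)^(n+1+b-c) when
   b > -1 and c > n+1+b.  Sufficiency follows by Tonelli and Hoelder's inequality
   in the second variable.

   For necessity, indicators of boxes adapted to the dilations
   (z',z_n) |-> (s z', s^2 z_n), on which the kernel has real part at least half
   of its modulus, force the two homogeneity identities.  The inequalities only
   use the almost everywhere absolute convergence of the defining integral,
   tested on functions of the second variable which are constant on dyadic boxes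
   tending to the boundary or to infinity, with coefficients making their norm
   finite and the integral against the kernel infinite.  Both parts see the
   kernel only through its modulus and this positivity, so S and T are treated
   together. *)

Require Import Defs.
From HB Require Import structures.
From mathcomp Require Import all_boot all_order all_algebra.
From mathcomp Require Import all_classical all_reals all_analysis.
From mathcomp Require Import measurable_realfun measurable_fun_approximation.
From mathcomp Require Import complex ring lra zify.
Set Implicit Arguments. Unset Strict Implicit. Unset Printing Implicit Defensive.
Import Order.TTheory GRing.Theory Num.Theory.
Import numFieldNormedType.Exports.
Local Open Scope classical_set_scope.
Local Open Scope ring_scope.

(** * Iterated integrals as integrals for a measure *)

Section iterated_integrals.
Local Open Scope ereal_scope.

Import HBNNSimple.

(** The integrals are iterated integrals of arbitrary functions. The kernel is bounded on them
    directly, by monotonicity and one variable at a time. For measurable integrands they agree with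
    the integral for a sigma-finite measure [vol], and Tonelli's theorem, negligible sets and
    Hoelder's inequality are used only there. The bound for the kernel is not a product of functions
    of single coordinates: the last real coordinate is coupled to earlier ones by the imaginary
    part, the last imaginary one by [rho u]. Both couplings are translations of the last variable by
    a function of variables already fixed, and the one-dimensional bounds are uniform under
    translation. The conditions [0 < a1] and [0 < a2] are never tested: divergence gives strict
    lower bounds for [c1] and [c2], which the homogeneity identities turn into positivity. The
    critical cases are excluded by the same boxes, since there the kernel mass of each box is still
    comparable to the norm it has to beat. *)

Lemma ge0_le_integral_nomeas d (T : measurableType d) (R : realType)
    (mu : {measure set T -> \bar R}) (f g : T -> \bar R) :
  (forall x, 0 <= f x) -> (forall x, f x <= g x) ->
  \int[mu]_x f x <= \int[mu]_x g x.
Proof.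
move=> f0 fg; have g0 x : 0 <= g x := le_trans (f0 x) (fg x).
(* The integral of a nonnegative function is a supremum over the simple functions below it, and a
   simple function below [f] is also below [g]. *)
rewrite !ge0_integralTE// ge_ereal_sup// => _ [h/= hf] <-.
apply: le_ereal_sup_tmp; exists (sintegral mu h) => //.
by exists h => // x; exact: le_trans (hf x) (fg x).
Qed.

(* Lebesgue measure typed on [R] with its default display, the display for
   which the tuples and pairs of [Defs] are measurable spaces. *)
Definition leb (R : realType) : set R -> \bar R := @lebesgue_measure R.

HB.instance Definition _ (R : realType) := @isMeasure.Build _ R R (@leb R)
  (measure0 (@lebesgue_measure R)) (measure_ge0 (@lebesgue_measure R))
  (@measure_semi_sigma_additive _ _ _ (@lebesgue_measure R)).

HB.instance Definition _ (R : realType) := @Measure_isSigmaFinite.Build _ R R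
  (@leb R) (sigma_finiteT (@lebesgue_measure R)).

(** The two types carry the same measurable sets, and transport along the identity map reconciles
    the two integrals. *)
Lemma integral_leb (R : realType) (f : R -> \bar R) :
  measurable_fun [set: R] f -> (forall x, 0 <= f x) ->
  \int[@lebesgue_measure R]_x f x = \int[@leb R]_x f x.
Proof.
move=> mf f0; pose i : measurableTypeR R -> R := id.
have mi : measurable_fun [set: measurableTypeR R] i.
  by move=> _ A mA; rewrite setTI.
rewrite (_ : \int[@leb R]_x f x = \int[pushforward (@lebesgue_measure R) i]_x f x).
  by rewrite (ge0_integral_pushforward mi).
by apply: (@eq_measure_integral _ R R setT (pushforward (@lebesgue_measure R) i)).
Qed.

Lemma sigma_finite_product d1 d2 (T1 : measurableType d1) (T2 : measurableType d2)
    (R : realType) (m1 : {sigma_finite_measure set T1 -> \bar R})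
    (m2 : {sigma_finite_measure set T2 -> \bar R}) :
  sigma_finite setT (m1 \x m2).
Proof.
have /sigma_finiteP[F [TF ndF Foo]] := sigma_finiteT m1.
have /sigma_finiteP[G [TG ndG Goo]] := sigma_finiteT m2.
(* Both exhaustions are increasing, so the diagonal rectangles already cover the product. *)
exists (fun i => F i `*` G i) => [|i].
  rewrite -setXTT TF TG predeqE => -[x y]; split => [[/= [i _ Fx] [j _ Gy]]|].
    exists (maxn i j) => //; split.
    - by move: x Fx; exact/subsetPset/ndF/leq_maxl.
    - by move: y Gy; exact/subsetPset/ndG/leq_maxr.
  by move=> [i _ [/= Fx Gy]]; split; exists i.
have [? ?] := Foo i; have [? ?] := Goo i; split; first exact: measurableX.
by rewrite product_measure1E// lte_mul_pinfty// ge0_fin_numE.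
Qed.

(** The image measure is recorded only through the integrals it gives. It is sigma-finite because an
    exhaustion of the source can be pulled back along the left inverse [psi]. *)
Lemma sigma_finite_pushforward d d' (T1 : measurableType d) (T2 : measurableType d')
    (R : realType) (mu : {measure set T1 -> \bar R})
    (phi : T1 -> T2) (psi : T2 -> T1) :
  sigma_finite setT mu ->
  measurable_fun [set: T1] phi -> measurable_fun [set: T2] psi ->
  cancel phi psi ->
  exists nu : {sigma_finite_measure set T2 -> \bar R},
    forall g : T2 -> \bar R, measurable_fun [set: T2] g -> (forall v, 0 <= g v) ->
    \int[nu]_v g v = \int[mu]_x g (phi x).
Proof.
move=> smu mphi mpsi psiK; have [m0 m0E] : exists m0 : set T2 -> \bar R, m0 = pushforward mu phi.
  by exists (pushforward mu phi).
have m00 : m0 set0 = 0 by rewrite m0E /pushforward preimage_set0 measure0.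
have m0ge0 A : 0 <= m0 A by rewrite m0E; exact: measure_ge0.
have m0sa : semi_sigma_additive m0.
  move=> F mF tF mUF; rewrite m0E /pushforward preimage_bigcup.
  apply: measure_semi_sigma_additive.
  - by move=> n; rewrite -[X in measurable X]setTI; exact: mphi.
  - apply/trivIsetP => /= i j _ _ ij; rewrite -preimage_setI.
    by move/trivIsetP : tF => /(_ _ _ _ _ ij) ->//; rewrite preimage_set0.
  - by rewrite -preimage_bigcup -[X in measurable X]setTI; exact: mphi.
have fin0 : sigma_finite setT m0.
  have [F FT Ffin] := smu.
  exists (fun i => psi @^-1` (F i)) => [|i].
    by rewrite -preimage_bigcup -FT preimage_setT.
  have [mF Fo] := Ffin i.
  split; first by rewrite -[X in measurable X]setTI; exact: mpsi.
  rewrite m0E /pushforward -comp_preimage.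
  by rewrite (_ : psi \o phi = id)//; apply/funext => x; exact: psiK.
pose mM := isMeasure.Build _ _ _ m0 m00 m0ge0 m0sa.
pose M : {measure set T2 -> \bar R} := HB.pack m0 mM.
pose mS := @Measure_isSigmaFinite.Build _ _ _ M fin0.
pose m1 : {sigma_finite_measure set T2 -> \bar R} := HB.pack (Measure.sort M) mS.
exists m1 => g mg g0.
transitivity (\int[pushforward mu phi]_v g v).
  by apply: eq_measure_integral => A _ _; exact: (congr1 (fun m : set T2 -> \bar R => m A) m0E).
by rewrite (ge0_integral_pushforward mphi)// preimage_setT.
Qed.

Section iint_theory.
Context (R : realType).

Lemma iintS k (g : k.+1.-tuple R -> \bar R) :
  iint g = \int[@lebesgue_measure R]_t iint (fun v : k.-tuple R => g [tuple of t :: v]).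
Proof. by []. Qed.

Lemma iint_ge0 k (g : k.-tuple R -> \bar R) : (forall v, 0 <= g v) -> 0 <= iint g.
Proof.
elim: k g => [|k IH] g g0 /=; first exact: g0.
by apply: integral_ge0 => t _; apply: IH.
Qed.

Lemma le_iint k (f g : k.-tuple R -> \bar R) :
  (forall v, 0 <= f v) -> (forall v, f v <= g v) -> iint f <= iint g.
Proof.
elim: k f g => [|k IH] f g f0 fg /=; first exact: fg.
apply: ge0_le_integral_nomeas => t; first exact: iint_ge0.
exact: IH.
Qed.

Lemma eq_iint k (f g : k.-tuple R -> \bar R) : f =1 g -> iint f = iint g.
Proof. by move=> /funext ->. Qed.

(** Induction on the dimension: a point mass on the empty tuple, then the image under cons of the
    product of [leb] with the measure already built. Tonelli's theorem identifies one more iterated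
    integration with this product. *)
Lemma iint_measure k : exists mu : {sigma_finite_measure set (k.-tuple R) -> \bar R},
  forall g : k.-tuple R -> \bar R, measurable_fun setT g -> (forall v, 0 <= g v) ->
  iint g = \int[mu]_v g v.
Proof.
elim: k => [|k [mu IH]].
  exists (\d_ ([tuple] : 0.-tuple R)) => g mg g0 /=.
  by rewrite integral_dirac// diracT mul1e.
pose phi (p : R * k.-tuple R) : k.+1.-tuple R := [tuple of p.1 :: p.2].
have mphi : measurable_fun setT phi by exact: measurable_cons.
pose psi (v : k.+1.-tuple R) : R * k.-tuple R := (thead v, [tuple of behead v]).
have mpsi : measurable_fun setT psi.
  by apply/measurable_fun_pairP; split; [exact: measurable_tnth|exact: measurable_behead].
have psiK : cancel phi psi.
  by move=> [a v]; rewrite /psi /phi /= theadE; congr pair; exact: val_inj.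
have [nu nuE] := sigma_finite_pushforward (sigma_finite_product (@leb R) mu) mphi mpsi psiK.
exists nu => g mg g0; rewrite nuE//=.
have mgphi : measurable_fun [set: R * k.-tuple R] (g \o phi).
  exact: (measurableT_comp mg mphi).
rewrite (fubini_tonelli1 (g \o phi))//=.
have gE t : iint (fun v : k.-tuple R => g [tuple of t :: v]) =
    fubini_F mu (g \o phi) t.
  rewrite IH//.
  by apply: (measurableT_comp mg); exact: measurable_cons.
rewrite -integral_leb.
- by apply: eq_integral => t _; exact: gE.
- by apply: measurable_fun_fubini_tonelli_F => // x; exact: g0.
- by move=> t; apply: integral_ge0 => v _; exact: g0.
Qed.

End iint_theory.

Section intV_theory.
Context (R : realType) (n : nat).

Lemma intV_measure : exists mu : {sigma_finite_measure set (Pt R n) -> \bar R},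
  forall g : Pt R n -> \bar R, measurable_fun [set: Pt R n] g -> (forall v, 0 <= g v) ->
  intV g = \int[mu]_v g v.
Proof.
have [m mE] := iint_measure R n.
have mid : measurable_fun [set: Pt R n] (@id (Pt R n)) by exact: measurable_id.
have [nu nuE] := sigma_finite_pushforward (sigma_finite_product m m) mid mid (fun=> erefl).
exists nu => g mg g0; rewrite nuE// (fubini_tonelli1 g)//= /intV.
have gE x : iint (fun y : n.-tuple R => g (x, y)) = fubini_F m g x.
  by rewrite mE//; exact: measurableT_comp.
rewrite mE.
- by apply: eq_integral => x _; exact: gE.
- by under eq_fun do rewrite gE; exact: measurable_fun_fubini_tonelli_F.
- by move=> x; rewrite gE; apply: integral_ge0.
Qed.

(** Lebesgue measure on C^n. It is picked from an existence statement and accessed only through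
    [intVE]. *)
Definition vol : {sigma_finite_measure set (Pt R n) -> \bar R} :=
  projT1 (cid intV_measure).

Lemma intVE (g : Pt R n -> \bar R) :
  measurable_fun [set: Pt R n] g -> (forall v, 0 <= g v) ->
  intV g = \int[vol]_v g v.
Proof. exact: projT2 (cid intV_measure) g. Qed.

Lemma le_intV (f g : Pt R n -> \bar R) :
  (forall v, 0 <= f v) -> (forall v, f v <= g v) -> intV f <= intV g.
Proof.
move=> f0 fg; apply: le_iint => x; first exact: iint_ge0.
exact: le_iint.
Qed.

Lemma intV_ge0 (f : Pt R n -> \bar R) : (forall v, 0 <= f v) -> 0 <= intV f.
Proof. by move=> f0; apply: iint_ge0 => x; exact: iint_ge0. Qed.

Lemma eq_intV (f g : Pt R n -> \bar R) : f =1 g -> intV f = intV g.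
Proof. by move=> /funext ->. Qed.

Lemma intVVE (g : Pt R n * Pt R n -> \bar R) :
  measurable_fun [set: Pt R n * Pt R n] g -> (forall v, 0 <= g v) ->
  intV (fun z => intV (fun w => g (z, w))) = \int[vol \x vol]_p g p.
Proof.
move=> mg g0; rewrite (fubini_tonelli1 g)//=.
have gE z : intV (fun w => g (z, w)) = fubini_F vol g z.
  by rewrite intVE//; exact: measurableT_comp.
rewrite intVE.
- by apply: eq_integral => x _; exact: gE.
- by under eq_fun do rewrite gE; exact: measurable_fun_fubini_tonelli_F.
- by move=> x; rewrite gE; apply: integral_ge0.
Qed.

Lemma nullVVE (N : set (Pt R n * Pt R n)) :
  nullVV N <-> (vol \x vol).-negligible N.
Proof.
split=> [[M [mM [NM M0]]]|[M [mM M0 NM]]]; exists M; split => //.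
  move: M0; rewrite (intVVE (g := fun p => (\1_M p)%:E)) => [||p].
  - by rewrite integral_indic// setIT.
  - exact/measurable_EFinP.
  - by rewrite lee_fin.
split=> //; rewrite (intVVE (g := fun p => (\1_M p)%:E)) => [||p].
- by rewrite integral_indic// setIT.
- exact/measurable_EFinP.
- by rewrite lee_fin.
Qed.

End intV_theory.

End iterated_integrals.

(** * The kernel *)

Section cabs_theory.
Local Open Scope complex_scope.
Context (R : realType).
Implicit Types w : R[i].

Lemma cabsE w : cabs w = Normc.normc w.
Proof. by case: w. Qed.

Lemma cabs_ge0 w : 0 <= cabs w.
Proof. exact: sqrtr_ge0. Qed.

Lemma cabsM w1 w2 : cabs (w1 * w2) = cabs w1 * cabs w2.
Proof. by rewrite !cabsE Normc.normcM. Qed.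

Lemma cabsV w : cabs w^-1 = (cabs w)^-1.
Proof. by rewrite !cabsE Normc.normcV. Qed.

Lemma cabs_real (x : R) : 0 <= x -> cabs x%:C = x.
Proof. by move=> x0; rewrite /cabs /= expr0n/= addr0 sqrtr_sqr ger0_norm. Qed.

Lemma normRe_le_cabs w : `|complex.Re w| <= cabs w.
Proof. by rewrite /cabs -sqrtr_sqr ler_wsqrtr// lerDl sqr_ge0. Qed.

Lemma normIm_le_cabs w : `|complex.Im w| <= cabs w.
Proof. by rewrite /cabs -sqrtr_sqr ler_wsqrtr// lerDr sqr_ge0. Qed.

Lemma cabs_le w : cabs w <= `|complex.Re w| + `|complex.Im w|.
Proof.
rewrite /cabs -(@ger0_norm _ (`|_| + `|_|)) ?addr_ge0//.
rewrite -sqrtr_sqr ler_wsqrtr// sqrrD !real_normK ?num_real//.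
by rewrite lerD2r lerDl mulrn_wge0// mulr_ge0.
Qed.

Lemma cabs_cpow w c : cabs (cpow w c) = powR (cabs w) c.
Proof.
rewrite /cpow; set th := c * _; rewrite [LHS]/cabs /= !exprMn -mulrDr cos2Dsin2.
by rewrite mulr1 sqrtr_sqr ger0_norm// powR_ge0.
Qed.

Definition carg w : R := atan (complex.Im w / complex.Re w).

(** Dividing by the two powers multiplies the phase by that of angle
    [- (c1 * carg w1 + c2 * carg w2)], and the cosine is even. *)
Lemma Re_div_cpow (A : R) w1 w2 c1 c2 :
  complex.Re (A%:C / (cpow w1 c1 * cpow w2 c2)) =
  A / (powR (cabs w1) c1 * powR (cabs w2) c2) * cos (c1 * carg w1 + c2 * carg w2).
Proof.
rewrite /cpow -!/(carg _) -!/(cabs _).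
set t1 := c1 * _; set t2 := c2 * _; set P1 := powR (cabs w1) c1.
set P2 := powR (cabs w2) c2.
have -> : Complex (P1 * cos t1) (P1 * sin t1) * Complex (P2 * cos t2) (P2 * sin t2)
    = Complex (P1 * P2 * cos (t1 + t2)) (P1 * P2 * sin (t1 + t2)).
  by apply/eqP; rewrite eq_complex /= cosD sinD; apply/andP; split; apply/eqP; ring.
set P := P1 * P2; set t := t1 + t2 => /=.
have -> : (P * cos t) ^+ 2 + (P * sin t) ^+ 2 = P ^+ 2.
  by rewrite !exprMn -mulrDr cos2Dsin2 mulr1.
(* If the modulus of the denominator vanishes, both sides are 0 because [0^-1 = 0]. *)
rewrite mul0r subr0; have [->|P0] := eqVneq P 0; first by rewrite !(mul0r, invr0, mulr0).
by field.
Qed.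

End cabs_theory.

(** * Factorization of the kernels; real and imaginary parts of rho(z,u) *)

Section kernel_theory.
Local Open Scope complex_scope.
Context (R : realType) (n : nat).
Implicit Types z w u e : Pt R n.

(** The one-variable factor: the modulus of either kernel is a product of two of these, one for the
    pair [z], [u] and one for the pair [w], [e]. *)
Definition ker1 (a b c : R) z u : R :=
  powR (rho z) a * powR (rho u) b / powR (cabs (rho2 z u)) c.

Lemma ker1_ge0 a b c z u : 0 <= ker1 a b c z u.
Proof. by rewrite divr_ge0 ?mulr_ge0 ?powR_ge0. Qed.

Lemma kerSE a1 a2 b1 b2 c1 c2 z w u e :
  kerS a1 a2 b1 b2 c1 c2 z w u e = (ker1 a1 b1 c1 z u * ker1 a2 b2 c2 w e)%:C.
Proof.
rewrite /kerS /ker1; congr (_%:C); rewrite invfM.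
set x1 := powR (cabs _) c1; set x2 := powR (cabs _) c2.
by move: x1 x2 => x1 x2; move: x1^-1 x2^-1 => y1 y2; ring.
Qed.

Lemma cabs_kerS a1 a2 b1 b2 c1 c2 z w u e :
  cabs (kerS a1 a2 b1 b2 c1 c2 z w u e) = ker1 a1 b1 c1 z u * ker1 a2 b2 c2 w e.
Proof. by rewrite kerSE cabs_real// mulr_ge0 ?ker1_ge0. Qed.

Lemma cabs_kerT a1 a2 b1 b2 c1 c2 z w u e :
  cabs (kerT a1 a2 b1 b2 c1 c2 z w u e) = ker1 a1 b1 c1 z u * ker1 a2 b2 c2 w e.
Proof.
rewrite -(cabs_kerS) /kerT cabsM cabsV cabsM !cabs_cpow cabs_real ?mulr_ge0 ?powR_ge0//.
by rewrite /kerS cabs_real// ?divr_ge0 ?mulr_ge0 ?powR_ge0.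
Qed.

Lemma Re_kerT a1 a2 b1 b2 c1 c2 z w u e :
  complex.Re (kerT a1 a2 b1 b2 c1 c2 z w u e) =
  ker1 a1 b1 c1 z u * ker1 a2 b2 c2 w e *
  cos (c1 * carg (rho2 z u) + c2 * carg (rho2 w e)).
Proof.
rewrite /kerT Re_div_cpow; congr (_ * _).
by apply: complexI; rewrite -kerSE.
Qed.

Definition sqdist' z u : R := \sum_(j < n.-1)
  ((xco z j - xco u j) ^+ 2 + (yco z j - yco u j) ^+ 2).

Lemma sqdist'_ge0 z u : 0 <= sqdist' z u.
Proof. by apply: sumr_ge0 => j _; rewrite addr_ge0 ?sqr_ge0. Qed.

Lemma Re_sum I (r : seq I) (P : pred I) (F : I -> R[i]) :
  complex.Re (\sum_(i <- r | P i) F i) = \sum_(i <- r | P i) complex.Re (F i).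
Proof. by apply: (big_morph (@complex.Re R)) => // -[? ?] [? ?]. Qed.

Lemma Im_sum I (r : seq I) (P : pred I) (F : I -> R[i]) :
  complex.Im (\sum_(i <- r | P i) F i) = \sum_(i <- r | P i) complex.Im (F i).
Proof. by apply: (big_morph (@complex.Im R)) => // -[? ?] [? ?]. Qed.

Lemma Re_rho2 z u :
  complex.Re (rho2 z u) = (2 * rho z + 2 * rho u + sqdist' z u) / 4.
Proof.
rewrite /rho2; set S := \sum_(j < n.-1) _.
have SE : complex.Re S = \sum_(j < n.-1)
    ((xco z j - xco u j) ^+ 2 - (yco z j + yco u j) ^+ 2).
  by rewrite Re_sum; apply: eq_bigr => j _ /=; rewrite !opprK; ring.
transitivity ((complex.Re S + 2 * (yco z n.-1 + yco u n.-1)) / 4).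
  by case: S {SE} => s1 s2 /=; rewrite !opprK; ring.
rewrite SE mulrC [RHS]mulrC; congr (_ * _); rewrite /rho /sqdist'.
(* From [- (y + v) ^+ 2 = (y - v) ^+ 2 - 2 * y ^+ 2 - 2 * v ^+ 2]: the two last terms are what
   completes the last coordinates to [rho z] and [rho u]. *)
have -> : \sum_(j < n.-1) ((xco z j - xco u j) ^+ 2 - (yco z j + yco u j) ^+ 2) =
  \sum_(j < n.-1) ((xco z j - xco u j) ^+ 2 + (yco z j - yco u j) ^+ 2)
  - 2 * \sum_(j < n.-1) yco z j ^+ 2 - 2 * \sum_(j < n.-1) yco u j ^+ 2.
  rewrite !mulr_sumr -!sumrB; apply: eq_bigr => j _; ring.
by ring.
Qed.

Lemma Im_rho2 z u : complex.Im (rho2 z u) =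
  (\sum_(j < n.-1) (xco z j - xco u j) * (yco z j + yco u j)
   - (xco z n.-1 - xco u n.-1)) / 2.
Proof.
rewrite /rho2; set S := \sum_(j < n.-1) _ ^+ 2.
have SE : complex.Im S = 2 * \sum_(j < n.-1)
    (xco z j - xco u j) * (yco z j + yco u j).
  rewrite Im_sum mulr_sumr; apply: eq_bigr => j _ /=; rewrite !opprK; ring.
transitivity ((complex.Im S - 2 * (xco z n.-1 - xco u n.-1)) / 4).
  by case: S {SE} => s1 s2 /=; rewrite !opprK; field.
by rewrite SE; field.
Qed.

Lemma Re_rho2_gt0 z u : TB z -> TB u -> 0 < complex.Re (rho2 z u).
Proof.
rewrite /TB /= => z0 u0; rewrite Re_rho2 divr_gt0// ltr_pwDl ?sqdist'_ge0//.
by rewrite addr_gt0 ?mulr_gt0.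
Qed.

Lemma cabs_rho2_gt0 z u : TB z -> TB u -> 0 < cabs (rho2 z u).
Proof.
move=> z0 u0; apply: lt_le_trans (normRe_le_cabs _).
by rewrite gtr0_norm ?Re_rho2_gt0.
Qed.

End kernel_theory.

(** * Measurability of the domain and of the kernel *)

Section measurability.
Local Open Scope complex_scope.
Context (R : realType) (n : nat).

Lemma measurable_xco j : measurable_fun [set: Pt R n] (fun z => xco z j).
Proof.
have [jn|nj] := ltnP j n; last first.
  rewrite (_ : (fun z => _) = cst 0)//; apply/funext => z /=.
  by rewrite /xco nth_default// size_tuple.
rewrite (_ : (fun z => _) = (fun v : n.-tuple R => tnth v (Ordinal jn)) \o fst).
  by apply: measurableT_comp => //; exact: measurable_tnth.
by apply/funext => z /=; rewrite /xco (tnth_nth 0).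
Qed.

Lemma measurable_yco j : measurable_fun [set: Pt R n] (fun z => yco z j).
Proof.
have [jn|nj] := ltnP j n; last first.
  rewrite (_ : (fun z => _) = cst 0)//; apply/funext => z /=.
  by rewrite /yco nth_default// size_tuple.
rewrite (_ : (fun z => _) = (fun v : n.-tuple R => tnth v (Ordinal jn)) \o snd).
  by apply: measurableT_comp => //; exact: measurable_tnth.
by apply/funext => z /=; rewrite /yco (tnth_nth 0).
Qed.

Lemma measurable_rho : measurable_fun [set: Pt R n] (@rho R n).
Proof.
apply: measurable_funB; first exact: measurable_yco.
apply: measurable_sum => j; apply: measurable_funX; exact: measurable_yco.
Qed.

Lemma measurable_TB : measurable (@TB R n).
Proof.
rewrite [X in measurable X](_ : _ = @rho R n @^-1` `]0, +oo[).
  by rewrite -[X in measurable X]setTI; exact: measurable_rho.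
by apply/seteqP; split => z /=; rewrite in_itv/= andbT.
Qed.

Lemma measurable_cabs d (T : measurableType d) (f : T -> R[i]) :
  measurable_fun setT (fun x => complex.Re (f x)) ->
  measurable_fun setT (fun x => complex.Im (f x)) ->
  measurable_fun [set: T] (fun x => cabs (f x)).
Proof.
move=> mr mi; have ms := continuous_measurable_fun (@sqrt_continuous R).
apply: (measurableT_comp ms).
by apply: measurable_funD; exact: measurable_funX.
Qed.

Lemma measurable_cabs_rho2 z : measurable_fun [set: Pt R n] (fun u => cabs (rho2 z u)).
Proof.
apply: measurable_cabs.
- under eq_fun do rewrite Re_rho2 /sqdist'; apply: measurable_funM => //.
  apply: measurable_funD; first apply: measurable_funD => //.
    by apply: measurable_funM => //; exact: measurable_rho.
  apply: measurable_sum => j; apply: measurable_funD; apply: measurable_funX;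
    apply: measurable_funB => //; [exact: measurable_xco|exact: measurable_yco].
- under eq_fun do rewrite Im_rho2; apply: measurable_funM => //.
  apply: measurable_funB.
    apply: measurable_sum => j; apply: measurable_funM.
      by apply: measurable_funB => //; exact: measurable_xco.
    by apply: measurable_funD => //; exact: measurable_yco.
  by apply: measurable_funB => //; exact: measurable_xco.
Qed.

Lemma measurable_ker1 a b c z : measurable_fun [set: Pt R n] (ker1 a b c z).
Proof.
have mp := @measurable_powR R.
apply: measurable_funM.
  by apply: measurable_funM => //; apply: measurableT_comp (mp b) measurable_rho.
rewrite (_ : (fun u => _) = (fun u => powR (cabs (rho2 z u)) (- c))).
  exact: measurableT_comp (mp (- c)) (measurable_cabs_rho2 z).
by apply/funext => u; rewrite powRN.
Qed.

End measurability.

(** * One-dimensional integrals *)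

Section powR_integrals.
Context (R : realType).
Local Notation mu := (@lebesgue_measure R).

(** The image of Lebesgue measure under a translation agrees with it on half-open intervals, which
    determine it. *)
Lemma ge0_integral_translation (f : R -> \bar R) (a : R) :
  measurable_fun [set: R] f -> (forall x, 0 <= f x)%E ->
  (\int[mu]_x f (x - a)%R = \int[mu]_x f x)%E.
Proof.
move=> mf f0; pose phi (x : measurableTypeR R) : measurableTypeR R := x - a.
have mphi : measurable_fun [set: measurableTypeR R] phi.
  by apply: measurable_funB.
transitivity (\int[pushforward mu phi]_x f x)%E.
  by rewrite (ge0_integral_pushforward mphi).
apply: eq_measure_integral => /= A mA _; apply/esym/lebesgue_measure_unique => //=.
move=> _ [[b c]] _ <-; rewrite /pushforward.
have -> : phi @^-1` `]b, c] = `](b + a), (c + a)]%classic.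
  by apply/seteqP; split => x /=; rewrite !in_itv/= /phi ltrBrDr lerBlDr.
rewrite !lebesgue_measure_itv/= !lte_fin ltrD2r.
by case: ifP => // _; rewrite -!EFinB; congr EFin; ring.
Qed.

Lemma cvg_powR_pinfty (p : R) : 0 < p -> powR x (- p) @[x --> +oo] --> 0.
Proof.
move=> p0; apply/cvgr0Pnorm_lt => e e0.
near=> x.
have x0 : 0 < x by near: x; exact: nbhs_pinfty_gt.
rewrite ger0_norm ?powR_ge0// powRN invf_plt ?posrE ?powR_gt0//.
have -> : e^-1 = (e^-1 `^ p^-1) `^ p.
  by rewrite -powRrM mulVf ?gt_eqF// powRr1// invr_ge0 ltW.
apply: gt0_ltr_powR => //; rewrite ?nnegrE ?powR_ge0 ?(ltW x0)//.
Unshelve. all: by end_near. Qed.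

Lemma continuous_powRl (p x : R) : 0 < x -> {for x, continuous (@powR R ^~ p)}.
Proof.
move=> x0; apply: differentiable_continuous; apply/derivable1_diffP.
by apply: derivable_powR; rewrite in_itv/= x0.
Qed.

Lemma is_derive_powR_div (p x : R) : 0 < x -> p != 0 ->
  is_derive x 1 (fun y => powR y p / p) (powR x (p - 1)).
Proof.
move=> x0 p0.
have := is_deriveM (is_derive1_powR p x0) (is_derive_cst (p^-1) x 1).
rewrite scaler0 add0r /GRing.scale/= mulrA mulVf// mul1r.
exact.
Qed.

Lemma integral_powR_tail (s k : R) : 0 < s -> 1 < k ->
  (\int[mu]_(x in `[s, +oo[) (powR x (- k))%:E = (powR s (1 - k) / (k - 1))%:E)%E.
Proof.
move=> s0 k1; pose F x : R := powR x (1 - k) / (1 - k).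
have k0 : 1 - k != 0 by rewrite subr_eq0 lt_eqF.
have dF (x : R) : 0 < x -> is_derive x 1 F (powR x (- k)).
  move=> x0; have := is_derive_powR_div x0 k0.
  by rewrite (_ : 1 - k - 1 = - k)//; ring.
rewrite (@ge0_continuous_FTC2y _ _ F s 0).
- by rewrite -EFinB sub0r /F; congr EFin; rewrite -mulrN -invrN opprB.
- by move=> x sx; exact: powR_ge0.
- apply: continuous_in_subspaceT => x; rewrite inE/= in_itv/= andbT => sx.
  by apply: continuous_powRl; exact: lt_le_trans s0 sx.
- rewrite /F -[X in _ --> X](mul0r (1 - k)^-1); apply: cvgM; last exact: cvg_cst.
  rewrite -opprB; apply: cvg_powR_pinfty; by rewrite subr_gt0.
- move=> x sx; have [] := dF x (lt_trans s0 sx); done.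
- apply: cvg_at_right_filter; apply: differentiable_continuous.
  by apply/derivable1_diffP; have [] := dF s s0.
- move=> x; rewrite in_itv/= andbT => sx; rewrite derive1E.
  by have [_ ->] := dF x (lt_trans s0 sx).
Qed.

(** The integrand may blow up at 0, so the fundamental theorem of calculus is applied on intervals
    away from 0 and the bound passes to the monotone limit. *)
Lemma integral_powR_head (r b : R) : 0 < r -> -1 < b ->
  (\int[mu]_(x in `]0%R, r]) (powR x b)%:E <= (powR r (b + 1) / (b + 1))%:E)%E.
Proof.
move=> r0 b1; pose F x : R := powR x (b + 1) / (b + 1).
have b0 : b + 1 != 0 by rewrite gt_eqF// -ltrBlDr sub0r.
have dF (x : R) : 0 < x -> is_derive x 1 F (powR x b).
  by move=> x0; have := is_derive_powR_div x0 b0; rewrite addrK.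
have F0 (x : R) : 0 <= F x by rewrite divr_ge0 ?powR_ge0// -lerBlDr sub0r ltW.
(* The index [i.+2] keeps every interval nondegenerate, [i = 0] included. *)
pose I (i : nat) : set R := `[r / i.+2%:R, r]%classic.
have IU : \bigcup_i I i = `]0, r]%classic.
  apply/seteqP; split => x /=.
    move=> [i _]; rewrite /I/= !in_itv/= => /andP[ix ->]; rewrite andbT.
    by apply: lt_le_trans ix; rewrite divr_gt0.
  rewrite in_itv/= => /andP[x0 xr].
  exists (Num.truncn (r / x)) => //; rewrite /I/= in_itv/= xr andbT.
  rewrite ler_pdivrMr// -ler_pdivrMl// mulrC ltW//.
  apply: lt_le_trans (truncnS_gt _) _; by rewrite ler_nat.
have ndI : nondecreasing_seq I.
  move=> i j ij; rewrite subsetEset => x /=; rewrite /I/= !in_itv/=.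
  move=> /andP[ix ->]; rewrite andbT; apply: le_trans ix.
  by rewrite ler_pM2l// lef_pV2 ?posrE// ler_nat !ltnS.
have mf : measurable_fun [set: R] (fun x : R => (powR x b)%:E).
  by apply/measurable_EFinP; exact: measurable_powR.
have := @ge0_nondecreasing_set_cvg_integral _ (measurableTypeR R) R I
  (fun x => (powR x b)%:E) mu ndI (fun i => measurable_itv _)
  (fun i => measurable_funS measurableT (@subsetT _ _) mf)
  (fun i x _ => powR_ge0 _ _).
rewrite IU => cvgI; rewrite -(cvg_lim _ cvgI)//; apply: lime_le.
  by apply/cvg_ex; exists (\int[mu]_(x in `]0%R, r]) (powR x b)%:E)%E.
apply: nearW => i; rewrite /I.
have i0 : 0 < r / i.+2%:R by rewrite divr_gt0.
have ir : r / i.+2%:R < r.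
  by rewrite ltr_pdivrMr// ltr_pMr// ltr1n.
rewrite (@continuous_FTC2 _ _ F)//.
- by rewrite -EFinB lee_fin lerBlDr lerDl.
- apply: continuous_in_subspaceT => x; rewrite inE/= in_itv/= => /andP[ix _].
  by apply: continuous_powRl; exact: lt_le_trans i0 ix.
- split.
  + move=> x; rewrite in_itv/= => /andP[ix _].
    by have [] := dF x (lt_trans i0 ix).
  + apply: cvg_at_right_filter; apply: differentiable_continuous.
    by apply/derivable1_diffP; have [] := dF _ i0.
  + apply: cvg_at_left_filter; apply: differentiable_continuous.
    by apply/derivable1_diffP; have [] := dF _ r0.
- move=> x; rewrite in_itv/= => /andP[ix _]; rewrite derive1E.
  by have [_ ->] := dF x (lt_trans i0 ix).
Qed.

End powR_integrals.

(** * Integrals of shifted powers, uniformly in the centre *)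

Section translated_integrals.
Context (R : realType).

Lemma gt0_powRD (x p q : R) : 0 < x -> powR x (p + q) = powR x p * powR x q.
Proof. by move=> x0; rewrite powRD//; apply/implyP => _; rewrite gt_eqF. Qed.

(** This is [(Num.sqrt r + |s|) ^+ 2 <= 2 * (r + s ^+ 2)] raised to a negative power. It reduces a
    quadratic distance with exponent [g] to a linear one with exponent [2 * g], whence the critical
    exponent one half. *)
Lemma powR_addsqr_le (r s g : R) : 0 < r -> 0 < g ->
  powR (r + s ^+ 2) (- g) <= powR 2 g * powR (Num.sqrt r + `|s|) (- (2 * g)).
Proof.
move=> r0 g0; set q := Num.sqrt r + `|s|.
have q0 : 0 < q by rewrite ltr_pwDl// sqrtr_gt0.
have h0 : 0 < r + s ^+ 2 by rewrite ltr_pwDl ?sqr_ge0.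
rewrite !powRN ler_pdivlMr ?powR_gt0// mulrC ler_pdivrMr ?powR_gt0//.
rewrite -powRM ?(ltW h0)// powRrM -[2 in leLHS]/(2%:R) powR_mulrn ?(ltW q0)//.
apply: ge0_ler_powR; rewrite ?nnegrE ?sqr_ge0 ?mulr_ge0 ?(ltW h0) ?(ltW g0)//.
rewrite -[r in leRHS](sqr_sqrtr (ltW r0)) -(real_normK (num_real s)) /q.
have := sqr_ge0 (Num.sqrt r - `|s|); nra.
Qed.
Local Notation mu := (@lebesgue_measure R).
Local Open Scope ereal_scope.

Lemma measurable_powR_comp (f : R -> R) (p : R) :
  measurable_fun [set: R] f -> measurable_fun [set: R] (fun x => powR (f x) p).
Proof. exact: measurableT_comp (@measurable_powR R p). Qed.

Lemma emeasurable_powRl (p : R) : measurable_fun [set: R] (fun x => (powR x p)%:E).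
Proof. by apply/measurable_EFinP; exact: measurable_powR. Qed.

Lemma emeasurable_powRl_restrict (p : R) (i : interval R) :
  measurable_fun [set: R] ((fun x => (powR x p)%:E) \_ [set` i]).
Proof.
have mi : measurable ([set` i] : set R) by exact: measurable_itv.
apply/(measurable_restrictT _ mi); exact: measurable_funTS (emeasurable_powRl _).
Qed.

Lemma integral_powR_shift (r g : R) : (0 < r)%R -> (1 < g)%R ->
  \int[mu]_(x in `[0%R, +oo[) (powR (r + x) (- g))%:E = (powR r (1 - g) / (g - 1))%:E.
Proof.
move=> r0 g1; rewrite -(integral_powR_tail r0 g1) [RHS]integral_mkcond.
rewrite -(@ge0_integral_translation R _ (- r)).
- rewrite integral_mkcond; apply: eq_integral => x _; rewrite !patchE opprK.
  by rewrite !mem_setE !in_itv/= !andbT lerDr addrC.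
- exact: emeasurable_powRl_restrict.
- by apply: erestrict_ge0 => x _; rewrite lee_fin powR_ge0.
Qed.

(** After translation the two half-lines contribute equally. The constant depends neither on [r] nor
    on the centre [a], which will depend on other coordinates. *)
Lemma integral_powR_norm (g : R) : (1 < g)%R ->
  exists2 C : R, (0 <= C)%R & forall r a : R, (0 < r)%R ->
  \int[mu]_x (powR (r + `|x - a|) (- g))%:E <= (C * powR r (1 - g))%:E.
Proof.
move=> g1; exists ((g - 1)^-1 + (g - 1)^-1)%R => [|r a r0].
  by rewrite addr_ge0// invr_ge0 subr_ge0 ltW.
have mf : measurable_fun [set: R] (fun x => (powR (r + `|x|) (- g))%:E).
  apply/measurable_EFinP; apply: measurable_powR_comp; apply: measurable_funD => //.
have f0 (x : R) : 0 <= (powR (r + `|x|) (- g))%:E by rewrite lee_fin powR_ge0.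
rewrite (@ge0_integral_translation R (fun x => (powR (r + `|x|) (- g))%:E))//.
have half : \int[mu]_(x in `[0%R, +oo[) (powR (r + `|x|) (- g))%:E =
    (powR r (1 - g) / (g - 1))%:E.
  rewrite -(integral_powR_shift r0 g1); apply: eq_integral => x.
  by rewrite mem_setE in_itv/= andbT => x0; rewrite ger0_norm.
have neg : \int[mu]_(x in `]-oo, 0%R]) (powR (r + `|x|) (- g))%:E =
    (powR r (1 - g) / (g - 1))%:E.
  rewrite -half ge0_integration_by_substitution0//.
  by apply: eq_integral => x _; rewrite normrN.
rewrite (_ : [set: R] = `]-oo, 0%R] `|` `]0%R, +oo[); last first.
  apply/seteqP; split => x //= _; rewrite !in_itv/= andbT.
  by case: leP => _; [left|right].
rewrite ge0_integral_setU//=; last 2 first.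
- exact: measurable_funTS.
- apply/disj_setPS => x [] /=; rewrite !in_itv/= andbT => x0.
  by rewrite ltNge x0.
rewrite neg integral_itv_obnd_cbnd; last exact: measurable_funTS.
by rewrite half -EFinD lee_fin mulrDl ![(_ * powR r _)%R]mulrC.
Qed.

Lemma integral_powR_sqr (g : R) : (2^-1 < g)%R ->
  exists2 C : R, (0 <= C)%R & forall r a : R, (0 < r)%R ->
  \int[mu]_x (powR (r + (x - a) ^+ 2) (- g))%:E <= (C * powR r (2^-1 - g))%:E.
Proof.
move=> g1; have g2 : (1 < 2 * g)%R by lra.
have [C C0 HC] := integral_powR_norm g2.
have g0 : (0 < g)%R by lra.
exists (powR 2 g * C)%R => [|r a r0]; first by rewrite mulr_ge0 ?powR_ge0.
have s0 : (0 < Num.sqrt r)%R by rewrite sqrtr_gt0.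
apply: (@le_trans _ _ (\int[mu]_x ((powR 2 g)%:E *
    (powR (Num.sqrt r + `|x - a|) (- (2 * g)))%:E))).
  apply: ge0_le_integral_nomeas => x; first by rewrite lee_fin powR_ge0.
  rewrite -EFinM lee_fin.
  exact: powR_addsqr_le.
have ms : measurable_fun [set: R] (fun x =>
    (powR (Num.sqrt r + `|x - a|) (- (2 * g)))%:E).
  apply/measurable_EFinP; apply: measurable_powR_comp; apply: measurable_funD => //.
  by apply: measurableT_comp => //; exact: measurable_funB.
rewrite ge0_integralZl//.
rewrite -mulrA EFinM lee_pmul2l ?lte_fin ?powR_gt0//.
apply: le_trans (HC _ a s0) _; rewrite lee_fin ler_wpM2l//.
rewrite -powR12_sqrt ?(ltW r0)// -powRrM.
by rewrite (_ : 2^-1 * (1 - 2 * g) = 2^-1 - g)%R//; field.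
Qed.

(** The half-line is cut at distance [r] from [a]. Up to there [r + (x - a)] is at least [r] and
    [-1 < b] gives convergence; beyond, it is at least [x - a] and [b + 1 < g] gives convergence. *)
Lemma integral_powR_half_line (b g : R) : (-1 < b)%R -> (b + 1 < g)%R ->
  exists2 C : R, (0 <= C)%R & forall r a : R, (0 < r)%R ->
  \int[mu]_x (if (a < x)%R then powR (x - a) b * powR (r + (x - a)) (- g) else 0)%:E
    <= (C * powR r (b + 1 - g))%:E.
Proof.
move=> b1 bg; have g0 : (0 < g)%R by lra.
have b0 : (0 < b + 1)%R by lra.
exists ((b + 1)^-1 + (g - b - 1)^-1)%R => [|r a r0].
  by rewrite addr_ge0// invr_ge0; lra.
pose f (x : R) : R := if (0 < x)%R then (powR x b * powR (r + x) (- g))%R else 0%R.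
have mf : measurable_fun [set: R] f.
  apply: measurable_fun_ifT => //.
    by apply: measurable_fun_ltr.
  apply: measurable_funM; first exact: measurable_powR.
  by apply: measurable_powR_comp; exact: measurable_funD.
have f0 (x : R) : (0 <= f x)%R by rewrite /f; case: ifP => // _; rewrite mulr_ge0 ?powR_ge0.
rewrite [leLHS](_ : _ = \int[mu]_x (f (x - a)%R)%:E); last first.
  by apply: eq_integral => x _; rewrite /f subr_gt0.
rewrite (@ge0_integral_translation R (EFin \o f))//; last exact/measurable_EFinP.
pose f1 (x : R) : \bar R := (powR r (- g))%:E * ((fun x => (powR x b)%:E) \_ `]0%R, r]) x.
pose f2 : R -> \bar R := (fun x => (powR x (- (g - b)))%:E) \_ `[r, +oo[.
have m1 := emeasurable_powRl_restrict b `]0%R, r].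
have m2 : measurable_fun [set: R] f2 by exact: emeasurable_powRl_restrict.
have p10 x : 0 <= ((fun x => (powR x b)%:E) \_ `]0%R, r]) x.
  by apply: erestrict_ge0 => y _; rewrite lee_fin powR_ge0.
have f10 x : 0 <= f1 x by rewrite mule_ge0// lee_fin powR_ge0.
have f20 x : 0 <= f2 x by apply: erestrict_ge0 => y _; rewrite lee_fin powR_ge0.
apply: (@le_trans _ _ (\int[mu]_x (f1 x + f2 x))).
  apply: ge0_le_integral_nomeas => x; first by rewrite lee_fin.
  rewrite /= /f; case: ifPn => x0; last by rewrite adde_ge0.
  have [xr|rx] := leP x r.
    rewrite -[leLHS]adde0 leeD// /f1 patchE mem_setE in_itv/= x0 xr/=.
    rewrite -EFinM lee_fin mulrC ler_wpM2r ?powR_ge0// !powRN.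
    rewrite lef_pV2 ?posrE ?powR_gt0 ?addr_gt0//.
    apply: ge0_ler_powR; rewrite ?nnegrE; lra.
  rewrite -[leLHS]add0e leeD// /f2 patchE mem_setE in_itv/= (ltW rx)/=.
  have -> : powR x (- (g - b)) = (powR x b * powR x (- g))%R.
    by rewrite opprB gt0_powRD.
  rewrite lee_fin ler_wpM2l ?powR_ge0// !powRN.
  rewrite lef_pV2 ?posrE ?powR_gt0 ?addr_gt0//.
  apply: ge0_ler_powR; rewrite ?nnegrE; lra.
rewrite ge0_integralD//; last first.
  by apply: measurable_funeM.
rewrite ge0_integralZl//; last by rewrite lee_fin powR_ge0.
rewrite -!integral_mkcond integral_powR_tail//; last by lra.
apply: (@le_trans _ _ ((powR r (- g))%:E * (powR r (b + 1) / (b + 1))%:E +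
  (powR r (1 - (g - b)) / (g - b - 1))%:E)).
  by apply: leeD => //; rewrite lee_pmul2l ?lte_fin ?powR_gt0//; exact: integral_powR_head.
rewrite -EFinM -EFinD lee_fin mulrA -gt0_powRD//.
rewrite (_ : - g + (b + 1) = b + 1 - g)%R; last by ring.
rewrite (_ : 1 - (g - b) = b + 1 - g)%R; last by ring.
by rewrite mulrDl ![(_ * powR r _)%R]mulrC.
Qed.

End translated_integrals.

(** * The kernel integral *)

Section iterated_products.
Context (R : realType).
Local Notation mu := (@lebesgue_measure R).

(* The last factor may depend on the previous coordinates as long as its
   integral is bounded uniformly in them: no exchange of integrals is needed. *)
Lemma iint_prod_le m (F : nat -> R -> R) (G : seq R -> R -> R) (A B c : R) :
  0 <= c -> 0 <= B -> (forall j t, 0 <= F j t) -> (forall s t, 0 <= G s t) ->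
  (forall j, measurable_fun [set: R] (F j)) ->
  (forall s, measurable_fun [set: R] (G s)) ->
  (forall j, \int[mu]_x (F j x)%:E <= A%:E)%E ->
  (forall s, \int[mu]_x (G s x)%:E <= B%:E)%E ->
  (iint (fun v : m.+1.-tuple R =>
    (c * (\prod_(j < m) F j (nth 0 v j)) * G (take m v) (nth 0 v m))%:E)
  <= (c * A ^+ m * B)%:E)%E.
Proof.
move=> c0 B0 F0 G0 mF mG AF BG.
elim: m F G c c0 F0 G0 mF mG AF BG => [|m IH] F G c c0 F0 G0 mF mG AF BG.
  rewrite /= expr0 mulr1.
  under eq_integral do rewrite big_ord0 mulr1 EFinM.
  rewrite ge0_integralZl//.
  - by rewrite EFinM lee_wpmul2l.
  - by apply/measurable_EFinP; exact: mG.
  - by move=> x _; rewrite lee_fin.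
have A0 : 0 <= A.
  rewrite -lee_fin; apply: le_trans (AF 0%N); apply: integral_ge0 => x _.
  by rewrite lee_fin.
rewrite iintS; apply: (@le_trans _ _ (\int[mu]_t ((c * A ^+ m * B)%:E * (F 0%N t)%:E))%E).
  apply: ge0_le_integral_nomeas => t.
    apply: iint_ge0 => v; rewrite lee_fin !mulr_ge0//.
    by apply: prodr_ge0 => j _.
  have cF : 0 <= c * F 0%N t by rewrite mulr_ge0.
  have := IH (fun j => F j.+1) (fun s => G (t :: s)) (c * F 0%N t) cF (fun j => F0 j.+1)
    (fun s => G0 (t :: s)) (fun j => mF j.+1) (fun s => mG (t :: s))
    (fun j => AF j.+1) (fun s => BG (t :: s)).
  rewrite (_ : c * F 0%N t * A ^+ m * B = c * A ^+ m * B * F 0%N t); last by ring.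
  apply: le_trans; rewrite le_eqVlt; apply/orP; left; apply/eqP.
  by apply: eq_iint => v; rewrite big_ord_recl/= !mulrA.
rewrite ge0_integralZl//.
- rewrite [leRHS](_ : _ = (c * A ^+ m * B)%:E * A%:E)%E; last first.
    by rewrite -EFinM; congr EFin; rewrite exprSr; ring.
  by rewrite lee_wpmul2l// lee_fin !mulr_ge0// exprn_ge0.
- by apply/measurable_EFinP; exact: mF.
- by move=> x _; rewrite lee_fin.
- by rewrite lee_fin !mulr_ge0// exprn_ge0.
Qed.

End iterated_products.

(** * Integration of the kernel over the tube domain *)

Section kernel_integral.
Context (R : realType) (m : nat).
Implicit Types z u : Pt R m.+1.

(* Up to a multiple of the squared distance, Im (rho2 z u) does not involve
   the variables [yco u j]. *)
Definition imcenter z (s : seq R) : R :=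
  xco z m - 2 * \sum_(j < m) (xco z j - nth 0 s j) * yco z j.

(** Writing [y_j + t_j] as [2 * y_j - (y_j - t_j)] in the imaginary part isolates [imcenter]. The
    remaining products of differences are absorbed by the squared distance, since
    [2 * |p * q| <= p ^+ 2 + q ^+ 2]. *)
Lemma Im_rho2_imcenter z u :
  `|xco u m - imcenter z (take m u.1)| <=
  2 * cabs (rho2 z u) + sqdist' z u / 2.
Proof.
have -> : xco u m - imcenter z (take m u.1) =
    2 * complex.Im (rho2 z u)
    + \sum_(j < m) (xco z j - xco u j) * (yco z j - yco u j).
  rewrite Im_rho2 /imcenter /=.
  have -> : \sum_(j < m) (xco z j - nth 0 (take m u.1) j) * yco z j =
            \sum_(j < m) (xco z j - xco u j) * yco z j.
    by apply: eq_bigr => j _; rewrite nth_take.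
  have -> : \sum_(j < m) (xco z j - xco u j) * (yco z j + yco u j) =
    2 * (\sum_(j < m) (xco z j - xco u j) * yco z j)
    - \sum_(j < m) (xco z j - xco u j) * (yco z j - yco u j).
    rewrite mulr_sumr -sumrB; apply: eq_bigr => j _; ring.
  by field.
apply: le_trans (ler_normD _ _) _; apply: lerD.
  by rewrite normrM ger0_norm// ler_wpM2l// normIm_le_cabs.
apply: le_trans (ler_norm_sum _ _ _) _; rewrite /sqdist' /= mulr_suml.
apply: ler_sum => j _; rewrite normrM.
rewrite -[(xco z j - xco u j) ^+ 2](real_normK (num_real _)).
rewrite -[(yco z j - yco u j) ^+ 2](real_normK (num_real _)).
have := sqr_ge0 (`|xco z j - xco u j| - `|yco z j - yco u j|); nra.
Qed.

Section pointwise.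
Variables (z u : Pt R m.+1).
Hypotheses (z0 : TB z) (u0 : TB u).
Let W := cabs (rho2 z u).

Let ReW : 2 * rho z + 2 * rho u + sqdist' z u <= 4 * W.
Proof.
rewrite -ler_pdivrMl// mulrC -Re_rho2.
by apply: le_trans (normRe_le_cabs _); exact: ler_norm.
Qed.

(** The constant 8 is not sharp; it is a common one for this bound and the next three, so that the
    factors can be multiplied without bookkeeping. *)
Lemma rho_le_cabs_rho2 : rho z + rho u <= 8 * W.
Proof.
by move: ReW z0 u0 (sqdist'_ge0 z u); rewrite /TB/=; nra.
Qed.

Lemma sqr_le_sqdist' (j : 'I_m) :
  (xco u j - xco z j) ^+ 2 <= sqdist' z u /\ (yco u j - yco z j) ^+ 2 <= sqdist' z u.
Proof.
rewrite /sqdist' (bigD1 j)//= -(sqrrN (xco u j - _)) -(sqrrN (yco u j - _)) !opprB.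
set S := \sum_(_ < _ | _) _; have S0 : 0 <= S.
  by apply: sumr_ge0 => i _; rewrite addr_ge0 ?sqr_ge0.
have := sqr_ge0 (xco z j - xco u j); have := sqr_ge0 (yco z j - yco u j).
by split; lra.
Qed.

Lemma xdist_le_cabs_rho2 (j : 'I_m) : rho z + (xco u j - xco z j) ^+ 2 <= 8 * W.
Proof.
have [+ _] := sqr_le_sqdist' j.
by move: ReW z0 u0 (sqdist'_ge0 z u); rewrite /TB/=; nra.
Qed.

Lemma ydist_le_cabs_rho2 (j : 'I_m) : rho z + (yco u j - yco z j) ^+ 2 <= 8 * W.
Proof.
have [_ +] := sqr_le_sqdist' j.
by move: ReW z0 u0 (sqdist'_ge0 z u); rewrite /TB/=; nra.
Qed.

Lemma imcenter_le_cabs_rho2 :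
  rho z + `|xco u m - imcenter z (take m u.1)| <= 8 * W.
Proof.
have := Im_rho2_imcenter z u; rewrite -/W.
by move: ReW z0 u0 (sqdist'_ge0 z u); rewrite /TB/=; nra.
Qed.

End pointwise.

Lemma powR_le_div (X W t : R) : 0 < X -> X <= 8 * W -> 0 < t ->
  powR W (- t) <= powR 8 t * powR X (- t).
Proof.
move=> X0 XW t0; have W0 : 0 < W by lra.
rewrite !powRN ler_pdivlMr ?powR_gt0// mulrC ler_pdivrMr ?powR_gt0//.
rewrite -powRM ?(ltW W0)//; apply: ge0_ler_powR; rewrite ?nnegrE; lra.
Qed.

Lemma kernel_integral (b c : R) : -1 < b -> m.+1%:R + 1 + b < c ->
  exists2 C : R, 0 <= C & forall z, TB z ->
  (intV (fun u => (\1_(@TB R m.+1) u * (powR (rho u) b / powR (cabs (rho2 z u)) c))%:E)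
   <= (C * powR (rho z) (m.+1%:R + 1 + b - c))%:E)%E.
Proof.
move=> b1 bc; pose d := c - (m.+1%:R + 1 + b).
have d0 : 0 < d by rewrite /d; lra.
(* The critical exponents of the one-dimensional integrals are [b + 1], [1] and, [2 * m] times,
   [2^-1]; they add up to [m.+1 + 1 + b]. The excess [d] of [c] over this sum is shared equally by
   the [2 * m.+1] factors, each of which then contributes [rho z] to the power [- e]. *)
pose e := d / (2 * m.+1%:R).
have m0 : 0 < m.+1%:R :> R by rewrite ltr0n.
have e0 : 0 < e by rewrite divr_gt0// mulr_gt0.
have de : e * m.+1%:R * 2 = d by rewrite /e; field; rewrite gt_eqF.
pose t0 := b + 1 + e; pose t1 := 2^-1 + e; pose t2 := 1 + e.
have [C0 C00 H0] := @integral_powR_half_line R b t0 b1 (ltac:(rewrite /t0; lra)).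
have [C1 C10 H1] := @integral_powR_sqr R t1 (ltac:(rewrite /t1; lra)).
have [C2 C20 H2] := @integral_powR_norm R t2 (ltac:(rewrite /t2; lra)).
pose C := C0 + C1 + C2.
have CC0 : 0 <= C by rewrite !addr_ge0.
exists (powR 8 c * C ^+ m * C * (C ^+ m * C)).
  by rewrite !mulr_ge0 ?powR_ge0 ?exprn_ge0.
move=> z z0; have r0 : 0 < rho z := z0.
pose A := C * powR (rho z) (- e).
have A0 : 0 <= A by rewrite mulr_ge0// powR_ge0.
pose FX j x := powR (rho z + (x - xco z j) ^+ 2) (- t1).
pose FY j x := powR (rho z + (x - yco z j) ^+ 2) (- t1).
pose GX s x := powR (rho z + `|x - imcenter z s|) (- t2).
pose S (s : seq R) := \sum_(j < m) nth 0 s j ^+ 2.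
(* At the last imaginary coordinate [x], with the previous ones in [s], the difference [x - S s] is
   [rho u], and the test is membership in the domain. *)
pose GY s x := if S s < x then powR (x - S s) b * powR (rho z + (x - S s)) (- t0) else 0.
have FX0 j t : 0 <= FX j t by exact: powR_ge0.
have FY0 j t : 0 <= FY j t by exact: powR_ge0.
have GX0 j t : 0 <= GX j t by exact: powR_ge0.
have GY0 j t : 0 <= GY j t.
  by rewrite /GY; case: ifP => // _; rewrite mulr_ge0 ?powR_ge0.
have msq (a : R) : measurable_fun [set: R] (fun x => powR (rho z + (x - a) ^+ 2) (- t1)).
  apply: measurable_powR_comp; apply: measurable_funD => //.
  by apply: measurable_funX; exact: measurable_funB.
have mFX j : measurable_fun [set: R] (FX j) by exact: msq.
have mFY j : measurable_fun [set: R] (FY j) by exact: msq.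
have mGX s : measurable_fun [set: R] (GX s).
  apply: measurable_powR_comp; apply: measurable_funD => //.
  by apply: measurableT_comp => //; exact: measurable_funB.
have mGY s : measurable_fun [set: R] (GY s).
  apply: measurable_fun_ifT => //; first exact: measurable_fun_ltr.
  apply: measurable_funM; apply: measurable_powR_comp; first exact: measurable_funB.
  by apply: measurable_funD => //; exact: measurable_funB.
have leA (x D : R) : 0 <= D -> D <= C -> D * powR (rho z) (- e) <= A.
  by move=> D0 DC; rewrite ler_wpM2r// powR_ge0.
have t1E : 2^-1 - t1 = - e by rewrite /t1; ring.
have t2E : 1 - t2 = - e by rewrite /t2; ring.
have t0E : b + 1 - t0 = - e by rewrite /t0; ring.
have IF (a : R) : (\int[@lebesgue_measure R]_x (powR (rho z + (x - a) ^+ 2) (- t1))%:E <= A%:E)%E.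
  apply: le_trans (H1 _ a r0) _; rewrite t1E lee_fin leA// /C; lra.
have IGX s : (\int[@lebesgue_measure R]_x (GX s x)%:E <= A%:E)%E.
  apply: le_trans (H2 _ _ r0) _; rewrite t2E lee_fin leA// /C; lra.
have IGY s : (\int[@lebesgue_measure R]_x (GY s x)%:E <= A%:E)%E.
  apply: le_trans (H0 _ _ r0) _; rewrite t0E lee_fin leA// /C; lra.
pose PX (x : seq R) := \prod_(j < m) FX j (nth 0 x j).
pose PY (x : seq R) := \prod_(j < m) FY j (nth 0 x j).
have PX0 x : 0 <= PX x by apply: prodr_ge0.
have PY0 x : 0 <= PY x by apply: prodr_ge0.
have pointwise u : \1_(@TB R m.+1) u * (powR (rho u) b / powR (cabs (rho2 z u)) c) <=
    powR 8 c * PX u.1 * GX (take m u.1) (nth 0 u.1 m) * PY u.2 *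
    GY (take m u.2) (nth 0 u.2 m).
  rewrite indicE; case: (boolP (u \in @TB R m.+1)); last first.
    by move=> _; rewrite mul0r !mulr_ge0 ?powR_ge0.
  rewrite inE => u0; rewrite mul1r; have ru0 : 0 < rho u := u0.
  have SE : S (take m u.2) = \sum_(j < m) (yco u j) ^+ 2.
    by apply: eq_bigr => j _; rewrite nth_take.
  have GYE : GY (take m u.2) (nth 0 u.2 m) =
      powR (rho u) b * powR (rho z + rho u) (- t0).
    by rewrite /GY SE -subr_gt0 -/(yco u m) -/(rho u) ru0.
  rewrite GYE mulrCA -powRN; set W := cabs _.
  have W0 : 0 < W by exact: cabs_rho2_gt0.
  rewrite ler_wpM2l ?powR_ge0//.
  have cE : c = t1 * m%:R + t2 + t1 * m%:R + t0.
    have : c = d + (m.+1%:R + 1 + b) by rewrite /d; ring.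
    by rewrite -de /t0 /t1 /t2 -natr1 => ->; field.
  have prodW (X : 'I_m -> R) : (forall j, 0 < X j /\ X j <= 8 * W) ->
      powR W (- (t1 * m%:R)) <= powR 8 (t1 * m%:R) * \prod_(j < m) powR (X j) (- t1).
    move=> HX; rewrite -mulNr !powRrM !powR_mulrn ?powR_ge0//.
    have powE (x : R) : x ^+ m = \prod_(j < m) x by rewrite prodr_const card_ord.
    rewrite !powE -big_split/=.
    apply: ler_prod => j _; rewrite powR_ge0/=; have [X0 XW] := HX j.
    by apply: powR_le_div => //; rewrite /t1; lra.
  have hX := prodW (fun j => rho z + (xco u j - xco z j) ^+ 2) (fun j =>
    conj (ltr_pwDl r0 (sqr_ge0 _)) (xdist_le_cabs_rho2 z0 u0 j)).
  have hY := prodW (fun j => rho z + (yco u j - yco z j) ^+ 2) (fun j =>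
    conj (ltr_pwDl r0 (sqr_ge0 _)) (ydist_le_cabs_rho2 z0 u0 j)).
  have hG : powR W (- t2) <= powR 8 t2 * GX (take m u.1) (nth 0 u.1 m).
    apply: powR_le_div; last by rewrite /t2; lra.
      by rewrite ltr_pwDl.
    exact: imcenter_le_cabs_rho2.
  have hR : powR W (- t0) <= powR 8 t0 * powR (rho z + rho u) (- t0).
    apply: powR_le_div; last by rewrite /t0; lra.
      by rewrite addr_gt0.
    exact: rho_le_cabs_rho2.
  have := ler_pM (mulr_ge0 (mulr_ge0 (powR_ge0 _ _) (powR_ge0 _ _)) (powR_ge0 _ _))
    (powR_ge0 _ _)
    (ler_pM (mulr_ge0 (powR_ge0 _ _) (powR_ge0 _ _)) (powR_ge0 _ _)
     (ler_pM (powR_ge0 _ _) (powR_ge0 _ _) hX hG) hY) hR.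
  rewrite -!gt0_powRD// -!opprD -cE => /le_trans; apply.
  rewrite le_eqVlt; apply/orP; left; apply/eqP.
  have -> : powR 8 c = powR 8 (t1 * m%:R) * powR 8 t2 * powR 8 (t1 * m%:R) * powR 8 t0.
    by rewrite {1}cE !gt0_powRD.
  by rewrite /PX /PY /FX /FY /xco /yco; ring.
have -> : powR 8 c * C ^+ m * C * (C ^+ m * C) * powR (rho z) (m.+1%:R + 1 + b - c) =
    powR 8 c * (A ^+ m * A) * A ^+ m * A.
  have -> : m.+1%:R + 1 + b - c = - e * m.+1%:R * 2%:R.
    by rewrite !mulNr de /d; ring.
  rewrite powRrM (powRrM _ _ m.+1%:R) !powR_mulrn ?powR_ge0 ?exprn_ge0 ?powR_ge0//.
  rewrite /A; set P := powR (rho z) _; rewrite !exprMn (exprS P m).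
  by move: (P ^+ m) (C ^+ m) => p q; ring.
(* For fixed [x] the factors in [x] are constants of the integral over [y], so the product bound is
   used for [y] and then for [x]. *)
apply: (@le_trans _ _ (iint (fun x : m.+1.-tuple R =>
   (powR 8 c * (A ^+ m * A) * PX x * GX (take m x) (nth 0 x m))%:E))).
  apply: le_iint => x.
    by apply: iint_ge0 => y; rewrite lee_fin mulr_ge0// divr_ge0 ?powR_ge0.
  have k0 : 0 <= powR 8 c * PX x * GX (take m x) (nth 0 x m).
    by rewrite !mulr_ge0 ?powR_ge0.
  have := iint_prod_le m k0 A0 FY0 GY0 mFY mGY (fun j => IF _) IGY.
  rewrite (_ : _ * _ * A ^+ m * A =
    powR 8 c * (A ^+ m * A) * PX x * GX (take m x) (nth 0 x m)); last by ring.
  apply: le_trans; apply: le_iint => y; rewrite lee_fin.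
    by rewrite mulr_ge0// divr_ge0 ?powR_ge0.
  exact: pointwise (x, y).
apply: iint_prod_le => //; first by rewrite !mulr_ge0 ?powR_ge0 ?exprn_ge0.
by move=> j; exact: IF.
Qed.

End kernel_integral.

(** * Boxes adapted to the dilations *)

Section iterated_equality.
Context (R : realType).
Local Notation mu := (@lebesgue_measure R).

(** The equality counterpart of [iint_prod_le], used for the volume of boxes. *)
Lemma iint_prod_eq m (F : nat -> R -> R) (G : seq R -> R -> R) (A B c : R) :
  0 <= c -> 0 <= B -> (forall j t, 0 <= F j t) -> (forall s t, 0 <= G s t) ->
  (forall j, measurable_fun [set: R] (F j)) ->
  (forall s, measurable_fun [set: R] (G s)) ->
  (forall j, \int[mu]_x (F j x)%:E = A%:E)%E ->
  (forall s, \int[mu]_x (G s x)%:E = B%:E)%E ->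
  (iint (fun v : m.+1.-tuple R =>
    (c * (\prod_(j < m) F j (nth 0 v j)) * G (take m v) (nth 0 v m))%:E)
  = (c * A ^+ m * B)%:E)%E.
Proof.
move=> c0 B0 F0 G0 mF mG AF BG.
elim: m F G c c0 F0 G0 mF mG AF BG => [|m IH] F G c c0 F0 G0 mF mG AF BG.
  rewrite /= expr0 mulr1.
  under eq_integral do rewrite big_ord0 mulr1 EFinM.
  rewrite ge0_integralZl//.
  - by rewrite BG.
  - by apply/measurable_EFinP; exact: mG.
  - by move=> x _; rewrite lee_fin.
have A0 : 0 <= A.
  rewrite -lee_fin -(AF 0%N); apply: integral_ge0 => x _.
  by rewrite lee_fin.
rewrite iintS; transitivity (\int[mu]_t ((c * A ^+ m * B)%:E * (F 0%N t)%:E))%E.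
  apply: eq_integral => t _.
  have cF : 0 <= c * F 0%N t by rewrite mulr_ge0.
  have := IH (fun j => F j.+1) (fun s => G (t :: s)) (c * F 0%N t) cF (fun j => F0 j.+1)
    (fun s => G0 (t :: s)) (fun j => mF j.+1) (fun s => mG (t :: s))
    (fun j => AF j.+1) (fun s => BG (t :: s)).
  rewrite (_ : c * F 0%N t * A ^+ m * B = c * A ^+ m * B * F 0%N t); last by ring.
  rewrite -EFinM => <-.
  by apply: eq_iint => v; rewrite big_ord_recl/= !mulrA.
rewrite ge0_integralZl//.
- by rewrite AF -EFinM; congr EFin; rewrite exprSr; ring.
- by apply/measurable_EFinP; exact: mF.
- by move=> x _; rewrite lee_fin.
- by rewrite lee_fin !mulr_ge0// exprn_ge0.
Qed.

End iterated_equality.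

(** * Null sets for the weighted measures *)

Section weighted_null_sets.
Context (R : realType) (n : nat).
Local Open Scope ereal_scope.

(** The weight is positive on the domain, so the weighted null sets are the same for every [al]. *)
Lemma wnullVE (al : R) (N : set (Pt R n)) :
  wnullV al N <-> (vol R n).-negligible (@TB R n `&` N).
Proof.
have mT := @measurable_TB R n.
have mr : measurable_fun [set: Pt R n] (fun z => powR (rho z) al).
  by apply: (measurableT_comp (@measurable_powR R al)); exact: measurable_rho.
have mf M : measurable M -> measurable_fun [set: Pt R n]
    (fun z => ((\1_(@TB R n `&` M) z : R) * powR (rho z) al)%:E).
  move=> mM; apply/measurable_EFinP; apply: measurable_funM => //.
  by apply: measurable_indic; exact: measurableI.
have f0 M z : 0 <= ((\1_(@TB R n `&` M) z : R) * powR (rho z) al)%:E.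
  by rewrite lee_fin mulr_ge0 ?powR_ge0.
split=> [[M [mM [NM]]]|[M [mM M0 NM]]].
  rewrite intVE//; last exact: mf.
  set g := (fun z => _) => g0.
  have /ae_eq_integral_abs : \int[vol R n]_x `|g x| = 0.
    by rewrite -g0; apply: eq_integral => x _; rewrite gee0_abs//; exact: f0.
  move=> /(_ measurableT (mf _ mM)) [M' [mM' M'0 HM']].
  exists M'; split => // z [Tz Nz]; apply: HM' => /= /(_ I).
  rewrite /g indicE mem_set; last by split=> //; exact: NM.
  by rewrite mul1r => /eqP; rewrite eqe gt_eqF// powR_gt0.
(* The definition asks for a cover of all of [N]; the complement of the domain can be added to it,
   because the weighted integral does not see it. *)
exists (M `|` ~` @TB R n); split; first by apply: measurableU => //; exact: measurableC.
split=> [z Nz|].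
  by have [Tz|Tz] := pselect (TB z); [left; apply: NM|right].
rewrite intVE//; last by apply: mf; apply: measurableU => //; exact: measurableC.
have -> : @TB R n `&` (M `|` ~` @TB R n) = @TB R n `&` M.
  by rewrite setIUr setICr setU0.
rewrite (@ge0_negligible_integral _ _ _ _ _ M)//; last exact: mf.
rewrite integral0_eq// => z [_ Mz]; rewrite indicE memNset ?mul0r//.
by move=> [_ ?]; exact: Mz.
Qed.

End weighted_null_sets.

(** * Anisotropic boxes and their volume *)

Section boxes.
Context (R : realType) (m : nat).
Implicit Types (k s t : R) (u : Pt R m.+1).

(* The factor 2 between the bounds on [rho] makes the boxes with
   [t = 2 ^+ i] and [t = 2 ^- i] pairwise disjoint. *)
Definition box k s t : set (Pt R m.+1) := [set u |
  [/\ forall j, (j < m)%N -> `|xco u j| <= k * s /\ `|yco u j| <= k * s,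
      `|xco u m| <= k * s ^+ 2 & t < rho u <= 2 * t]].

Lemma box_TB k s t : 0 <= t -> box k s t `<=` @TB R m.+1.
Proof. by move=> t0 u [_ _ /andP[tu _]]; rewrite /TB/=; exact: le_lt_trans tu. Qed.

Lemma measurable_box k s t : measurable (box k s t).
Proof.
have mle (f : Pt R m.+1 -> R) (a : R) : measurable_fun [set: Pt R m.+1] f ->
    measurable [set u | `|f u| <= a].
  move=> mf; rewrite (_ : [set u | _] = f @^-1` `[(- a), a]).
    by rewrite -[X in measurable X]setTI; apply: mf => //; exact: measurable_itv.
  by apply/seteqP; split => u /=; rewrite in_itv/= ler_norml.
rewrite (_ : box k s t =
    (\bigcap_j (if (j < m)%N then [set u : Pt R m.+1 | `|xco u j| <= k * s] `&`
       [set u : Pt R m.+1 | `|yco u j| <= k * s] else setT)) `&`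
    ([set u : Pt R m.+1 | `|xco u m| <= k * s ^+ 2] `&` @rho R m.+1 @^-1` `]t, 2 * t])).
  apply: measurableI; last apply: measurableI.
  - apply: bigcapT_measurable => j; case: ifP => // _.
    by apply: measurableI; apply: mle; [exact: measurable_xco|exact: measurable_yco].
  - by apply: mle; exact: measurable_xco.
  - by rewrite -[X in measurable X]setTI; apply: measurable_rho.
apply/seteqP; split => u /=.
  move=> [H1 H2 H3]; split; last by split => //; rewrite in_itv/=.
  by move=> j _; case: ifP => // jm; have [] := H1 j jm.
rewrite in_itv/= => -[H1 [H2 H3]]; split=> // j jm.
by have := H1 j I; rewrite jm => -[].
Qed.

(** The product of the side lengths. For fixed earlier coordinates, the last imaginary coordinate
    runs over a translate of []t, 2 * t]], of length [t]. *)
Definition vbox k s t : R := (2 * (k * s)) ^+ m * (2 * (k * s ^+ 2)) * ((2 * (k * s)) ^+ m * t).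

Lemma integral_indic_itv_sym (a : R) : 0 <= a ->
  (\int[@lebesgue_measure R]_x (\1_(`[(- a), a]%classic : set R) x)%:E = (2 * a)%:E)%E.
Proof.
move=> a0; rewrite integral_indic// setIT /= lebesgue_measure_itv/= lte_fin.
case: ltP => [_|aa]; first by rewrite -EFinB; congr EFin; ring.
have -> : a = 0 by lra.
by rewrite mulr0.
Qed.

Lemma vol_box k s t : 0 <= k -> 0 <= s -> 0 <= t ->
  vol R m.+1 (box k s t) = (vbox k s t)%:E.
Proof.
move=> k0 s0 t0.
have ks : 0 <= k * s by rewrite mulr_ge0.
have ks2 : 0 <= k * s ^+ 2 by rewrite mulr_ge0// exprn_ge0.
pose F (j : nat) (x : R) : R := \1_(`[(- (k * s)), (k * s)]%classic : set R) x.
pose G (l : seq R) (x : R) : R := \1_(`[(- (k * s ^+ 2)), (k * s ^+ 2)]%classic : set R) x.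
pose S (l : seq R) := \sum_(j < m) nth 0 l j ^+ 2.
pose H (l : seq R) (x : R) : R := \1_(`](S l + t), (S l + 2 * t)]%classic : set R) x.
have IF j : (\int[@lebesgue_measure R]_x (F j x)%:E = (2 * (k * s))%:E)%E.
  exact: integral_indic_itv_sym.
have IG l : (\int[@lebesgue_measure R]_x (G l x)%:E = (2 * (k * s ^+ 2))%:E)%E.
  exact: integral_indic_itv_sym.
have IH l : (\int[@lebesgue_measure R]_x (H l x)%:E = t%:E)%E.
  rewrite integral_indic// setIT /= lebesgue_measure_itv/= lte_fin ltrD2l.
  case: ltP => [_|tt]; first by rewrite -EFinB; congr EFin; ring.
  by have -> : t = 0 by lra.
have F0 j x : 0 <= F j x by [].
have G0 j x : 0 <= G j x by [].
have H0 j x : 0 <= H j x by [].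
have mi (i : interval R) : measurable_fun [set: R] (\1_([set` i] : set R) : R -> R).
  by apply: measurable_indic; exact: measurable_itv.
have mF j : measurable_fun [set: R] (F j) by exact: mi.
have mG j : measurable_fun [set: R] (G j) by exact: mi.
have mH j : measurable_fun [set: R] (H j) by exact: mi.
transitivity (intV (fun u : Pt R m.+1 => (\1_(box k s t) u)%:E)).
  rewrite intVE.
  - by rewrite integral_indic ?setIT//; exact: measurable_box.
  - by apply/measurable_EFinP; apply: measurable_indic; exact: measurable_box.
  - by move=> u; rewrite lee_fin.
pose P (x : seq R) : R := \prod_(j < m) F j (nth 0 x j).
have P0 x : 0 <= P x by apply: prodr_ge0.
have E (x y : m.+1.-tuple R) : \1_(box k s t) (x, y) =
    P x * G (take m x) (nth 0 x m) * P y * H (take m y) (nth 0 y m) :> R.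
  have PE (v : m.+1.-tuple R) : P v =
      ([forall j : 'I_m, `|nth 0 v j| <= k * s] : bool)%:R.
    rewrite /P; case: (boolP [forall j, _]) => [/forallP h|].
      rewrite big1// => j _; rewrite /F indicE mem_set//= in_itv/=.
      by rewrite -ler_norml; exact: h.
    rewrite negb_forall => /existsP[j hj]; rewrite (bigD1 j)//= /F indicE memNset ?mul0r//=.
    by rewrite in_itv/= -ler_norml; exact/negP.
  have GE : G (take m x) (nth 0 x m) = ((`|nth 0 x m| <= k * s ^+ 2)%R : bool)%:R.
    rewrite /G indicE; congr (_%:R); congr nat_of_bool.
    by rewrite mem_setE in_itv/= ler_norml.
  have HE : H (take m y) (nth 0 y m) = ((t < rho (x, y) <= 2 * t)%R : bool)%:R.
    rewrite /H indicE; congr (_%:R); congr nat_of_bool.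
    have -> : S (take m y) = \sum_(j < m) yco (x, y) j ^+ 2.
      by apply: eq_bigr => j _; rewrite nth_take.
    by rewrite mem_setE in_itv/= /rho/= ltrBrDl lerBlDl.
  rewrite !PE GE HE -!natrM !mulnb indicE; congr (_%:R); congr nat_of_bool.
  apply/idP/idP.
    rewrite inE => -[h1 h2 h3]; rewrite h2 h3 !andbT; apply/andP; split.
    - by apply/forallP => j; have [] := h1 j (ltn_ord j).
    - by apply/forallP => j; have [] := h1 j (ltn_ord j).
  move=> /andP[/andP[/andP[/forallP h1 h2] /forallP h3] h4]; rewrite inE; split => //.
  by move=> j jm; split; [exact: (h1 (Ordinal jm))|exact: (h3 (Ordinal jm))].
rewrite /intV.
transitivity (iint (fun x : m.+1.-tuple R =>
    ((2 * (k * s)) ^+ m * t * P x * G (take m x) (nth 0 x m))%:E)).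
  apply: eq_iint => x.
  have c0 : 0 <= P x * G (take m x) (nth 0 x m) by rewrite mulr_ge0.
  have := iint_prod_eq m c0 t0 F0 H0 mF mH IF IH.
  rewrite (_ : P x * _ * _ * t = (2 * (k * s)) ^+ m * t * P x * G (take m x) (nth 0 x m)); last by ring.
  by move=> <-; apply: eq_iint => y; rewrite E.
have c0 : 0 <= (2 * (k * s)) ^+ m * t by rewrite !mulr_ge0// exprn_ge0// mulr_ge0.
have B0 : 0 <= 2 * (k * s ^+ 2) by rewrite mulr_ge0.
rewrite (iint_prod_eq m c0 B0 F0 G0 mF mG IF IG); congr EFin; rewrite /vbox.
by move: ((2 * (k * s)) ^+ m) => q; ring.
Qed.

Lemma vbox_gt0 k s t : 0 < k -> 0 < s -> 0 < t -> 0 < vbox k s t.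
Proof. by move=> k0 s0 t0; rewrite /vbox !(mulr_gt0, exprn_gt0). Qed.

End boxes.

(** * Essential suprema *)

Section essential_supremum.
Context (R : realType) (m : nat).
Local Notation V := (vol R m.+1).
Local Notation TBm := (@TB R m.+1).
Local Open Scope ereal_scope.
Implicit Types h : Pt R m.+1 -> \bar R.

Lemma box_not_negligible (k s t : R) : (0 < k)%R -> (0 < s)%R -> (0 < t)%R ->
  ~ V.-negligible (@box R m k s t).
Proof.
move=> k0 s0 t0; rewrite (negligibleP V (@measurable_box R m k s t)).
move=> V0; have := vol_box m (ltW k0) (ltW s0) (ltW t0); rewrite [LHS]V0 => -[] /esym/eqP.
by rewrite gt_eqF// vbox_gt0.
Qed.

Lemma TB_not_negligible : ~ V.-negligible TBm.
Proof.
move=> TN; apply: (@box_not_negligible 1 1 1) => //.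
by apply: negligibleS TN; apply: box_TB.
Qed.

Lemma esssupV_le al h (M : \bar R) : (forall z, TB z -> h z <= M) -> esssupV al h <= M.
Proof.
move=> hM; apply: ereal_inf_lbound; apply/wnullVE.
rewrite (_ : _ `&` _ = set0); first exact: negligible_set0.
by apply/seteqP; split => z //= -[_ [/hM + /lt_geF]] => ->.
Qed.

Lemma esssupV_ge0 al h : (forall z, 0 <= h z) -> 0 <= esssupV al h.
Proof.
move=> h0; apply: le_ereal_inf_tmp => M /= /wnullVE hM; rewrite leNgt; apply/negP => M0.
apply: TB_not_negligible; apply: negligibleS hM => z Tz; split => //; split => //.
exact: lt_le_trans M0 (h0 z).
Qed.

Lemma esssupV_lt al h (M : \bar R) : esssupV al h < M ->
  V.-negligible [set z | TB z /\ M <= h z].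
Proof.
move=> /ereal_inf_lt[q /= /wnullVE hq qM]; apply: negligibleS hq => z [Tz Mz].
by split => //; split => //; exact: lt_le_trans qM Mz.
Qed.

(** Each level strictly above the essential supremum is exceeded only on a null set; levels
    decreasing to it give a countable union of null sets. An infinite essential supremum is never
    exceeded. *)
Lemma esssupV_negligible al h : (forall z, 0 <= h z) ->
  V.-negligible [set z | TB z /\ esssupV al h < h z].
Proof.
move=> h0; have := esssupV_ge0 al h0.
case FE : (esssupV al h) => [F| |]//= F0; last first.
  rewrite (_ : [set _ | _] = set0); first exact: negligible_set0.
  by apply/seteqP; split => z //= [_]; rewrite ltNge leey.
apply: (@negligibleS _ _ _ _ (\bigcup_i [set z | TB z /\ (F + i.+1%:R^-1)%:E <= h z])).
  move=> z /= [Tz Fh].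
  case hE : (h z) Fh => [r| |]//= Fr; last by exists 0%N => //=; split => //; rewrite hE leey.
  have rF : (0 < r - F)%R by rewrite subr_gt0 -lte_fin.
  exists (Num.truncn (r - F)^-1) => //=; split => //; rewrite hE lee_fin.
  rewrite -lerBrDl invf_ple ?posrE// ltW//; exact: truncnS_gt.
apply: negligible_bigcup => i; apply: (@esssupV_lt al).
by rewrite FE lte_fin ltrDl.
Qed.

(** The essential supremum at [w] is below [r] exactly when, for some rational [q < r], the section
    at [w] of the set where [h] exceeds [q] has measure zero. The measure of a section is measurable
    in [w], and there are countably many [q]. *)
Lemma measurable_esssupV (al : R) (h : Pt R m.+1 * Pt R m.+1 -> R) :
  measurable_fun [set: Pt R m.+1 * Pt R m.+1] h ->
  measurable_fun [set: Pt R m.+1] (fun w => esssupV al (fun z => (h (z, w))%:E)).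
Proof.
move=> mh; apply: (measurability _ (ErealGenInftyO.measurableE R)).
move=> _ [_ [r ->] <-]; rewrite setTI.
pose A q : set (Pt R m.+1 * Pt R m.+1) := [set p | TB p.1 /\ (q < h p)%R].
have mA q : measurable (A q).
  rewrite (_ : A q = (fst @^-1` TBm) `&` (h @^-1` `]q, +oo[)).
    apply: measurableI; first by rewrite -[X in measurable X]setTI; apply: measurable_fst => //; exact: measurable_TB.
    by rewrite -[X in measurable X]setTI; apply: mh => //; exact: measurable_itv.
  by apply/seteqP; split => p /=; rewrite in_itv/= andbT.
pose N q w := V (ysection (A q) w).
have mN q : measurable_fun [set: Pt R m.+1] (N q) by exact: measurable_fun_ysection.
rewrite (_ : _ @^-1` _ = \bigcup_(q : rat)
   (if (ratr q < r)%R then N (ratr q) @^-1` [set 0] else set0)).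
  apply: bigcupT_measurable_rat => q; case: ifP => // _.
  by rewrite -[X in measurable X]setTI; apply: mN.
have NE q w : V.-negligible (TBm `&` [set z | TB z /\ q%:E < (h (z, w))%:E]) <-> N q w = 0.
  rewrite (_ : _ `&` _ = ysection (A q) w).
    by rewrite negligibleP//; exact: measurable_ysection.
  apply/seteqP; split => z; rewrite /ysection/= ?inE.
    by move=> [_ [Tz]]; rewrite lte_fin => qh; split.
  by move=> [Tz qh]; split => //; split => //; rewrite lte_fin.
apply/seteqP; split => w /=; rewrite in_itv/=.
  move=> /ereal_inf_lt[M /= /wnullVE hM Mr].
  have [q qr Mq] : exists2 q : rat, (ratr q < r)%R & M <= (ratr q)%:E.
    case: M hM Mr => [s| |] hM //=; last first.
      move=> _; have [q] := @rat_in_itvoo R (r - 1) r (ltac:(lra)).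
      by rewrite in_itv/= => /andP[_ qr]; exists q => //; rewrite leNye.
    rewrite lte_fin => sr; have [q] := rat_in_itvoo sr.
    by rewrite in_itv/= => /andP[sq qr]; exists q => //; rewrite lee_fin ltW.
  exists q => //=; rewrite qr; apply/NE; apply: negligibleS hM => z [Tz [_ qh]].
  by split => //; split => //; exact: le_lt_trans Mq qh.
move=> [q _]; case: ifP => // qr /NE hq.
apply: (@le_lt_trans _ _ (ratr q)%:E); last by rewrite lte_fin.
by apply: ereal_inf_lbound; apply/wnullVE.
Qed.

End essential_supremum.

(** * Sufficiency *)

Section sufficiency.
Context (R : realType) (m : nat).
Local Notation V := (vol R m.+1).
Local Notation TBm := (@TB R m.+1).
Local Notation N := (m.+1%:R : R).
Local Open Scope ereal_scope.

Lemma measurable_indic_TB : measurable_fun [set: Pt R m.+1] (\1_TBm : _ -> R).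
Proof. by apply: measurable_indic; exact: measurable_TB. Qed.

Lemma measurable_powR_rho p : measurable_fun [set: Pt R m.+1] (fun z => powR (rho z) p).
Proof. by apply: (measurableT_comp (@measurable_powR R p)); exact: measurable_rho. Qed.

Lemma measurable_indic_ker1 a b c z :
  measurable_fun [set: Pt R m.+1] (fun u => (\1_TBm u * ker1 a b c z u)%R).
Proof.
apply: measurable_funM; [exact: measurable_indic_TB|exact: measurable_ker1].
Qed.

Lemma integral_ker1 (a b c : R) : (-1 < b)%R -> (N + 1 + b < c)%R ->
  exists2 C : R, (0 <= C)%R & forall z, TB z ->
  \int[V]_u (\1_TBm u * ker1 a b c z u)%:E <= (C * powR (rho z) (a + (N + 1 + b - c)))%:E.
Proof.
move=> b1 bc; have [C C0 HC] := kernel_integral b1 bc; exists C => // z z0.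
have r0 : (0 < rho z)%R := z0.
have mk : measurable_fun [set: Pt R m.+1]
    (fun u => (\1_TBm u * (powR (rho u) b / powR (cabs (rho2 z u)) c))%:E).
  apply/measurable_EFinP.
  rewrite (_ : (fun u => _) = (fun u => \1_TBm u * ker1 0 b c z u)%R).
    exact: measurable_indic_ker1.
  by apply/funext => u; rewrite /ker1 powRr0 mul1r.
have k0 u : 0 <= (\1_TBm u * (powR (rho u) b / powR (cabs (rho2 z u)) c))%:E.
  by rewrite lee_fin mulr_ge0// divr_ge0 ?powR_ge0.
rewrite (_ : \int[V]_u _ = (powR (rho z) a)%:E *
    \int[V]_u (\1_TBm u * (powR (rho u) b / powR (cabs (rho2 z u)) c))%:E).
  rewrite -intVE// gt0_powRD// mulrCA EFinM lee_wpmul2l ?lee_fin ?powR_ge0//.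
  exact: HC.
rewrite -ge0_integralZl ?lee_fin ?powR_ge0//; apply: eq_integral => u _.
by rewrite -EFinM /ker1; congr EFin; ring.
Qed.

(** Hoelder's inequality is applied after moving [rho e] to the power [al / p] from one factor to
    the other. The [q]-th power of what remains of the kernel is again a kernel, with parameters
    [a'], [b'], [c']. The condition on [al] says that [-1 < b']; by the value of [c], integrability
    in [e] becomes [0 < a], and the powers of [rho w] cancel, whence a bound uniform in [w]. *)
Lemma hoelder_ker1 (p al a b c : R) : (1 < p)%R -> (0 < a)%R ->
  (al + 1 < p * (b + 1))%R -> c = (N + 1 + a + b - (N + 1 + al) / p)%R ->
  exists2 C : R, (0 <= C)%R & forall w, TB w -> forall F : Pt R m.+1 -> \bar R,
  measurable_fun [set: Pt R m.+1] F -> (forall e, 0 <= F e) ->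
  \int[V]_e ((\1_TBm e)%:E * F e `^ p * (powR (rho e) al)%:E) < +oo ->
  \int[V]_e ((\1_TBm e * ker1 a b c w e)%:E * F e) <=
  C%:E * (\int[V]_e ((\1_TBm e)%:E * F e `^ p * (powR (rho e) al)%:E)) `^ p^-1.
Proof.
move=> p1 a0 alb cE; have p0 : (0 < p)%R by lra.
pose q := (p / (p - 1))%R; have q0 : (0 < q)%R by rewrite divr_gt0//; lra.
have qV : (q^-1 = 1 - p^-1)%R by rewrite /q; field; rewrite gt_eqF//=; lra.
have pq : (p^-1 + q^-1 = 1)%R by rewrite qV; ring.
pose b' := ((b - al / p) * q)%R; pose c' := (c * q)%R; pose a' := (a * q)%R.
have b'1 : (-1 < b')%R.
  have h1 : ((al + 1) / p < b + 1)%R by rewrite ltr_pdivrMr// mulrC.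
  have h2 : (- q^-1 < b - al / p)%R by rewrite qV; lra.
  by rewrite /b' -ltr_pdivrMr// mulN1r.
have expE : (N + 1 + b' - c' = - a')%R.
  have NE : (N + 1 = (N + 1) * (1 - p^-1) * q)%R by rewrite -qV mulfVK// gt_eqF.
  transitivity ((N + 1) * (1 - p^-1) * q + (b - al / p) * q - c * q)%R.
    by rewrite -NE.
  by rewrite cE /a'; ring.
have bc' : (N + 1 + b' < c')%R.
  by rewrite -subr_lt0 expE oppr_lt0 mulr_gt0.
have [C C0 HC] := integral_ker1 a' b'1 bc'.
exists (powR C q^-1); first exact: powR_ge0.
move=> w w0 F mF F0 Foo.
set J := \int[V]_e _ in Foo *.
have mG : measurable_fun [set: Pt R m.+1]
    (fun e => (\1_TBm e)%:E * F e `^ p * (powR (rho e) al)%:E).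
  apply: emeasurable_funM; last by apply/measurable_EFinP; exact: measurable_powR_rho.
  apply: emeasurable_funM; first by apply/measurable_EFinP; exact: measurable_indic_TB.
  exact: measurableT_comp (@measurable_poweR R p) mF.
have G0 e : 0 <= (\1_TBm e)%:E * F e `^ p * (powR (rho e) al)%:E.
  by rewrite !mule_ge0 ?lee_fin ?powR_ge0 ?poweR_ge0.
have iG : V.-integrable [set: Pt R m.+1]
    (fun e => (\1_TBm e)%:E * F e `^ p * (powR (rho e) al)%:E).
  apply/integrableP; split => //.
  by under eq_integral do rewrite gee0_abs//.
pose f e : R := (\1_TBm e * fine (F e) * powR (rho e) (al / p))%R.
pose g e : R := (\1_TBm e * ker1 a b c w e * powR (rho e) (- (al / p)))%R.
have mf : measurable_fun [set: Pt R m.+1] f.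
  apply: measurable_funM; last exact: measurable_powR_rho.
  apply: measurable_funM; first exact: measurable_indic_TB.
  exact: measurableT_comp (fine_measurable measurableT) mF.
have mg : measurable_fun [set: Pt R m.+1] g.
  apply: measurable_funM; last exact: measurable_powR_rho.
  exact: measurable_indic_ker1.
have f0 e : (0 <= f e)%R by rewrite mulr_ge0 ?powR_ge0// mulr_ge0// fine_ge0.
have g0 e : (0 <= g e)%R by rewrite mulr_ge0 ?powR_ge0// mulr_ge0// ker1_ge0.
have := hoelder V mf mg p0 q0 pq.
rewrite unlock /= invr1 poweRe1; last by apply: integral_ge0 => e _; rewrite lee_fin powR_ge0.
have IfE : \int[V]_e (`|(f e)%:E| `^ p) <= J.
  apply: ge0_le_integral_nomeas => e; first exact: poweR_ge0.
  rewrite gee0_abs ?lee_fin// poweR_EFin.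
  rewrite /f indicE; case: (boolP (e \in TBm)) => [|_]; last first.
    by rewrite !mul0r !mul0e powR0 ?gt_eqF.
  rewrite inE => e0; rewrite !mul1r mul1e.
  have re0 : (0 < rho e)%R := e0.
  rewrite powRM ?fine_ge0 ?powR_ge0// -powRrM mulfVK ?gt_eqF//.
  rewrite EFinM lee_wpmul2r ?lee_fin ?powR_ge0//.
  case: (F e) (F0 e) => [r| |]//= _; last by rewrite (gt_eqF p0) leey.
have IgE : \int[V]_e (`|(g e)%:E| `^ q) <= C%:E.
  apply: le_trans (_ : \int[V]_e (\1_TBm e * ker1 a' b' c' w e)%:E <= _); last first.
    apply: le_trans (HC _ w0) _.
    by rewrite expE addrN powRr0 mulr1.
  apply: ge0_le_integral_nomeas => e; first exact: poweR_ge0.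
  rewrite gee0_abs; last by rewrite lee_fin.
  rewrite poweR_EFin lee_fin.
  rewrite /g indicE; case: (boolP (e \in TBm)) => [|_]; last first.
    by rewrite !mul0r powR0 ?gt_eqF.
  rewrite inE => e0; rewrite !mul1r; have re0 : (0 < rho e)%R := e0.
  rewrite /ker1 -!powRN powRM ?mulr_ge0 ?powR_ge0//.
  rewrite powRM ?mulr_ge0 ?powR_ge0// powRM ?powR_ge0//.
  rewrite -!powRrM le_eqVlt; apply/orP; left; apply/eqP.
  rewrite (_ : b' = b * q + - (al / p) * q)%R; last by rewrite /b'; ring.
  rewrite gt0_powRD// /a' /c' mulNr; ring.
move=> H; apply: le_trans (_ : \int[V]_e (f e * g e)%:E <= _); last first.
  rewrite (_ : \int[V]_e (f e * g e)%:E = \int[V]_x (`|f x * g x| `^ 1)%:E); last first.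
    by apply: eq_integral => e _; rewrite powRr1// ger0_norm// mulr_ge0.
  apply: le_trans H _; rewrite muleC; apply: lee_pmul; rewrite ?poweR_ge0//.
    rewrite -poweR_EFin; apply: gt0_ler_poweR => //; first by rewrite invr_ge0 ltW.
    - by rewrite in_itv/= leey integral_ge0// => e _; exact: poweR_ge0.
    - by rewrite in_itv/= leey andbT lee_fin.
  apply: gt0_ler_poweR => //; first by rewrite invr_ge0 ltW.
  - by rewrite in_itv/= leey integral_ge0// => e _; exact: poweR_ge0.
  - by rewrite in_itv/= leey integral_ge0.
apply: ae_ge0_le_integral => //.
- by move=> e _; rewrite mule_ge0// lee_fin mulr_ge0 ?ker1_ge0.
- by apply: emeasurable_funM => //; apply/measurable_EFinP; exact: measurable_indic_ker1.
- by move=> e _; rewrite lee_fin mulr_ge0.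
- by apply/measurable_EFinP; exact: measurable_funM.
(* [f] uses [fine (F e)], which is 0 where [F e] is infinite. Finiteness of the weighted integral
   confines such points of the domain to a null set. *)
apply: filterS (integrable_ae measurableT iG) => e /(_ I) Gfin _.
rewrite /f /g.
rewrite indicE; case: (boolP (e \in TBm)) Gfin => [|_ _]; last by rewrite !mul0r mul0e.
rewrite inE => e0; have re0 : (0 < rho e)%R := e0.
rewrite indicE mem_set// !mul1r mul1e.
case: (F e) (F0 e) => [r r0 _|_|]//; last first.
  by rewrite /= (gt_eqF p0) gt0_mulye// lte_fin powR_gt0.
rewrite -EFinM lee_fin le_eqVlt; apply/orP; left; apply/eqP.
have P0 : powR (rho e) (al / p) != 0%R by rewrite gt_eqF// powR_gt0.
by rewrite powRN /=; field.
Qed.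

End sufficiency.

(** * From absolute estimates to bounded operators *)

Section boundedness.
Context (R : realType) (m : nat).
Local Notation V := (vol R m.+1).
Local Notation TBm := (@TB R m.+1).
Local Notation N := (m.+1%:R : R).
Implicit Types (f : Pt R m.+1 -> Pt R m.+1 -> R[i]).

Lemma measurable_cabs_fun f : cmeasurable f ->
  measurable_fun [set: Pt R m.+1 * Pt R m.+1] (fun p => cabs (f p.1 p.2)).
Proof. by move=> [mr mi]; exact: (measurable_cabs mr mi). Qed.

Lemma mixnorm_infE (p al1 al2 : R) f : cmeasurable f ->
  mixnorm_inf p al1 al2 f = ((\int[V]_w ((\1_TBm w)%:E *
    (esssupV al1 (fun z => (cabs (f z w))%:E)) `^ p * (powR (rho w) al2)%:E)) `^ p^-1)%E.
Proof.
move=> mf; rewrite /mixnorm_inf intVE// => [|w].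
  apply: emeasurable_funM; last by apply/measurable_EFinP; exact: measurable_powR_rho.
  apply: emeasurable_funM; first by apply/measurable_EFinP; exact: measurable_indic_TB.
  apply: (measurableT_comp (@measurable_poweR R p)).
  exact: (measurable_esssupV al1 (measurable_cabs_fun mf)).
by rewrite !mule_ge0 ?lee_fin ?powR_ge0 ?poweR_ge0.
Qed.

Lemma mixnorm_inf_ge0 (p al1 al2 : R) f : (0 <= mixnorm_inf p al1 al2 f)%E.
Proof. exact: poweR_ge0. Qed.

(** By Tonelli the variable [u] is integrated first, where [h (u, e)] is almost everywhere at most
    its essential supremum in [u]. The latter only concerns points of the domain, hence the
    vanishing of [k1] elsewhere. *)
Lemma integral_esssupV_le (al C : R) (k1 k2 : Pt R m.+1 -> R)
    (h : Pt R m.+1 * Pt R m.+1 -> R) :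
  measurable_fun [set: Pt R m.+1] k1 -> measurable_fun [set: Pt R m.+1] k2 ->
  measurable_fun [set: Pt R m.+1 * Pt R m.+1] h ->
  (forall u, 0 <= k1 u) -> (forall e, 0 <= k2 e) -> (forall p, 0 <= h p) ->
  (forall u, ~ TB u -> k1 u = 0) -> (\int[V]_u (k1 u)%:E <= C%:E)%E ->
  (\int[V \x V]_p (k1 p.1 * k2 p.2 * h p)%:E <=
   C%:E * \int[V]_e ((k2 e)%:E * esssupV al (fun u => (h (u, e))%:E)))%E.
Proof.
move=> mk1 mk2 mh k10 k20 h0 k1T k1C.
have C0 : 0 <= C.
  by rewrite -lee_fin; apply: le_trans k1C; apply: integral_ge0 => u _; rewrite lee_fin.
pose F e := esssupV al (fun u => (h (u, e))%:E).
have F0 e : (0 <= F e)%E by apply: esssupV_ge0 => u; rewrite lee_fin.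
have mF : measurable_fun [set: Pt R m.+1] F by exact: measurable_esssupV.
have kF0 e : (0 <= (k2 e)%:E * F e)%E by rewrite mule_ge0// lee_fin.
have mkF : measurable_fun [set: Pt R m.+1] (fun e => (k2 e)%:E * F e)%E.
  by apply: emeasurable_funM => //; exact/measurable_EFinP.
pose g p : R := k1 p.1 * k2 p.2 * h p.
have g0 p : 0 <= g p by rewrite mulr_ge0// mulr_ge0.
have mg : measurable_fun [set: Pt R m.+1 * Pt R m.+1] (EFin \o g).
  apply/measurable_EFinP; apply: measurable_funM => //; apply: measurable_funM.
  - exact: (measurableT_comp mk1 measurable_fst).
  - exact: (measurableT_comp mk2 measurable_snd).
rewrite (fubini_tonelli2 (EFin \o g))//.
have inner e : (fubini_G V (EFin \o g) e <= C%:E * ((k2 e)%:E * F e))%E.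
  apply: (@le_trans _ _ (\int[V]_u ((k2 e)%:E * F e * (k1 u)%:E))%E).
    apply: ae_ge0_le_integral => //.
    - by move=> u _; exact: g0.
    - exact: (measurableT_comp mg (pair2_measurable e)).
    - by move=> u _; apply: mule_ge0 => //; rewrite lee_fin.
    - by apply: measurable_funeM; exact/measurable_EFinP.
    apply: (@negligibleS _ _ _ _ _ _ _ (@esssupV_negligible R m al
       (fun u => (h (u, e))%:E) (fun u => h0 _))) => u /= hu.
    have Tu : TB u.
      apply: contrapT => Tu; apply: hu => _.
      by rewrite /g /= k1T// !mul0r mule0.
    split => //; rewrite ltNge; apply/negP => hF; apply: hu => _.
    have -> : g (u, e) = k2 e * h (u, e) * k1 u by rewrite /g/=; ring.
    by rewrite EFinM lee_wpmul2r ?lee_fin// EFinM lee_wpmul2l ?lee_fin.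
  rewrite ge0_integralZl//; last first.
    by move=> u _; rewrite lee_fin.
  - exact/measurable_EFinP.
  - by rewrite muleC lee_wpmul2r.
apply: (@le_trans _ _ (\int[V]_e (C%:E * ((k2 e)%:E * F e)))%E).
  apply: ge0_le_integral_nomeas => // e; apply: integral_ge0 => u _.
  exact: g0.
by rewrite ge0_integralZl.
Qed.

(** The value of [c1] makes the powers of [rho z] cancel in the first variable as Hoelder's
    inequality does in the second. The bound holds at every point of the domain, so no exceptional
    set appears. *)
Lemma ker1_mixnorm_le (p2 a1 a2 b1 b2 c1 c2 al1 al2 : R) : 1 < p2 ->
  0 < a1 -> 0 < a2 -> -1 < b1 -> al2 + 1 < p2 * (b2 + 1) ->
  c1 = N + 1 + a1 + b1 -> c2 = N + 1 + a2 + b2 - (N + 1 + al2) / p2 ->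
  exists2 C : R, 0 <= C & forall f, cmeasurable f ->
  (mixnorm_inf p2 al1 al2 f < +oo)%E -> forall z w, TB z -> TB w ->
  (intV (fun u => intV (fun e => (\1_TBm u * \1_TBm e *
     (ker1 a1 b1 c1 z u * ker1 a2 b2 c2 w e * cabs (f u e)))%:E))
   <= C%:E * mixnorm_inf p2 al1 al2 f)%E.
Proof.
move=> p1 a10 a20 b11 alb c1E c2E.
have p0 : 0 < p2 by lra.
have bc1 : N + 1 + b1 < c1 by rewrite c1E; lra.
have [C1 C10 H1] := integral_ker1 a1 b11 bc1.
have [C2 C20 H2] := hoelder_ker1 p1 a20 alb c2E.
exists (C1 * C2) => [|f mf foo z w z0 w0]; first by rewrite mulr_ge0.
have mh := measurable_cabs_fun mf.
have mk1 := measurable_indic_ker1 a1 b1 c1 z.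
have mk2 := measurable_indic_ker1 a2 b2 c2 w.
have k10 u : 0 <= \1_TBm u * ker1 a1 b1 c1 z u by rewrite mulr_ge0// ker1_ge0.
have k20 u : 0 <= \1_TBm u * ker1 a2 b2 c2 w u by rewrite mulr_ge0// ker1_ge0.
have k1T u : ~ TB u -> \1_TBm u * ker1 a1 b1 c1 z u = 0.
  by move=> Tu; rewrite indicE memNset// mul0r.
have k1C : (\int[V]_u (\1_TBm u * ker1 a1 b1 c1 z u)%:E <= C1%:E)%E.
  apply: le_trans (H1 z z0) _; rewrite c1E.
  by rewrite (_ : a1 + _ = 0) ?powRr0 ?mulr1//; ring.
have h0 (p : Pt R m.+1 * Pt R m.+1) : 0 <= cabs (f p.1 p.2) by exact: cabs_ge0.
have le1 := integral_esssupV_le al1 mk1 mk2 mh k10 k20 h0 k1T k1C.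
have foo' := foo; rewrite mixnorm_infE// in foo'; rewrite mixnorm_infE//.
have p2V : p2^-1 != 0 by rewrite gt_eqF// invr_gt0.
have F0 e : (0 <= esssupV al1 (fun u => (cabs (f u e))%:E))%E.
  by apply: esssupV_ge0 => u; rewrite lee_fin cabs_ge0.
have := H2 w w0 _ (measurable_esssupV al1 mh) F0 (lty_poweRy p2V foo').
move=> le2; rewrite EFinM -muleA.
apply: le_trans (lee_wpmul2l (_ : 0 <= C1%:E)%E le2); last by rewrite lee_fin.
apply: le_trans le1; rewrite -intVVE.
- rewrite le_eqVlt; apply/orP; left; apply/eqP.
  apply: eq_intV => u; apply: eq_intV => e; congr EFin => /=.
  by move: (cabs _) (ker1 _ _ _ _ _) (ker1 _ _ _ _ _) => x y t; ring.
- apply/measurable_EFinP; apply: measurable_funM => //; apply: measurable_funM.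
  - exact: (measurableT_comp mk1 measurable_fst).
  - exact: (measurableT_comp mk2 measurable_snd).
- by move=> p; rewrite lee_fin; exact: mulr_ge0 (mulr_ge0 (k10 _) (k20 _)) (h0 _).
Qed.

Lemma esssupVV_le (h : Pt R m.+1 -> Pt R m.+1 -> \bar R) (M : \bar R) :
  (forall z w, TB z -> TB w -> h z w <= M)%E -> (esssupVV h <= M)%E.
Proof.
move=> hM; apply: ereal_inf_lbound; rewrite /=; apply/nullVVE.
rewrite (_ : [set _ | _] = set0); first exact: negligible_set0.
apply/seteqP; split => // -[z w] /= [Tz [Tw]].
by rewrite ltNge hM.
Qed.

Lemma normB_le_ge0 (x y M : R) :
  0 <= x -> x <= M -> 0 <= y -> y <= M -> `|x - y| <= M.
Proof. by move=> *; rewrite ler_norml; apply/andP; split; lra. Qed.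

Lemma fine_le_fine (x y : \bar R) :
  (0 <= x)%E -> (x <= y)%E -> (y < +oo)%E -> 0 <= fine x <= fine y.
Proof.
case: x => [x| |]; case: y => [y| |]//=.
by rewrite !lee_fin => -> ->.
Qed.

Lemma EFin_le_2fine (x C : R) (y z : \bar R) :
  x <= 2 * fine y -> (0 <= y)%E -> (y <= C%:E * z)%E -> (y < +oo)%E ->
  (x%:E <= (2 * C)%:E * z)%E.
Proof.
case: y => [y| |]//= xy _ yz _; apply: (@le_trans _ _ (2 * y)%:E).
  by rewrite lee_fin.
by rewrite !EFinM -muleA lee_wpmul2l// lee_fin.
Qed.

Lemma fine_intVV_le (g h : Pt R m.+1 -> Pt R m.+1 -> R) :
  (forall u e, 0 <= g u e <= h u e) ->
  (intV (fun u => intV (fun e => (h u e)%:E)) < +oo)%E ->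
  0 <= fine (intV (fun u => intV (fun e => (g u e)%:E))) <=
  fine (intV (fun u => intV (fun e => (h u e)%:E))).
Proof.
move=> gh hoo.
have g0 : (0 <= intV (fun u => intV (fun e => (g u e)%:E)))%E.
  apply: intV_ge0 => u; apply: intV_ge0 => e; rewrite lee_fin.
  by have /andP[] := gh u e.
have le_gh : (intV (fun u => intV (fun e => (g u e)%:E)) <=
    intV (fun u => intV (fun e => (h u e)%:E)))%E.
  apply: le_intV => u.
    by apply: intV_ge0 => e; rewrite lee_fin; have /andP[] := gh u e.
  by apply: le_intV => e; rewrite lee_fin; have /andP[] := gh u e.
exact: fine_le_fine g0 le_gh hoo.
Qed.

(** The integrals of the positive and negative parts both lie between 0 and the integral of [h],
    hence so does the absolute value of their difference. *)
Lemma rintVV_le (g h : Pt R m.+1 -> Pt R m.+1 -> R) :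
  (forall u e, `|g u e| <= h u e) ->
  (intV (fun u => intV (fun e => ((\1_TBm u * \1_TBm e : R) * h u e)%:E)) < +oo)%E ->
  `|rintVV g| <= fine (intV (fun u => intV (fun e => ((\1_TBm u * \1_TBm e : R) * h u e)%:E))).
Proof.
move=> gh hoo; set H := fine _.
have i0 u e : 0 <= (\1_TBm u * \1_TBm e : R) by rewrite mulr_ge0.
have maxE u e x : `|x| <= h u e -> 0 <= (\1_TBm u * \1_TBm e : R) * Num.max x 0 <=
    (\1_TBm u * \1_TBm e : R) * h u e.
  move=> xh; rewrite mulr_ge0 ?le_max ?lexx ?orbT//= ler_wpM2l// ge_max.
  by rewrite (le_trans (ler_norm x) xh) (le_trans (normr_ge0 x) xh).
have /andP[P0 PH] := @fine_intVV_le (fun u e => (\1_TBm u * \1_TBm e : R) * Num.max (g u e) 0) _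
  (fun u e => maxE u e _ (gh u e)) hoo.
have ghN u e : `|- g u e| <= h u e by rewrite normrN.
have /andP[Q0 QH] := @fine_intVV_le (fun u e => (\1_TBm u * \1_TBm e : R) * Num.max (- g u e) 0) _
  (fun u e => maxE u e _ (ghN u e)) hoo.
exact: normB_le_ge0 P0 PH Q0 QH.
Qed.

Lemma bounded_inf_sufficient (K : Pt R m.+1 -> Pt R m.+1 -> Pt R m.+1 -> Pt R m.+1 -> R[i])
    (p2 a1 a2 b1 b2 c1 c2 al1 al2 : R) : 1 < p2 ->
  (forall z w u e, cabs (K z w u e) = ker1 a1 b1 c1 z u * ker1 a2 b2 c2 w e) ->
  0 < a1 -> 0 < a2 -> -1 < b1 -> al2 + 1 < p2 * (b2 + 1) ->
  c1 = N + 1 + a1 + b1 -> c2 = N + 1 + a2 + b2 - (N + 1 + al2) / p2 ->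
  bounded_inf K p2 al1 al2.
Proof.
move=> p1 KE a10 a20 b11 alb c1E c2E.
have [C C0 HC] := ker1_mixnorm_le al1 p1 a10 a20 b11 alb c1E c2E.
(* The factor 2 pays for bounding a modulus by its real and imaginary parts. *)
exists (2 * C) => f mf foo.
have I z w : TB z -> TB w -> (intV (fun u => intV (fun e => ((\1_TBm u * \1_TBm e : R) *
    cabs (K z w u e * f u e))%:E)) <= C%:E * mixnorm_inf p2 al1 al2 f)%E.
  move=> z0 w0; apply: le_trans (HC f mf foo z w z0 w0).
  rewrite le_eqVlt; apply/orP; left; apply/eqP.
  by apply: eq_intV => u; apply: eq_intV => e; rewrite cabsM KE.
have Coo : (C%:E * mixnorm_inf p2 al1 al2 f < +oo)%E.
  by rewrite lte_mul_pinfty// lee_fin.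
split.
  apply/nullVVE; rewrite (_ : [set _ | _] = set0); first exact: negligible_set0.
  apply/seteqP; split => // -[z w] /= [z0 [w0]]; apply.
  exact: le_lt_trans (I z w z0 w0) Coo.
apply: esssupVV_le => z w z0 w0.
have Ioo := le_lt_trans (I z w z0 w0) Coo.
have hR := rintVV_le (fun u e => normRe_le_cabs (K z w u e * f u e)) Ioo.
have hI := rintVV_le (fun u e => normIm_le_cabs (K z w u e * f u e)) Ioo.
have I0 : (0 <= intV (fun u => intV (fun e => ((\1_TBm u * \1_TBm e : R) *
    cabs (K z w u e * f u e))%:E)))%E.
  apply: intV_ge0 => u; apply: intV_ge0 => e.
  by rewrite lee_fin mulr_ge0 ?cabs_ge0 ?mulr_ge0.
apply: EFin_le_2fine I0 (I z w z0 w0) Ioo.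
apply: le_trans (cabs_le _) _.
by rewrite -[2]/(1 + 1) mulrDl mul1r; exact: lerD hR hI.
Qed.

End boundedness.

(** * Divergent pairings *)

Section divergence.
Context (R : realType).
Local Open Scope ereal_scope.

(** Comparison with the integral: the term of index [k] is the minimum of the decreasing integrand
    on []k.+1, k.+2]], and these intervals are disjoint. *)
Lemma nneseries_powR_lty (p : R) : (1 < p)%R ->
  \sum_(k <oo) (powR k.+2%:R (- p))%:E < +oo.
Proof.
move=> p1; pose F (k : nat) : set R := `]k.+1%:R, k.+2%:R]%classic.
have mp : measurable_fun [set: R] (fun x => (powR x (- p))%:E) by exact: emeasurable_powRl.
have p0 (x : R) : 0 <= (powR x (- p))%:E by rewrite lee_fin powR_ge0.
have tF : trivIset setT F.
  apply: ltn_trivIset => j i ij; apply/seteqP; split => // x [] /=.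
  rewrite /F /= !in_itv/= => /andP[h1 h2] /andP[h3 h4].
  have : (i.+2%:R <= j.+1%:R :> R)%R by rewrite ler_nat.
  lra.
have mF k : measurable (F k : set (measurableTypeR R)) by exact: measurable_itv.
have := @ge0_integral_bigcup _ (measurableTypeR R) R lebesgue_measure F _ mF
  (measurable_funTS mp) (fun x _ => p0 x) tF.
set D := \bigcup_k F k => IE.
apply: (@le_lt_trans _ _ (\int[@lebesgue_measure R]_(x in D) (powR x (- p))%:E)).
  rewrite IE; apply: lee_nneseries => k _ //.
  rewrite [leLHS](_ : _ = \int[@lebesgue_measure R]_(x in F k) (powR k.+2%:R (- p))%:E).
    apply: ge0_le_integral => //.
    - by apply: measurable_funTS.
    - move=> x; rewrite /F/= in_itv/= => /andP[kx xk]; rewrite lee_fin !powRN.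
      have x0 : (0 < x)%R by apply: le_lt_trans kx.
      rewrite lef_pV2 ?posrE ?powR_gt0//; apply: ge0_ler_powR; rewrite ?nnegrE; lra.
  rewrite integral_cst//= lebesgue_measure_itv/= lte_fin ltr_nat ltnSn.
  by rewrite -EFinB -natrB// subSnn mule1.
apply: (@le_lt_trans _ _ (\int[@lebesgue_measure R]_(x in `[1%R, +oo[) (powR x (- p))%:E)).
  apply: ge0_subset_integral => //.
  - exact: bigcupT_measurable.
  - exact: measurable_funTS.
  - move=> x [k _]; rewrite /F/= !in_itv/= andbT => /andP[kx _].
    by apply: ltW; apply: le_lt_trans kx; rewrite ler1n.
by rewrite integral_powR_tail// ltry.
Qed.

Lemma nneseries_harmonic : \sum_(k <oo) (k.+1%:R^-1 : R)%:E = +oo.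
Proof.
apply/eqP; rewrite -leye_eq leNgt; apply/negP => Soo.
by apply: (@dvg_harmonic R); exact: nnseries_is_cvg Soo.
Qed.

Context d (T : measurableType d) (mu : {measure set T -> \bar R}).
Variable E : nat -> set T.
Hypothesis mE : forall k, measurable (E k).
Hypothesis tE : trivIset setT E.

Lemma integral_infinite (H : T -> R) (c : R) : measurable_fun [set: T] H ->
  (forall x, 0 <= H x)%R -> (0 < c)%R ->
  (forall k, (c / k.+1%:R)%:E <= \int[mu]_(x in E k) (H x)%:E) ->
  \int[mu]_x (H x)%:E = +oo.
Proof.
move=> mH H0 c0 HE.
have mH' : measurable_fun [set: T] (fun x => (H x)%:E) by exact/measurable_EFinP.
have H0' x : 0 <= (H x)%:E by rewrite lee_fin.
apply/eqP; rewrite -leye_eq.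
apply: (@le_trans _ _ (\int[mu]_(x in \bigcup_k E k) (H x)%:E)); last first.
  by apply: ge0_subset_integral => //; exact: bigcupT_measurable.
rewrite ge0_integral_bigcup//; last exact: measurable_funTS.
apply: (@le_trans _ _ (\sum_(k <oo) (c%:E * (k.+1%:R^-1 : R)%:E))); last first.
  apply: lee_nneseries => [k _ _|k _]; first by rewrite -EFinM lee_fin divr_ge0// ltW.
  by rewrite -EFinM; exact: HE.
rewrite nneseriesZl; last by move=> k _; rewrite lee_fin.
by rewrite nneseries_harmonic gt0_muley.
Qed.

(* A gliding hump: the weights [q k] are those for which [H] fails to define a
   functional on the weighted L^p space. *)
Lemma exists_divergent (W : T -> R) (q : nat -> R) (p C : R) : (1 < p)%R ->
  measurable_fun [set: T] W -> (forall x, 0 <= W x)%R -> (forall k, 0 < q k)%R ->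
  (forall k, \int[mu]_(x in E k) (W x)%:E <= (C * powR (q k) p)%:E) ->
  exists g : T -> R, [/\ measurable_fun [set: T] g, (forall x, 0 <= g x)%R,
    (forall k, exists2 r : R, (0 < r)%R & forall x, E k x -> g x = r),
    \int[mu]_x (powR (g x) p * W x)%:E < +oo &
    forall (H : T -> R) (c : R), measurable_fun [set: T] H ->
      (forall x, 0 <= H x)%R -> (0 < c)%R ->
      (forall k, (c * q k)%:E <= \int[mu]_(x in E k) (H x)%:E) ->
      \int[mu]_x (H x * g x)%:E = +oo].
Proof.
move=> p1 mW W0 q0 WE; have p0 : (0 < p)%R by lra.
(* With the value [l k] on [E k], the weighted p-norm is controlled by the convergent sum of [k.+2]
   to the power [- p], while the pairing with [H] dominates a harmonic sum. *)
pose l k : R := ((q k)^-1 / k.+2%:R)%R.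
have l0 k : (0 < l k)%R by rewrite divr_gt0// invr_gt0.
(* As the sets [E k] are disjoint, [xget] returns the one index whose set contains [x]. *)
pose le x : \bar R := (l (xget 0%N [set k | E k x]))%:E.
pose g x : R := fine ((le \_ (\bigcup_k E k)) x).
have gE k x : E k x -> g x = l k.
  move=> Ex; rewrite /g patchE mem_set; last by exists k.
  rewrite /le /=; congr l; apply: xget_unique => // j Ej; apply: contrapT => /eqP jk.
  have /trivIsetP/(_ j k I I jk) := tE; apply/eqP/set0P; by exists x.
have gN x : ~ (\bigcup_k E k) x -> g x = 0%R by move=> h; rewrite /g patchE memNset.
have g0 x : (0 <= g x)%R.
  have [[k _ Ek]|h] := pselect ((\bigcup_k E k) x); last by rewrite gN.
  by rewrite (gE k)// ltW.
have mg : measurable_fun [set: T] g.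
  have ml : measurable_fun [set: T] (le \_ (\bigcup_k E k)).
    apply/(measurable_restrictT _ (bigcupT_measurable _ mE)).
    apply/measurable_fun_bigcup => // k.
    apply: (eq_measurable_fun (cst (l k)%:E)) => // x; rewrite inE => Ex.
    have := gE k x Ex; rewrite /g patchE mem_set; last by exists k.
    by rewrite /le /= => ->.
  exact: (measurableT_comp (fine_measurable measurableT) ml).
have mpW : measurable_fun [set: T] (fun x => (powR (g x) p * W x)%:E).
  apply/measurable_EFinP; apply: measurable_funM => //.
  exact: measurableT_comp (@measurable_powR R p) mg.
have pW0 x : 0 <= (powR (g x) p * W x)%:E by rewrite lee_fin mulr_ge0 ?powR_ge0.
exists g; split => //.
- by move=> k; exists (l k) => // x; exact: gE.
- have -> : \int[mu]_x (powR (g x) p * W x)%:E =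
      \int[mu]_(x in \bigcup_k E k) (powR (g x) p * W x)%:E.
    rewrite [RHS]integral_mkcond; apply: eq_integral => x _; rewrite patchE.
    case: ifPn => //; rewrite notin_setE => h.
    by rewrite gN// powR0 ?mul0r// gt_eqF.
  rewrite ge0_integral_bigcup//; last exact: measurable_funTS.
  have C0 : (0 <= C)%R.
    have := WE 0%N; rewrite -(@pmulr_lge0 _ (powR (q 0%N) p)) ?powR_gt0// -lee_fin.
    by apply: le_trans; apply: integral_ge0 => x _; rewrite lee_fin.
  apply: (@le_lt_trans _ _ (\sum_(k <oo) (C%:E * (powR k.+2%:R (- p))%:E))).
    apply: lee_nneseries => k _; first by move=> _; apply: integral_ge0.
    rewrite [leLHS](_ : _ = \int[mu]_(x in E k) ((powR (l k) p)%:E * (W x)%:E)); last first.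
      by apply: eq_integral => x; rewrite inE => Ex; rewrite (gE k x Ex) EFinM.
    have mWk : measurable_fun (E k) (fun x => (W x)%:E).
      by apply: measurable_funTS; exact/measurable_EFinP.
    have Wk x : E k x -> 0 <= (W x)%:E by rewrite lee_fin.
    rewrite ge0_integralZl ?lee_fin ?powR_ge0//.
    apply: le_trans (lee_wpmul2l _ (WE k)) _; first by rewrite lee_fin powR_ge0.
    rewrite -!EFinM lee_fin mulrCA ler_wpM2l// /l -powRM; last 2 first.
    + by rewrite divr_ge0// invr_ge0 ltW.
    + exact: ltW.
    rewrite mulrAC mulVf ?mul1r; last by rewrite gt_eqF.
    by rewrite -powR_inv1// -powRrM mulN1r.
  rewrite nneseriesZl; last by move=> k _; rewrite lee_fin powR_ge0.
  by rewrite lte_mul_pinfty// ?lee_fin// nneseries_powR_lty.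
- move=> H c mH H0 c0 HE.
  (* The half comes from [k.+2 <= 2 * k.+1]. *)
  apply: (@integral_infinite _ (c / 2)) => //.
  + exact: measurable_funM.
  + by move=> x; rewrite mulr_ge0.
  + by rewrite divr_gt0.
  move=> k; rewrite [leRHS](_ : _ = \int[mu]_(x in E k) ((l k)%:E * (H x)%:E)); last first.
    by apply: eq_integral => x; rewrite inE => Ex; rewrite (gE k x Ex) mulrC EFinM.
  have mHk : measurable_fun (E k) (fun x => (H x)%:E).
    by apply: measurable_funTS; exact/measurable_EFinP.
  have Hk x : E k x -> 0 <= (H x)%:E by rewrite lee_fin.
  have lk0 : (0 <= l k)%R by exact: ltW.
  rewrite ge0_integralZl ?lee_fin//.
  apply: le_trans (lee_wpmul2l _ (HE k)); last by rewrite lee_fin ltW.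
  rewrite -EFinM lee_fin /l.
  have -> : ((q k)^-1 / k.+2%:R * (c * q k) = c / k.+2%:R)%R.
    have qk := lt0r_neq0 (q0 k); have k2 : k.+2%:R != 0%R :> R by rewrite pnatr_eq0.
    by move: qk k2 => qk; move: (k.+2%:R : R) => kk kk0; field; rewrite qk kk0.
  rewrite -mulrA ler_pM2l// -invfM lef_pV2 ?posrE// ?mulr_gt0//.
  by rewrite -natrM ler_nat; lia.
Qed.

End divergence.

(** * The kernel on boxes *)

Section comparability.
Context (R : realType).

(** The hypotheses place [y] between [M^-1] and [M]. The absolute value of [p] avoids any discussion
    of the signs of the exponents. *)
Lemma powR_le_norm (y M p : R) : 0 < y -> 1 <= M -> y <= M -> 1 <= M * y ->
  powR y p <= powR M `|p|.
Proof.
move=> y0 M1 yM My; have M0 : 0 < M by lra.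
have [p0|p0] := leP 0 p; first by rewrite ger0_norm//; apply: ge0_ler_powR; rewrite ?nnegrE ?(ltW y0) ?(ltW M0).
rewrite -[p in leLHS]opprK powRN -[leRHS]invrK lef_pV2 ?posrE ?invr_gt0 ?powR_gt0//.
rewrite -powRN -[- `|_|]mulN1r powRrM powR_inv1 ?(ltW M0)// (ltr0_norm p0).
by apply: ge0_ler_powR; rewrite ?nnegrE ?invr_ge0 ?(ltW y0) ?(ltW M0) ?oppr_ge0 ?(ltW p0)// -[_^-1]mul1r ler_pdivrMr// mulrC.
Qed.

Lemma powR_comparable (x t M p : R) : 0 < t -> 1 <= M -> t <= M * x -> x <= M * t ->
  powR M (- `|p|) * powR t p <= powR x p <= powR M `|p| * powR t p.
Proof.
move=> t0 M1 tx xt; have M0 : 0 < M by lra.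
have x0 : 0 < x by rewrite -(pmulr_rgt0 _ M0); exact: lt_le_trans tx.
apply/andP; split.
  rewrite powRN mulrC ler_pdivrMr ?powR_gt0//.
  rewrite -ler_pdivrMl ?powR_gt0// -powRN.
  have -> : powR x (- p) * powR t p = powR (t / x) p.
    by rewrite powRM ?invr_ge0 ?(ltW t0) ?(ltW x0)// -powR_inv1 ?(ltW x0)// -powRrM mulN1r mulrC.
  apply: powR_le_norm => //; first by rewrite divr_gt0.
    by rewrite ler_pdivrMr.
  by rewrite mulrA ler_pdivlMr// mul1r.
rewrite -ler_pdivrMr ?powR_gt0// -powRN.
have -> : powR x p * powR t (- p) = powR (x / t) p.
  by rewrite powRM ?invr_ge0 ?(ltW t0) ?(ltW x0)// -powR_inv1 ?(ltW t0)// -powRrM mulN1r.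
apply: powR_le_norm => //; first by rewrite divr_gt0.
  by rewrite ler_pdivrMr.
by rewrite mulrA ler_pdivlMr// mul1r.
Qed.

End comparability.

(** * Size of the kernel and of the weight on boxes *)

Section box_estimates.
Context (R : realType) (m : nat).
Implicit Types (z u : Pt R m.+1) (k s t M : R).
Local Notation N := (m.+1%:R : R).
Local Notation V := (vol R m.+1).

(** Weaker than lying in a box: [rho u] is bounded above by the scale but may be much smaller. Thus
    a fixed point is at every scale [1 <= s] for one [M], and boxes close to the boundary are
    covered. *)
Definition at_scale M s u := [/\ forall j, (j < m)%N ->
    `|xco u j| <= M * s /\ `|yco u j| <= M * s,
  `|xco u m| <= M * s ^+ 2, 0 < rho u & rho u <= M * s ^+ 2].

Lemma box_at_scale k s t M u : 0 < s -> 0 < t -> k <= M -> 2 * t <= M * s ^+ 2 ->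
  box k s t u -> at_scale M s u.
Proof.
move=> s0 t0 kM tM [h1 h2 /andP[tu ut]]; split.
- move=> j /h1[hx hy]; split; [apply: le_trans hx _|apply: le_trans hy _];
  by rewrite ler_wpM2r// ltW.
- by apply: le_trans h2 _; rewrite ler_wpM2r// sqr_ge0.
- exact: lt_trans tu.
- exact: le_trans ut tM.
Qed.

(** In the upper bound for the modulus, the real and the imaginary part each account for half of
    this constant. *)
Definition cmp_const M : R := 2 * M + 4 * m%:R * M ^+ 2.

Lemma cabs_rho2_comparable M s z u : 1 <= M -> 0 < s -> at_scale M s z -> at_scale M s u ->
  s ^+ 2 <= M * (rho z + rho u) ->
  s ^+ 2 <= cmp_const M * cabs (rho2 z u) /\
  cabs (rho2 z u) <= cmp_const M * s ^+ 2.
Proof.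
move=> M1 s0 [zxy zx z0 zr] [uxy ux u0 ur] zu.
have M0 : 0 < M by lra.
have S0 : 0 < s ^+ 2 by rewrite exprn_gt0.
have m0 : 0 <= m%:R :> R by [].
have Q0 := sqdist'_ge0 z u.
have ReE := Re_rho2 z u.
have W1 : complex.Re (rho2 z u) <= cabs (rho2 z u).
  exact: le_trans (ler_norm _) (normRe_le_cabs _).
have W0 : 0 <= cabs (rho2 z u) by exact: cabs_ge0.
have diff (x y : R) : `|x| <= M * s -> `|y| <= M * s -> `|x - y| <= 2 * M * s.
  by move=> hx hy; apply: le_trans (ler_normB _ _) _; lra.
have sum (x y : R) : `|x| <= M * s -> `|y| <= M * s -> `|x + y| <= 2 * M * s.
  by move=> hx hy; apply: le_trans (ler_normD _ _) _; lra.
have Ms0 : 0 <= 2 * M * s by rewrite !mulr_ge0// ltW.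
split.
  apply: le_trans zu _; rewrite /cmp_const mulrDl.
  have h : 0 <= 4 * m%:R * M ^+ 2 * cabs (rho2 z u) by apply: mulr_ge0 => //; apply: mulr_ge0; [exact: mulr_ge0|exact: sqr_ge0].
  have : M * (rho z + rho u) <= M * (2 * cabs (rho2 z u)).
    by rewrite ler_pM2l//; lra.
  lra.
have QM : sqdist' z u <= m%:R * (8 * M ^+ 2 * s ^+ 2).
  rewrite /sqdist' /= -[m%:R]/(m%:R) -mulr_natl.
  have -> : m%:R * 1 * (8 * M ^+ 2 * s ^+ 2) = \sum_(j < m) (8 * M ^+ 2 * s ^+ 2).
    by rewrite sumr_const card_ord mulr1 mulr_natl.
  apply: ler_sum => j _; have [zxj zyj] := zxy j (ltn_ord j).
  have [uxj uyj] := uxy j (ltn_ord j).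
  rewrite -[(xco z j - _) ^+ 2](real_normK (num_real _)).
  rewrite -[(yco z j - _) ^+ 2](real_normK (num_real _)).
  have := lerXn2r 2 (normr_ge0 _) Ms0 (diff _ _ zxj uxj).
  have := lerXn2r 2 (normr_ge0 _) Ms0 (diff _ _ zyj uyj).
  rewrite !exprMn; lra.
have IM : `|complex.Im (rho2 z u)| <= (m%:R * (4 * M ^+ 2 * s ^+ 2) + 2 * M * s ^+ 2) / 2.
  rewrite Im_rho2 /= normrM [`|_^-1|]ger0_norm// ler_pM2r//.
  apply: le_trans (ler_normB _ _) _; apply: lerD.
    apply: le_trans (ler_norm_sum _ _ _) _.
    have -> : m%:R * (4 * M ^+ 2 * s ^+ 2) = \sum_(j < m) (4 * M ^+ 2 * s ^+ 2).
      by rewrite sumr_const card_ord mulr_natl.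
    apply: ler_sum => j _; have [zxj zyj] := zxy j (ltn_ord j).
    have [uxj uyj] := uxy j (ltn_ord j); rewrite normrM.
    have := ler_pM (normr_ge0 _) (normr_ge0 _) (diff _ _ zxj uxj) (sum _ _ zyj uyj).
    by move=> /le_trans; apply; rewrite le_eqVlt; apply/orP; left; apply/eqP; ring.
  by apply: le_trans (ler_normB _ _) _; lra.
apply: le_trans (cabs_le _) _; rewrite [`|complex.Re _|]ger0_norm.
  by rewrite ReE /cmp_const; lra.
by rewrite ReE; lra.
Qed.

Lemma cmp_const_ge1 M : 1 <= M -> 1 <= cmp_const M.
Proof.
move=> M1; rewrite /cmp_const; have : 0 <= 4 * m%:R * M ^+ 2.
  by apply: mulr_ge0; [exact: mulr_ge0|exact: sqr_ge0].
lra.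
Qed.

Lemma vboxE k s t : 0 <= s ->
  vbox m k s t = (2 * k) ^+ (m + m).+1 * powR (s ^+ 2) N * t.
Proof.
move=> s0; rewrite powR_mulrn ?sqr_ge0// /vbox.
rewrite [(s ^+ 2) ^+ _]exprS exprAC [(2 * k) ^+ _]exprS exprD.
rewrite (mulrA 2 k s) (exprMn m (2 * k) s).
by move: ((2 * k) ^+ m) (s ^+ m) => x y; ring.
Qed.

(** Up to constants, the kernel on the box equals its value with [rho u] replaced by [t] and the
    modulus of [rho2 z u] by [s ^+ 2]; it remains to multiply by the volume of the box, of order [t]
    times the [N]-th power of [s ^+ 2]. *)
Lemma box_ker1_ge (a b c k M : R) : 0 < k -> k <= M -> 1 <= M ->
  exists2 C : R, 0 < C & forall z s t, 0 < s -> 0 < t -> 2 * t <= M * s ^+ 2 ->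
  at_scale M s z -> s ^+ 2 <= M * (rho z + t) ->
  ((C * powR (rho z) a * powR t (b + 1) * powR (s ^+ 2) (N - c))%:E <=
   \int[V]_(u in box k s t) (ker1 a b c z u)%:E)%E.
Proof.
move=> k0 kM M1; have K1 := cmp_const_ge1 M1; have K0 : 0 < cmp_const M by lra.
pose L := powR 2 (- `|b|) * powR (cmp_const M) (- `|- c|).
have L0 : 0 < L by rewrite mulr_gt0 ?powR_gt0.
exists (L * (2 * k) ^+ (m + m).+1).
  by rewrite mulr_gt0// exprn_gt0// mulr_gt0.
move=> z s t s0 t0 tM zM zt; have S0 : 0 < s ^+ 2 by rewrite exprn_gt0.
have low u : box k s t u ->
    L * powR (rho z) a * powR t b * powR (s ^+ 2) (- c) <= ker1 a b c z u.
  move=> ub; have uM := box_at_scale s0 t0 kM tM ub.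
  have [_ _ /andP[tu ut]] := ub.
  have [W1 W2] : s ^+ 2 <= cmp_const M * cabs (rho2 z u) /\
      cabs (rho2 z u) <= cmp_const M * s ^+ 2.
    apply: cabs_rho2_comparable => //; apply: le_trans zt _.
    by rewrite ler_pM2l ?lerD2l ?(ltW tu)//; lra.
  have /andP[hW _] := powR_comparable (- c) S0 K1 W1 W2.
  have [tu2 two] : t <= 2 * rho u /\ 1 <= 2 :> R by split; lra.
  have /andP[hu _] := powR_comparable b t0 two tu2 ut.
  rewrite /ker1 -powRN -mulrA -[leRHS]mulrA.
  have -> : L * powR (rho z) a * (powR t b * powR (s ^+ 2) (- c)) =
     powR (rho z) a * ((powR 2 (- `|b|) * powR t b) *
      (powR (cmp_const M) (- `|- c|) * powR (s ^+ 2) (- c))) by rewrite /L; ring.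
  by rewrite ler_wpM2l ?powR_ge0// ler_pM ?mulr_ge0 ?powR_ge0.
have mb : measurable (@box R m k s t) by exact: measurable_box.
apply: (@le_trans _ _ (\int[V]_(u in box k s t)
    (L * powR (rho z) a * powR t b * powR (s ^+ 2) (- c))%:E)%E).
  rewrite integral_cst// [X in (_ <= _ * X)%E](vol_box m (ltW k0) (ltW s0) (ltW t0)).
  rewrite vboxE ?(ltW s0)// -EFinM lee_fin !gt0_powRD// powRr1 ?(ltW t0)//.
  rewrite le_eqVlt; apply/orP; left; apply/eqP.
  move: ((2 * k) ^+ _) (powR (s ^+ 2) N) (powR (s ^+ 2) (- c)) (powR t b) (powR (rho z) a).
  by move=> *; ring.
apply: ge0_le_integral => //.
- by move=> u _; rewrite lee_fin !mulr_ge0 ?powR_ge0// ltW.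
- by apply: measurable_funTS; apply/measurable_EFinP; exact: measurable_ker1.
Qed.

Lemma box_weight_le (al k : R) : 0 < k ->
  exists2 C : R, 0 <= C & forall s t, 0 < s -> 0 < t ->
  (\int[V]_(u in box k s t) (powR (rho u) al)%:E <=
   (C * powR t (al + 1) * powR (s ^+ 2) N)%:E)%E.
Proof.
move=> k0; exists (powR 2 `|al| * (2 * k) ^+ (m + m).+1).
  by rewrite mulr_ge0 ?powR_ge0// exprn_ge0// mulr_ge0// ltW.
move=> s t s0 t0; have mb : measurable (@box R m k s t) by exact: measurable_box.
apply: (@le_trans _ _ (\int[V]_(u in box k s t) (powR 2 `|al| * powR t al)%:E)%E).
  apply: ge0_le_integral => //.
  - by move=> u _; rewrite lee_fin powR_ge0.
  - by apply: measurable_funTS; apply/measurable_EFinP; exact: measurable_powR_rho.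
  - move=> u [_ _ /andP[tu ut]]; rewrite lee_fin.
    have [tu2 two] : t <= 2 * rho u /\ 1 <= 2 :> R by split; lra.
    by have /andP[_] := powR_comparable al t0 two tu2 ut.
rewrite integral_cst// [X in (_ * X <= _)%E](vol_box m (ltW k0) (ltW s0) (ltW t0)).
rewrite vboxE ?(ltW s0)// -EFinM lee_fin gt0_powRD// powRr1 ?(ltW t0)//.
rewrite le_eqVlt; apply/orP; left; apply/eqP.
move: ((2 * k) ^+ _) (powR (s ^+ 2) N) (powR t al) (powR 2 `|al|).
by move=> *; ring.
Qed.

End box_estimates.

(** * Necessity *)

Section test_functions.
Context (R : realType) (m : nat).
Local Notation V := (vol R m.+1).
Local Notation TBm := (@TB R m.+1).
Local Notation N := (m.+1%:R : R).
Implicit Types (phi g : Pt R m.+1 -> R).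

Lemma intVV_mul phi g : measurable_fun [set: Pt R m.+1] phi ->
  measurable_fun [set: Pt R m.+1] g -> (forall u, 0 <= phi u) -> (forall e, 0 <= g e) ->
  (intV (fun u => intV (fun e => (phi u * g e)%:E)) =
   \int[V]_u (phi u)%:E * \int[V]_e (g e)%:E)%E.
Proof.
move=> mphi mg phi0 g0.
have mphi' : measurable_fun [set: Pt R m.+1] (fun u => (phi u)%:E) by exact/measurable_EFinP.
have mg' : measurable_fun [set: Pt R m.+1] (fun u => (g u)%:E) by exact/measurable_EFinP.
have phi0' u : (0 <= (phi u)%:E)%E by rewrite lee_fin.
have g0' u : (0 <= (g u)%:E)%E by rewrite lee_fin.
have inner u : intV (fun e => (phi u * g e)%:E) = ((phi u)%:E * \int[V]_e (g e)%:E)%E.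
  rewrite intVE.
  - by rewrite -ge0_integralZl.
  - by apply/measurable_EFinP; exact: measurable_funM.
  - by move=> e; rewrite lee_fin mulr_ge0.
have I0 : (0 <= \int[V]_e (g e)%:E)%E by exact: integral_ge0.
rewrite (eq_intV inner) intVE.
- by rewrite ge0_integralZr.
- exact: emeasurable_funM.
- by move=> u; exact: mule_ge0.
Qed.

Definition test_fun phi g (u e : Pt R m.+1) : R[i] := Complex (phi u * g e) 0.

Lemma cabs_test_fun phi g u e : 0 <= phi u -> 0 <= g e ->
  cabs (test_fun phi g u e) = phi u * g e.
Proof. by move=> *; rewrite (@cabs_real R)// mulr_ge0. Qed.

Lemma cmeasurable_test_fun phi g : measurable_fun [set: Pt R m.+1] phi ->
  measurable_fun [set: Pt R m.+1] g -> cmeasurable (test_fun phi g).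
Proof.
move=> mphi mg; split => //=; apply: measurable_funM.
- exact: measurableT_comp mphi measurable_fst.
- exact: measurableT_comp mg measurable_snd.
Qed.

Lemma mixnorm_test_fun_le (p al1 al2 : R) phi g : 0 < p ->
  measurable_fun [set: Pt R m.+1] g ->
  (forall u, 0 <= phi u <= 1) -> (forall e, 0 <= g e) ->
  (mixnorm_inf p al1 al2 (test_fun phi g) <=
   (\int[V]_e (powR (g e) p * (\1_TBm e * powR (rho e) al2))%:E) `^ p^-1)%E.
Proof.
move=> p0 mg phi01 g0.
have phi0 u : 0 <= phi u by have /andP[] := phi01 u.
have ess e : (esssupV al1 (fun z => (cabs (test_fun phi g z e))%:E) <= (g e)%:E)%E.
  apply: esssupV_le => z _; rewrite lee_fin cabs_test_fun// ler_piMl//.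
  by have /andP[] := phi01 z.
have ess0 e : (0 <= esssupV al1 (fun z => (cabs (test_fun phi g z e))%:E))%E.
  by apply: esssupV_ge0 => z; rewrite lee_fin cabs_ge0.
have mW : measurable_fun [set: Pt R m.+1]
    (fun e => (powR (g e) p * (\1_TBm e * powR (rho e) al2))%:E).
  apply/measurable_EFinP; apply: measurable_funM.
    exact: measurableT_comp (@measurable_powR R p) mg.
  by apply: measurable_funM; [exact: measurable_indic_TB|exact: measurable_powR_rho].
have W0 e : (0 <= (powR (g e) p * (\1_TBm e * powR (rho e) al2))%:E)%E.
  by rewrite lee_fin mulr_ge0 ?powR_ge0// mulr_ge0 ?powR_ge0.
have N0 e : (0 <= (\1_TBm e)%:E * (esssupV al1
    (fun z => (cabs (test_fun phi g z e))%:E)) `^ p * (powR (rho e) al2)%:E)%E.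
  by apply: mule_ge0; [apply: mule_ge0; [rewrite lee_fin|exact: poweR_ge0]|rewrite lee_fin powR_ge0].
rewrite /mixnorm_inf -(intVE mW W0); apply: gt0_ler_poweR.
- by rewrite invr_ge0 ltW.
- by rewrite in_itv/= leey andbT; exact: intV_ge0.
- by rewrite in_itv/= leey andbT; exact: intV_ge0.
apply: le_intV => // e.
have -> : (powR (g e) p * (\1_TBm e * powR (rho e) al2))%:E =
    ((\1_TBm e)%:E * (g e)%:E `^ p * (powR (rho e) al2)%:E)%E.
  by rewrite poweR_EFin -!EFinM; congr EFin; ring.
apply: lee_wpmul2r; first by rewrite lee_fin powR_ge0.
apply: lee_wpmul2l; first by rewrite lee_fin.
apply: gt0_ler_poweR; [exact: ltW| | |exact: ess].
- by rewrite in_itv/= leey andbT ess0.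
- by rewrite in_itv/= leey andbT lee_fin.
Qed.

(** It turns an almost everywhere statement into one point where the first variable is in [A] and
    the second in [B]. *)
Lemma setX_not_negligible (A B : set (Pt R m.+1)) : measurable A -> measurable B ->
  ~ V.-negligible A -> ~ V.-negligible B -> ~ (V \x V)%E.-negligible (A `*` B).
Proof.
move=> mA mB nA nB /(negligibleP _ (measurableX mA mB)).
rewrite [LHS](product_measure1E V V mA mB) => /eqP; rewrite mule_eq0 => /orP[]/eqP h.
- by apply: nA; apply/negligibleP.
- by apply: nB; apply/negligibleP.
Qed.

Lemma esssupVV_lt (h : Pt R m.+1 -> Pt R m.+1 -> \bar R) (M : \bar R) :
  (esssupVV h < M)%E ->
  (V \x V)%E.-negligible [set zw | TB zw.1 /\ TB zw.2 /\ (M <= h zw.1 zw.2)%E].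
Proof.
move=> /ereal_inf_lt[q /= /nullVVE hq qM]; apply: negligibleS hq => -[z w] /= [Tz [Tw Mz]].
by split => //; split => //; exact: lt_le_trans qM Mz.
Qed.

End test_functions.

(** * Dyadic families of boxes *)

Section dyadic_boxes.
Context (R : realType) (m : nat).
Local Notation V := (vol R m.+1).
Local Notation TBm := (@TB R m.+1).
Local Notation N := (m.+1%:R : R).
Implicit Types (s t : nat -> R).

Lemma trivIset_box s t : (forall i j, (i < j)%N -> 2 * t i <= t j \/ 2 * t j <= t i) ->
  trivIset setT (fun k => @box R m 1 (s k) (t k)).
Proof.
move=> st; apply: ltn_trivIset => j i ij; apply/seteqP; split => // u [].
by move=> [_ _ /andP[h1 h2]] [_ _ /andP[h3 h4]]; case: (st _ _ ij) => h; move: h1 h2 h3 h4; lra.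
Qed.

(** [M] exceeds all coordinates of [z]. It also exceeds the inverse of [rho z], which bounds the
    kernel modulus from below when [s = 1] and [t] tends to 0. *)
Lemma exists_scale z : TB z -> exists2 M : R, 2 <= M &
  (forall s : R, 1 <= s -> @at_scale R m M s z) /\ 1 <= M * rho z.
Proof.
move=> z0; have r0 : 0 < rho z := z0.
pose S := \sum_(j < m) (`|xco z j| + `|yco z j|).
have S0 : 0 <= S by apply: sumr_ge0 => j _; exact: addr_ge0.
have V0 : 0 < (rho z)^-1 by rewrite invr_gt0.
have x0 : 0 <= `|xco z m| by [].
pose M := S + `|xco z m| + rho z + (rho z)^-1 + 2.
have M0 : 0 <= M by rewrite /M; lra.
exists M; first by rewrite /M; lra.
split=> [s s1|]; last first.
  rewrite -(mulVf (lt0r_neq0 r0)) ler_pM2r// /M; lra.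
have leM (x : R) : x <= M -> x <= M * s.
  by move=> /le_trans; apply; rewrite ler_peMr.
have leM2 (x : R) : x <= M -> x <= M * s ^+ 2.
  by move=> /le_trans; apply; rewrite ler_peMr// exprn_ege1.
split => //.
- move=> j jm; have : `|xco z j| + `|yco z j| <= S.
    rewrite /S (bigD1 (Ordinal jm))//= lerDl.
    by apply: sumr_ge0 => i _; exact: addr_ge0.
  have hx : 0 <= `|xco z j| by []. have hy : 0 <= `|yco z j| by [].
  by move=> h; split; apply: leM; rewrite /M; lra.
- by apply: leM2; rewrite /M; lra.
- by apply: leM2; rewrite /M; lra.
Qed.

Lemma integral_box_TB (k s t : R) (F : Pt R m.+1 -> R) : 0 <= t ->
  (\int[V]_(u in box k s t) (\1_TBm u * F u)%:E = \int[V]_(u in box k s t) (F u)%:E)%E.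
Proof.
move=> t0; apply: eq_integral => u; rewrite inE => ub.
by rewrite indicE mem_set ?mul1r//; exact: box_TB ub.
Qed.

(* Both families of test boxes, those shrinking to the boundary ([s = 1]) and
   those escaping to infinity ([t = s ^+ 2]), satisfy these hypotheses. *)
Lemma dyadic_box_ker1_ge (a b c : R) z s t : TB z ->
  (forall k, 1 <= s k) -> (forall k, 0 < t k <= s k ^+ 2) ->
  (forall k, s k = 1 \/ t k = s k ^+ 2) ->
  exists2 C : R, 0 < C & forall k,
  ((C * (powR (t k) (b + 1) * powR (s k ^+ 2) (N - c)))%:E <=
   \int[V]_(u in box 1 (s k) (t k)) (\1_TBm u * ker1 a b c z u)%:E)%E.
Proof.
move=> z0 s1 t01 st; have r0 : 0 < rho z := z0.
have [M M2 [zM Mz]] := exists_scale z0.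
have [M1 M10] : 1 <= M /\ 0 <= M by split; lra.
have [C C0 HC] := @box_ker1_ge R m a b c 1 M ltr01 M1 M1.
exists (C * powR (rho z) a) => [|k]; first by rewrite mulr_gt0// powR_gt0.
have /andP[t0 ts] := t01 k; have s0 : 0 < s k := lt_le_trans ltr01 (s1 k).
rewrite integral_box_TB ?(ltW t0)// mulrA; apply: HC => //.
- apply: (@le_trans _ _ (2 * s k ^+ 2)); first by rewrite ler_pM2l.
  by rewrite ler_wpM2r// sqr_ge0.
- exact: zM.
- rewrite mulrDr; case: (st k) => [->|<-].
    rewrite expr1n; apply: le_trans Mz _; rewrite lerDl mulr_ge0// ltW//.
  apply: (@le_trans _ _ (M * t k)); first by rewrite ler_peMl// ltW.
  by rewrite lerDr mulr_ge0// ltW.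
Qed.

(** The weighted measure of a box is written as a [p]-th power, because its [p]-th root is the
    quantity [q k] of the gliding hump. *)
Lemma dyadic_box_weight_le (al p : R) s t : 0 < p ->
  (forall k, 1 <= s k) -> (forall k, 0 < t k) ->
  exists C : R, forall k,
  (\int[V]_(u in box 1 (s k) (t k)) (\1_TBm u * powR (rho u) al)%:E <=
   (C * powR (powR (t k) ((al + 1) / p) * powR (s k ^+ 2) (N / p)) p)%:E)%E.
Proof.
move=> p0 s1 t0; have [C C0 HC] := @box_weight_le R m al 1 ltr01.
exists C => k; have s0 : 0 < s k := lt_le_trans ltr01 (s1 k).
rewrite integral_box_TB ?(ltW (t0 k))// powRM ?powR_ge0// -!powRrM !mulfVK ?gt_eqF//.
by rewrite mulrA; exact: HC.
Qed.

End dyadic_boxes.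

(** * Lower bounds for real integrals *)

Section real_integral.
Context (R : realType) (m : nat).
Local Notation V := (vol R m.+1).
Local Notation TBm := (@TB R m.+1).

Lemma half_mul_le (x y r : R) : x * y <= 2 * r -> x / 2 * y <= r.
Proof. by move=> ?; lra. Qed.

Lemma indic_mul_le (T : Type) (A1 A2 B : set T) (u e : T) (x y r : R) :
  0 <= x -> 0 <= y -> (A1 u -> A2 e -> (B u /\ B e) /\ x * y <= 2 * r) ->
  0 <= r * (\1_A1 u * \1_A2 e) /\
  \1_B u * x * \1_A1 u * (\1_B e * y * \1_A2 e) <=
  2 * ((\1_B u * \1_B e : R) * (r * (\1_A1 u * \1_A2 e))).
Proof.
move=> x0 y0 H; have xy0 := mulr_ge0 x0 y0.
rewrite [\1_A1 u]indicE [\1_A2 e]indicE.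
case: (boolP (u \in A1)) => [|_]; last by rewrite !(mulr0, mul0r).
case: (boolP (e \in A2)) => [|_]; last by rewrite !(mulr0, mul0r).
rewrite !inE => eA uA; have [[uB eB] h] := H uA eA.
by rewrite !indicE !mem_set//= !(mulr1, mul1r); split => //; lra.
Qed.

Lemma intV_0 : intV (fun _ : Pt R m.+1 => 0%E) = 0%E.
Proof. by rewrite intVE ?integral0. Qed.

Lemma fineB0_ge (x : R) (y : \bar R) : (x%:E <= y)%E -> (y < +oo)%E ->
  x <= fine y - fine 0%E.
Proof. by case: y => //= y; rewrite lee_fin subr0. Qed.

(** For nonnegative [h] the integral of the negative part is 0, and the positive part dominates a
    tensor product, whose integral factors. *)
Lemma rintVV_ge (h : Pt R m.+1 -> Pt R m.+1 -> R) (k1 k2 : Pt R m.+1 -> R) (L1 L2 : R) :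
  measurable_fun [set: Pt R m.+1] k1 -> measurable_fun [set: Pt R m.+1] k2 ->
  (forall u, 0 <= k1 u) -> (forall e, 0 <= k2 e) -> 0 <= L1 -> 0 <= L2 ->
  (forall u e, 0 <= h u e) ->
  (forall u e, k1 u * k2 e <= (\1_TBm u * \1_TBm e : R) * h u e) ->
  (intV (fun u => intV (fun e => ((\1_TBm u * \1_TBm e : R) * h u e)%:E)) < +oo)%E ->
  (L1%:E <= \int[V]_u (k1 u)%:E)%E -> (L2%:E <= \int[V]_u (k2 u)%:E)%E ->
  L1 * L2 <= rintVV h.
Proof.
move=> mk1 mk2 k10 k20 L10 L20 h0 kh hoo HL1 HL2.
have maxE : (fun u => intV (fun e => ((\1_TBm u * \1_TBm e : R) * Num.max (h u e) 0)%:E)) =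
    (fun u => intV (fun e => ((\1_TBm u * \1_TBm e : R) * h u e)%:E)).
  apply/funext => u; apply: eq_intV => e; congr EFin.
  by have /max_idPl -> := h0 u e.
have maxN : (fun u => intV (fun e => ((\1_TBm u * \1_TBm e : R) * Num.max (- h u e) 0)%:E)) =
    (fun=> 0%E).
  apply/funext => u; rewrite -[RHS]intV_0; apply: eq_intV => e; congr EFin.
  have /max_idPr -> : - h u e <= 0 by rewrite oppr_le0; exact: h0.
  exact: mulr0.
have -> : rintVV h = fine (intV (fun u => intV (fun e =>
    ((\1_TBm u * \1_TBm e : R) * h u e)%:E))) - fine 0%E.
  have YE := etrans (congr1 (@intV R m.+1) maxN) intV_0.
  exact: (f_equal2 (fun x y => fine x - fine y) (congr1 (@intV R m.+1) maxE) YE).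
apply: fineB0_ge; last exact: hoo.
apply: le_trans (_ : _ <= intV (fun u => intV (fun e => (k1 u * k2 e)%:E)))%E _.
  rewrite (intVV_mul mk1 mk2 k10 k20) EFinM; apply: lee_pmul;
    [by rewrite lee_fin|by rewrite lee_fin|exact: HL1|exact: HL2].
have kk0 u e : (0 <= (k1 u * k2 e)%:E)%E by rewrite lee_fin mulr_ge0.
apply: le_intV => u; first by apply: intV_ge0 => e; exact: kk0.
by apply: le_intV => e; [exact: kk0|rewrite lee_fin; exact: kh].
Qed.

End real_integral.

(** * Consequences of boundedness for the exponents *)

Section necessity.
Context (R : realType) (m : nat).
Local Notation V := (vol R m.+1).
Local Notation TBm := (@TB R m.+1).
Local Notation N := (m.+1%:R : R).
Context (K : Pt R m.+1 -> Pt R m.+1 -> Pt R m.+1 -> Pt R m.+1 -> R[i]).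
Context (p2 a1 a2 b1 b2 c1 c2 al1 al2 : R).
Hypothesis p1 : 1 < p2.
Hypothesis KE : forall z w u e,
  cabs (K z w u e) = ker1 a1 b1 c1 z u * ker1 a2 b2 c2 w e.
Hypothesis bK : bounded_inf K p2 al1 al2.

Let p0 : 0 < p2. Proof. exact: lt_trans ltr01 p1. Qed.

Let box1 : set (Pt R m.+1) := box 1 1 1.

Let mbox (k s t : R) : measurable (@box R m k s t). Proof. exact: measurable_box. Qed.

Let mind (k s t : R) : measurable_fun [set: Pt R m.+1] (\1_(@box R m k s t) : _ -> R).
Proof. exact: measurable_indic. Qed.

Let ind01 (A : set (Pt R m.+1)) u : 0 <= (\1_A u : R) <= 1.
Proof. by rewrite indicE; case: (_ \in _); rewrite /= ?lexx ?ler01. Qed.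

(** For a nonnegative tensor product the absolute integral factors, and its almost everywhere
    finiteness holds at some point of the product of [A] and [B], which is not negligible. *)
Lemma bounded_inf_integral_lty (phi g : Pt R m.+1 -> R) (A B : set (Pt R m.+1)) :
  measurable_fun [set: Pt R m.+1] phi -> measurable_fun [set: Pt R m.+1] g ->
  (forall u, 0 <= phi u <= 1) -> (forall e, 0 <= g e) ->
  (\int[V]_e (powR (g e) p2 * (\1_TBm e * powR (rho e) al2))%:E < +oo)%E ->
  measurable A -> measurable B -> A `<=` TBm -> B `<=` TBm ->
  ~ V.-negligible A -> ~ V.-negligible B ->
  exists z w, [/\ A z, B w &
    (\int[V]_u (\1_TBm u * ker1 a1 b1 c1 z u * phi u)%:E *
     \int[V]_e (\1_TBm e * ker1 a2 b2 c2 w e * g e)%:E < +oo)%E].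
Proof.
move=> mphi mg phi01 g0 goo mA mB AT BT nA nB.
have phi0 u : 0 <= phi u by have /andP[] := phi01 u.
have [C /(_ (test_fun phi g) (cmeasurable_test_fun mphi mg)) []] := bK.
  apply: le_lt_trans (mixnorm_test_fun_le al1 al2 p0 mg phi01 g0) _.
  exact: poweR_lty.
move=> /nullVVE nI _.
have [z [w [Az Bw Izw]]] : exists z w, [/\ A z, B w &
    integrableVV (fun u e => K z w u e * test_fun phi g u e)].
  apply: contrapT => nex; apply: (setX_not_negligible mA mB nA nB).
  apply: negligibleS nI => -[z w] /= [Az Bw]; split; first exact: AT.
  by split; [exact: BT|move=> I; apply: nex; exists z, w].
exists z, w; split => //; rewrite -intVV_mul.
- move: Izw; rewrite /integrableVV; apply: le_lt_trans.
  rewrite le_eqVlt; apply/orP; left; apply/eqP.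
  apply: eq_intV => u; apply: eq_intV => e; congr EFin.
  rewrite cabsM KE cabs_test_fun//.
  by move: (ker1 _ _ _ _ _) (ker1 _ _ _ _ _) => x y; ring.
- by apply: measurable_funM => //; exact: measurable_indic_ker1.
- by apply: measurable_funM => //; exact: measurable_indic_ker1.
- by move=> u; rewrite mulr_ge0// mulr_ge0// ker1_ge0.
- by move=> e; rewrite mulr_ge0// mulr_ge0// ker1_ge0.
Qed.

Let unit_scale (k : nat) : 1 <= (1 : R). Proof. by []. Qed.

(** Since [0 * +oo = 0], a finite product says something about one factor only if the other is known
    to be positive. *)
Lemma integral_box1_gt0 (a b c : R) z : TB z ->
  (0 < \int[V]_u (\1_TBm u * ker1 a b c z u * \1_box1 u)%:E)%E.
Proof.
move=> z0.
have [C C0 HC] := @dyadic_box_ker1_ge R m a b c z (fun=> 1) (fun=> 1) z0 unit_scale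
  (fun=> ltac:(by rewrite expr1n ltr01 lexx)) (fun=> or_introl erefl).
have := HC 0%N; rewrite expr1n !powR1 !mulr1 => h.
apply: lt_le_trans (_ : 0 < C%:E)%E _; first by rewrite lte_fin.
apply: le_trans h _; rewrite integral_mkcond.
rewrite le_eqVlt; apply/orP; left; apply/eqP; apply: eq_integral => u _.
rewrite patchE [\1_box1 u]indicE -/box1.
by case: ifPn => _; rewrite ?mulr1 ?mulr0.
Qed.

Let not_negligible_box1 : ~ V.-negligible box1.
Proof. exact: box_not_negligible. Qed.

Let box1_TB : box1 `<=` TBm. Proof. exact: box_TB. Qed.

Let integral_box1_weight :
  (\int[V]_e (powR (\1_box1 e) p2 * (\1_TBm e * powR (rho e) al2))%:E < +oo)%E.
Proof.
have [C HC] := @dyadic_box_weight_le R m al2 p2 (fun=> 1) (fun=> 1) p0 unit_scale (fun=> ltr01).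
apply: le_lt_trans (_ : _ <= (C * powR (powR 1 ((al2 + 1) / p2) * powR (1 ^+ 2) (N / p2)) p2)%:E)%E _;
  last exact: ltry.
apply: le_trans (HC 0%N); rewrite [leRHS]integral_mkcond.
rewrite le_eqVlt; apply/orP; left; apply/eqP; apply: eq_integral => u _.
rewrite patchE [\1_box1 u]indicE -/box1; case: ifPn => _; first by rewrite powR1 mul1r.
by rewrite powR0 ?gt_eqF// mul0r.
Qed.

Let lty_mul_gt0 (x y : \bar R) : (0 <= x)%E -> (0 < y)%E -> (x * y < +oo)%E -> (x < +oo)%E.
Proof.
move=> x0 y0; case: x x0 => [r| |]//= _; first by rewrite ltry.
by rewrite gt0_mulye// ltxx.
Qed.

(** The constant 1 is an admissible function of the first variable, because the norm there is an
    essential supremum; the indicator of a fixed box is used in the second. *)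
Lemma bounded_inf_ker1_lty : exists2 z, TB z &
  (\int[V]_u (\1_TBm u * ker1 a1 b1 c1 z u)%:E < +oo)%E.
Proof.
have one01 (u : Pt R m.+1) : 0 <= (1 : R) <= 1 by rewrite ler01 lexx.
have mone : measurable_fun [set: Pt R m.+1] (fun=> 1 : R) by exact: measurable_cst.
have ind0 u : 0 <= (\1_box1 u : R) by have /andP[] := ind01 box1 u.
have [z [w [Az Bw Izw]]] := bounded_inf_integral_lty mone
  (mind 1 1 1) one01 ind0 integral_box1_weight (mbox 1 1 1) (mbox 1 1 1) box1_TB box1_TB
  not_negligible_box1 not_negligible_box1.
exists z; first exact: box1_TB.
have := lty_mul_gt0 _ (integral_box1_gt0 a2 b2 c2 (box1_TB Bw)) Izw.
under eq_integral do rewrite mulr1.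
apply; apply: integral_ge0 => u _; by rewrite lee_fin mulr_ge0// ker1_ge0.
Qed.

(** In the first statement every box would carry kernel mass bounded below, against the
    integrability of the kernel in the first variable. In the second, up to constants, the left side
    is the weighted p2-norm of the indicator of a box and the right side its kernel mass: if the
    mass dominates on every box, the gliding hump gives a function of finite norm with infinite
    pairing. *)
Lemma bounded_inf_not_divergent (s t : nat -> R) :
  (forall i j, (i < j)%N -> 2 * t i <= t j \/ 2 * t j <= t i) ->
  (forall k, 1 <= s k) -> (forall k, 0 < t k <= s k ^+ 2) ->
  (forall k, s k = 1 \/ t k = s k ^+ 2) ->
  ~ (forall k, 1 <= powR (t k) (b1 + 1) * powR (s k ^+ 2) (N - c1)) /\
  ~ (forall k, powR (t k) ((al2 + 1) / p2) * powR (s k ^+ 2) (N / p2) <=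
      powR (t k) (b2 + 1) * powR (s k ^+ 2) (N - c2)).
Proof.
move=> tt s1 ts st; have tE := @trivIset_box R m s t tt.
have t0 k : 0 < t k by have /andP[] := ts k.
have mE k : measurable (@box R m 1 (s k) (t k)) by exact: mbox.
have kT0 (a b c : R) w u : 0 <= \1_TBm u * ker1 a b c w u by rewrite mulr_ge0// ker1_ge0.
split => hk.
  have [z z0] := bounded_inf_ker1_lty; rewrite ltNge => /negP; apply.
  have [C C0 HC] := dyadic_box_ker1_ge a1 b1 c1 z0 s1 ts st.
  rewrite (integral_infinite mE tE _ (kT0 _ _ _ _) C0)//.
    exact: measurable_indic_ker1.
  move=> k; apply: le_trans (HC k); rewrite lee_fin ler_pM2l//.
  by apply: le_trans (hk k); rewrite invf_le1// ler1n.
have [C HC] := dyadic_box_weight_le m al2 p0 s1 t0.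
have mW : measurable_fun [set: Pt R m.+1] (fun u => \1_TBm u * powR (rho u) al2).
  by apply: measurable_funM; [exact: measurable_indic_TB|exact: measurable_powR_rho].
have W0 u : 0 <= \1_TBm u * powR (rho u) al2 by rewrite mulr_ge0 ?powR_ge0.
have q0 k : 0 < powR (t k) ((al2 + 1) / p2) * powR (s k ^+ 2) (N / p2).
  by rewrite mulr_gt0 ?powR_gt0 ?exprn_gt0// (lt_le_trans ltr01 (s1 k)).
have [g [mg g0 _ goo gH]] := exists_divergent mE tE p1 mW W0 q0 HC.
have [z [w [Az Bw Izw]]] := bounded_inf_integral_lty (mind 1 1 1) mg (ind01 box1) g0 goo
  (mbox 1 1 1) (mbox 1 1 1) box1_TB box1_TB not_negligible_box1 not_negligible_box1.
have w0 : TB w := box1_TB Bw.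
have [C' C'0 HC'] := dyadic_box_ker1_ge a2 b2 c2 w0 s1 ts st.
have Hoo := gH _ C' (measurable_indic_ker1 a2 b2 c2 w) (kT0 _ _ _ _) C'0.
move: Izw; rewrite Hoo => [|k].
  by rewrite gt0_muley ?ltxx// integral_box1_gt0//; exact: box1_TB.
by apply: le_trans (HC' k); rewrite lee_fin ler_pM2l.
Qed.

Let pow2_ge1 (k : nat) : 1 <= 2 ^+ k :> R. Proof. by rewrite exprn_ege1// ler1n. Qed.

Let pow2_gt0 (k : nat) : 0 < 2 ^+ k :> R. Proof. by rewrite exprn_gt0. Qed.

Let boundary_boxes :
  [/\ forall i j, (i < j)%N -> 2 * (2 ^+ i)^-1 <= (2 ^+ j)^-1 :> R \/
                               2 * (2 ^+ j)^-1 <= (2 ^+ i)^-1 :> R,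
      forall k : nat, 0 < (2 ^+ k : R)^-1 <= 1 ^+ 2 &
      forall k : nat, 1 = 1 :> R \/ (2 ^+ k)^-1 = 1 ^+ 2 :> R].
Proof.
split=> [i j ij|k|k]; last by left.
- right; rewrite ler_pdivrMr// mulrC ler_pdivlMr//.
  by rewrite -exprS; apply: ler_weXn2l => //; rewrite ler1n.
- by rewrite invr_gt0 pow2_gt0 expr1n invf_le1 ?pow2_gt0 ?pow2_ge1.
Qed.

Let infinity_boxes :
  [/\ forall i j, (i < j)%N -> 2 * (2 ^+ i) ^+ 2 <= (2 ^+ j) ^+ 2 :> R \/
                               2 * (2 ^+ j) ^+ 2 <= (2 ^+ i) ^+ 2 :> R,
      forall k : nat, 0 < (2 ^+ k : R) ^+ 2 <= (2 ^+ k) ^+ 2 &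
      forall k : nat, 2 ^+ k = 1 :> R \/ (2 ^+ k) ^+ 2 = (2 ^+ k) ^+ 2 :> R].
Proof.
split=> [i j ij|k|k]; last by right.
- left; rewrite -!exprM -exprS; apply: ler_weXn2l; first by rewrite ler1n.
  by lia.
- by rewrite lexx andbT; apply: exprn_gt0; exact: pow2_gt0.
Qed.

(** Boxes tending to the boundary give the two conditions on [b1] and [b2], boxes tending to
    infinity those on [c1] and [c2]. Each negated inequality includes the critical case, where the
    two compared powers coincide. *)
Lemma bounded_inf_exponents :
  [/\ -1 < b1, N + 1 + b1 < c1, al2 + 1 < p2 * (b2 + 1) &
      N + 1 + b2 - (N + 1 + al2) / p2 < c2].
Proof.
have [tt1 ts1 st1] := boundary_boxes; have [tt2 ts2 st2] := infinity_boxes.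
have [B1 B2] := bounded_inf_not_divergent tt1 unit_scale ts1 st1.
have [I1 I2] := bounded_inf_not_divergent tt2 pow2_ge1 ts2 st2.
have powV (k : nat) (x y : R) : y <= x -> powR (2 ^+ k)^-1 x <= powR (2 ^+ k)^-1 y.
  by move=> xy; apply: ger_powR => //; rewrite invr_gt0 pow2_gt0 invf_le1 ?pow2_gt0 ?pow2_ge1.
have pow4 (k : nat) (x y : R) : x <= y -> powR ((2 ^+ k) ^+ 2) x <= powR ((2 ^+ k) ^+ 2) y.
  by move=> xy; apply: ler_powR => //; apply: exprn_ege1; exact: pow2_ge1.
have pow40 (k : nat) : 0 < (2 ^+ k) ^+ 2 :> R by apply: exprn_gt0; exact: pow2_gt0.
split; rewrite ltNge; apply/negP => h.
- apply: B1 => k; rewrite expr1n powR1 /= mulr1.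
  by rewrite -[leLHS](powRr0 (2 ^+ k)^-1); apply: powV; lra.
- apply: I1 => k; rewrite -gt0_powRD//.
  by rewrite -[leLHS](powRr0 ((2 ^+ k) ^+ 2)); apply: pow4; lra.
- apply: B2 => k; rewrite expr1n powR1 /= !mulr1; apply: powV.
  by rewrite ler_pdivlMr// mulrC.
- apply: I2 => k; rewrite -!gt0_powRD//; apply: pow4.
  have -> : (al2 + 1) / p2 + N / p2 = (N + 1 + al2) / p2 by rewrite -mulrDl; congr (_ / _); ring.
  lra.
Qed.

Lemma powR_bounded_eq0 (x C : R) : (forall D, 0 < D -> powR D x <= C) -> x = 0.
Proof.
move=> h; apply/eqP; apply: contrapT => /negP x0.
have C1 : 1 <= C by have := h 1 ltr01; rewrite powR1.
have C0 : 0 < C + 1 by lra.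
(* The value of [D] for which [powR D x] is [C + 1], whatever the sign of [x]. *)
have := h (powR (C + 1) x^-1) (powR_gt0 _ C0).
by rewrite -powRrM mulVf// powRr1; lra.
Qed.

Variable k : R.
Hypothesis k01 : 0 < k <= 1.
Hypothesis KR : forall (s1 s2 : R) z u w e, 0 < s1 -> 0 < s2 ->
  box k s1 (s1 ^+ 2) z -> box k s1 (s1 ^+ 2) u ->
  box k s2 (s2 ^+ 2) w -> box k s2 (s2 ^+ 2) e ->
  ker1 a1 b1 c1 z u * ker1 a2 b2 c2 w e <= 2 * complex.Re (K z w u e).

(** With [z] and [u] in the same box of scale [s], the quantities [rho z], [rho u] and the modulus
    of [rho2 z u] are all comparable to [s ^+ 2], and only a power of the scale remains. *)
Lemma ker1_diagonal_ge (a b c : R) : exists2 C : R, 0 < C & forall z s, 0 < s ->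
  box k s (s ^+ 2) z -> ((C * powR (s ^+ 2) (N + 1 + a + b - c))%:E <=
   \int[V]_u (\1_TBm u * ker1 a b c z u * \1_(@box R m k s (s ^+ 2)) u)%:E)%E.
Proof.
have /andP[k0 k1] := k01; have k2 : k <= 2 by lra.
have [C C0 HC] := @box_ker1_ge R m a b c k 2 k0 k2 (ltac:(lra)).
exists (C * powR 2 (- `|a|)) => [|z s s0 zb]; first by rewrite mulr_gt0// powR_gt0.
have S0 : 0 < s ^+ 2 by rewrite exprn_gt0.
have [_ _ /andP[tz zt]] := zb.
have zs : at_scale 2 s z by apply: box_at_scale zb.
have := HC z s (s ^+ 2) s0 S0 (lexx _) zs (ltac:(lra)).
rewrite [X in (_ <= X)%E](_ : _ =
    (\int[V]_u (\1_TBm u * ker1 a b c z u * \1_(@box R m k s (s ^+ 2)) u)%:E)%E); last first.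
  rewrite integral_mkcond; apply: eq_integral => u _; rewrite patchE [\1_(box _ _ _) u]indicE.
  case: ifPn => [|_]; last by rewrite mulr0.
  by rewrite inE => ub; rewrite mulr1 indicE mem_set ?mul1r//; apply: box_TB ub; exact: ltW.
apply: le_trans; rewrite lee_fin.
have [tz2 two] : s ^+ 2 <= 2 * rho z /\ 1 <= 2 :> R by split; lra.
have /andP[h _] := powR_comparable a S0 two tz2 zt.
have -> : N + 1 + a + b - c = a + (b + 1) + (N - c) by ring.
rewrite [powR _ (_ + (N - c))]gt0_powRD// [powR _ (a + _)]gt0_powRD//.
move: (powR_ge0 (s ^+ 2) (b + 1)) (powR_ge0 (s ^+ 2) (N - c)) h.
move: (powR (s ^+ 2) a) (powR (s ^+ 2) (b + 1)) (powR (s ^+ 2) (N - c)).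
move: (powR 2 _) (powR (rho z) a) => x y pa pb pc pb0 pc0 h.
by have := ler_wpM2l (ltW C0) (ler_wpM2r (mulr_ge0 pb0 pc0) h); rewrite !mulrA.
Qed.

(** The test function is the indicator of a product of two boxes, and its image is bounded below on
    that same product. The scale [s1] is absent on the right because the supremum norm of an
    indicator does not depend on the size of the box; the two scales vary independently. *)
Lemma bounded_inf_scaling : exists C1 C2 : R, 0 < C1 /\ forall s1 s2 : R, 0 < s1 -> 0 < s2 ->
  C1 * powR (s1 ^+ 2) (N + 1 + a1 + b1 - c1) * powR (s2 ^+ 2) (N + 1 + a2 + b2 - c2) <=
  C2 * powR (s2 ^+ 2) ((N + 1 + al2) / p2).
Proof.
have /andP[k0 k1] := k01.
have [B hB] := bK.
have [D1 D10 HD1] := ker1_diagonal_ge a1 b1 c1.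
have [D2 D20 HD2] := ker1_diagonal_ge a2 b2 c2.
have [W W0 HW] := @box_weight_le R m al2 k k0.
exists (D1 * D2 / 2), (`|B| * powR W p2^-1); split.
  by rewrite divr_gt0// mulr_gt0.
move=> s1 s2 s10 s20.
have S10 : 0 < s1 ^+ 2 by rewrite exprn_gt0.
have S20 : 0 < s2 ^+ 2 by rewrite exprn_gt0.
pose A1 := @box R m k s1 (s1 ^+ 2); pose A2 := @box R m k s2 (s2 ^+ 2).
pose f := test_fun (\1_A1 : _ -> R) (\1_A2 : _ -> R).
have i1 u : 0 <= (\1_A1 u : R) by have /andP[] := ind01 A1 u.
have i2 u : 0 <= (\1_A2 u : R) by have /andP[] := ind01 A2 u.
have normf : (mixnorm_inf p2 al1 al2 f <=
    (powR W p2^-1 * powR (s2 ^+ 2) ((N + 1 + al2) / p2))%:E)%E.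
  apply: le_trans (mixnorm_test_fun_le al1 al2 p0 (mind _ _ _) (ind01 A1) i2) _.
  have IW : (\int[V]_e (powR (\1_A2 e) p2 * (\1_TBm e * powR (rho e) al2))%:E <=
      (W * powR (s2 ^+ 2) (N + 1 + al2))%:E)%E.
    have -> : N + 1 + al2 = (al2 + 1) + N by ring.
    rewrite gt0_powRD// mulrA; apply: le_trans (HW s2 _ s20 S20).
    rewrite [leRHS]integral_mkcond le_eqVlt; apply/orP; left; apply/eqP.
    apply: eq_integral => u _; rewrite patchE [\1_A2 u]indicE; case: ifPn => [|_].
      rewrite inE => ub; rewrite powR1 mul1r indicE mem_set ?mul1r//.
      by apply: box_TB ub; exact: ltW.
    by rewrite powR0 ?gt_eqF// mul0r.
  have -> : (powR W p2^-1 * powR (s2 ^+ 2) ((N + 1 + al2) / p2))%:E =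
      ((W * powR (s2 ^+ 2) (N + 1 + al2))%:E `^ p2^-1)%E.
    by rewrite poweR_EFin powRM ?powR_ge0// -powRrM.
  apply: gt0_ler_poweR => //.
  - by rewrite invr_ge0 ltW.
  - rewrite in_itv/= leey andbT; apply: integral_ge0 => u _.
    by rewrite lee_fin mulr_ge0 ?powR_ge0// mulr_ge0 ?powR_ge0.
  - by rewrite in_itv/= leey andbT lee_fin mulr_ge0// powR_ge0.
have foo : (mixnorm_inf p2 al1 al2 f < +oo)%E by apply: le_lt_trans normf _; exact: ltry.
have [/nullVVE nI esf] := hB f (cmeasurable_test_fun (mind _ _ _) (mind _ _ _)) foo.
(* If [L] exceeded the bound, the image would have modulus below [L] almost everywhere. But it is at
   least [L] on the product of the boxes wherever the integral converges, and that product is not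
   negligible. *)
set L := D1 * D2 / 2 * _ * _; rewrite leNgt; apply/negP => hL.
have esL : (esssupVV (fun z w => (cabs (applyK K f z w))%:E) < L%:E)%E.
  apply: le_lt_trans esf _; apply: le_lt_trans (_ : _ <= `|B|%:E * mixnorm_inf p2 al1 al2 f)%E _.
    by apply: lee_wpmul2r; [exact: mixnorm_inf_ge0|rewrite lee_fin ler_norm].
  apply: le_lt_trans (lee_wpmul2l _ normf) _; first by rewrite lee_fin.
  by rewrite -EFinM lte_fin mulrA.
have nL := esssupVV_lt esL.
have nA (s : R) : 0 < s -> ~ V.-negligible (@box R m k s (s ^+ 2)).
  by move=> s0; apply: box_not_negligible => //; rewrite exprn_gt0.
apply: (setX_not_negligible (mbox _ _ _) (mbox _ _ _) (nA _ s10) (nA _ s20)).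
apply: negligibleS (negligibleU nI nL) => -[z w] /= [Az Aw].
have z0 : TB z by apply: box_TB Az; exact: ltW.
have w0 : TB w by apply: box_TB Aw; exact: ltW.
have [Izw|Izw] := pselect (integrableVV (fun u e => K z w u e * f u e)); last by left.
right; split => //; split => //; rewrite lee_fin.
apply: le_trans (normRe_le_cabs _); apply: le_trans (ler_norm _).
pose g1 u : R := \1_TBm u * ker1 a1 b1 c1 z u * \1_A1 u.
pose g2 u : R := \1_TBm u * ker1 a2 b2 c2 w u * \1_A2 u.
have mg1 : measurable_fun [set: Pt R m.+1] g1.
  by apply: measurable_funM; [exact: measurable_indic_ker1|exact: mind].
have mg2 : measurable_fun [set: Pt R m.+1] g2.
  by apply: measurable_funM; [exact: measurable_indic_ker1|exact: mind].
have g10 u : 0 <= g1 u.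
  apply: mulr_ge0; last by []; apply: mulr_ge0; [by []|exact: ker1_ge0].
have g20 u : 0 <= g2 u.
  apply: mulr_ge0; last by []; apply: mulr_ge0; [by []|exact: ker1_ge0].
have ReE u e : complex.Re (K z w u e * f u e) = complex.Re (K z w u e) * (\1_A1 u * \1_A2 e).
  by rewrite /f /test_fun; case: (K z w u e) => x y /=; rewrite mulr0 subr0.
have RK u e : 0 <= complex.Re (K z w u e * f u e) /\
    g1 u * g2 e <= 2 * ((\1_TBm u * \1_TBm e : R) * complex.Re (K z w u e * f u e)).
  rewrite ReE /g1 /g2; apply: indic_mul_le; [exact: ker1_ge0|exact: ker1_ge0|].
  move=> uA eA; split; last exact: KR s10 s20 Az uA Aw eA.
  by split; [apply: box_TB uA|apply: box_TB eA]; exact: ltW.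
have Re0 u e := (RK u e).1.
have Foo : (intV (fun u => intV (fun e => ((\1_TBm u * \1_TBm e : R) *
    complex.Re (K z w u e * f u e))%:E)) < +oo)%E.
  have ii u e : 0 <= (\1_TBm u * \1_TBm e : R) by exact: mulr_ge0.
  have h0 u e : (0 <= ((\1_TBm u * \1_TBm e : R) * complex.Re (K z w u e * f u e))%:E)%E.
    by rewrite lee_fin; exact: mulr_ge0 (ii u e) (Re0 u e).
  apply: le_lt_trans Izw; apply: le_intV => u; first by apply: intV_ge0 => e; exact: h0.
  apply: le_intV => e; first exact: h0.
  rewrite lee_fin; apply: ler_wpM2l; first exact: ii.
  exact: le_trans (ler_norm _) (normRe_le_cabs _).
have -> : L = (D1 * powR (s1 ^+ 2) (N + 1 + a1 + b1 - c1) / 2) *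
    (D2 * powR (s2 ^+ 2) (N + 1 + a2 + b2 - c2)).
  by rewrite /L; move: (powR _ _) (powR _ _) => x y; ring.
have P1 : 0 <= D1 * powR (s1 ^+ 2) (N + 1 + a1 + b1 - c1) by rewrite mulr_ge0 ?powR_ge0// ltW.
have P2 : 0 <= D2 * powR (s2 ^+ 2) (N + 1 + a2 + b2 - c2) by rewrite mulr_ge0 ?powR_ge0// ltW.
have mg1h : measurable_fun [set: Pt R m.+1] (fun u => g1 u / 2) by exact: measurable_funM.
apply: (rintVV_ge mg1h mg2 _ g20 _ P2 Re0 _ Foo _ (HD2 w s2 s20 Aw)).
- by move=> u; rewrite divr_ge0.
- by rewrite divr_ge0.
- by move=> u e; apply: half_mul_le; exact: (RK u e).2.
- have := HD1 z s1 s10 Az => h.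
  rewrite (_ : (\int[V]_u (g1 u / 2)%:E = (2^-1)%:E * \int[V]_u (g1 u)%:E)%E).
    by rewrite mulrC EFinM; apply: lee_wpmul2l; [rewrite lee_fin|exact: h].
  rewrite -ge0_integralZl ?lee_fin//.
  + by apply: eq_integral => u _; rewrite mulrC EFinM.
  + exact/measurable_EFinP.
  + by move=> u _; rewrite lee_fin; exact: g10.
Qed.

End necessity.

(** * The characterization *)

Section diagonal_positivity.
Context (R : realType) (m : nat).

(** On such boxes the real part is at least [s ^+ 2] and the imaginary part at most a multiple of
    [k * s ^+ 2]. The scale cancels in the quotient, so a small [k] works for every [s]. *)
Lemma carg_rho2_small (eps : R) : 0 < eps -> exists2 k : R, 0 < k <= 1 &
  forall (s : R) z u, 0 < s -> @box R m k s (s ^+ 2) z -> box k s (s ^+ 2) u ->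
  `|carg (rho2 z u)| < eps.
Proof.
move=> e0.
have /cvgrPdist_lt/(_ eps e0) /nbhs_ballP[d /= d0 Hd] : atan x @[x --> (0 : R)] --> (atan 0 : R).
  exact: continuous_atan.
have m0 : 0 < (2 * m%:R + 1 : R) by rewrite ltr_pwDr// mulr_ge0.
(* [2 * m + 1] is the constant in the bound on the imaginary part; the extra 2 makes the final
   inequality strict. The bound [k <= 1] lets [k ^+ 2] be replaced by [k]. *)
pose k := Num.min 1 (d / (2 * (2 * m%:R + 1))).
have k0 : 0 < k by rewrite lt_min ltr01 divr_gt0// mulr_gt0.
have k1 : k <= 1 by rewrite ge_min lexx.
have kd : (2 * m%:R + 1) * k < d.
  apply: (@le_lt_trans _ _ ((2 * m%:R + 1) * (d / (2 * (2 * m%:R + 1))))).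
    by rewrite ler_pM2l// ge_min lexx orbT.
  rewrite (_ : _ * _ = d / 2); first by lra.
  by field; rewrite gt_eqF.
exists k; first by rewrite k0.
move=> s z u s0 [zxy zx /andP[tz _]] [uxy ux /andP[tu _]].
have S0 : 0 < s ^+ 2 by rewrite exprn_gt0.
have ReS : s ^+ 2 <= complex.Re (rho2 z u).
  have Q0 := sqdist'_ge0 z u; rewrite Re_rho2; lra.
have Re0 : 0 < complex.Re (rho2 z u) by exact: lt_le_trans ReS.
have ks0 : 0 <= 2 * k * s by rewrite !mulr_ge0// ltW.
have IM : `|complex.Im (rho2 z u)| <= (2 * m%:R + 1) * k * s ^+ 2.
  rewrite Im_rho2 /= normrM [`|_^-1|]ger0_norm// ler_pdivrMr//.
  have h1 : `|\sum_(j < m) (xco z j - xco u j) * (yco z j + yco u j)| <=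
      m%:R * (4 * k * s ^+ 2).
    apply: le_trans (ler_norm_sum _ _ _) _.
    have -> : m%:R * (4 * k * s ^+ 2) = \sum_(j < m) (4 * k * s ^+ 2).
      by rewrite sumr_const card_ord mulr_natl.
    apply: ler_sum => j _; have [zxj zyj] := zxy j (ltn_ord j).
    have [uxj uyj] := uxy j (ltn_ord j); rewrite normrM.
    have hx : `|xco z j - xco u j| <= 2 * k * s.
      by apply: le_trans (ler_normB _ _) _; lra.
    have hy : `|yco z j + yco u j| <= 2 * k * s.
      by apply: le_trans (ler_normD _ _) _; lra.
    apply: le_trans (ler_pM (normr_ge0 _) (normr_ge0 _) hx hy) _.
    have -> : 2 * k * s * (2 * k * s) = k * (4 * k * s ^+ 2) by ring.
    by rewrite ler_piMl// !mulr_ge0// ?sqr_ge0// ltW.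
  have h2 : `|xco z m - xco u m| <= 2 * k * s ^+ 2.
    by apply: le_trans (ler_normB _ _) _; lra.
  apply: le_trans (ler_normB _ _) _; apply: le_trans (lerD h1 h2) _.
  by rewrite le_eqVlt; apply/orP; left; apply/eqP; ring.
have := Hd (complex.Im (rho2 z u) / complex.Re (rho2 z u)).
rewrite atan0 sub0r normrN; apply.
rewrite /ball/= sub0r normrN normrM normfV (gtr0_norm Re0) ltr_pdivrMr//.
apply: le_lt_trans IM _; apply: (@lt_le_trans _ _ (d * s ^+ 2)).
  by rewrite ltr_pM2r.
by rewrite ler_pM2l.
Qed.

Lemma kerT_diagonal_positive (a1 a2 b1 b2 c1 c2 : R) : exists2 k : R, 0 < k <= 1 &
  forall (s1 s2 : R) z u w e, 0 < s1 -> 0 < s2 ->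
  @box R m k s1 (s1 ^+ 2) z -> box k s1 (s1 ^+ 2) u ->
  @box R m k s2 (s2 ^+ 2) w -> box k s2 (s2 ^+ 2) e ->
  ker1 a1 b1 c1 z u * ker1 a2 b2 c2 w e <=
  2 * complex.Re (kerT a1 a2 b1 b2 c1 c2 z w u e).
Proof.
have hc : cos x @[x --> (0 : R)] --> (cos 0 : R) by exact: continuous_cos.
have h2 : 0 < 2^-1 :> R by rewrite invr_gt0.
move/cvgrPdist_lt: hc => /(_ _ h2) /nbhs_ballP[d d0 Hd]; rewrite /= in d0 Hd.
(* The summand 1 keeps [c] positive when both exponents vanish. *)
pose c := `|c1| + `|c2| + 1.
have c0 : 0 < c by rewrite ltr_pwDr// addr_ge0.
have [k k01 Hk] := carg_rho2_small (divr_gt0 d0 c0).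
exists k => // s1 s2 z u w e s10 s20 zb ub wb eb.
rewrite Re_kerT; set t := c1 * _ + c2 * _.
have td : `|t| < d.
  have h1 := Hk _ _ _ s10 zb ub; have h3 := Hk _ _ _ s20 wb eb.
  apply: le_lt_trans (ler_normD _ _) _; rewrite !normrM.
  apply: (@le_lt_trans _ _ ((`|c1| + `|c2|) * (d / c))).
    by rewrite mulrDl lerD// ler_wpM2l// ltW.
  rewrite mulrA ltr_pdivrMr// mulrC ltr_pM2l// /c ltrDl; exact: ltr01.
have ct : 2^-1 <= cos t.
  have := Hd t; rewrite /ball/= sub0r normrN cos0 => /(_ td).
  rewrite ltr_norml => /andP[_ h]; lra.
have k0 : 0 <= ker1 a1 b1 c1 z u * ker1 a2 b2 c2 w e by rewrite mulr_ge0 ?ker1_ge0.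
move: (ker1 a1 b1 c1 z u * ker1 a2 b2 c2 w e) k0 => x x0.
have := ler_wpM2l x0 ct; lra.
Qed.

Lemma kerS_diagonal_positive (a1 a2 b1 b2 c1 c2 : R) z u w e :
  ker1 a1 b1 c1 z u * ker1 a2 b2 c2 w e <=
  2 * complex.Re (@kerS R m.+1 a1 a2 b1 b2 c1 c2 z w u e).
Proof.
rewrite kerSE /=.
have k0 : 0 <= ker1 a1 b1 c1 z u * ker1 a2 b2 c2 w e by rewrite mulr_ge0 ?ker1_ge0.
by move: (ker1 a1 b1 c1 z u * ker1 a2 b2 c2 w e) k0 => x x0; lra.
Qed.

End diagonal_positivity.

Section characterization.
Context (R : realType) (m : nat).
Local Notation N := (m.+1%:R : R).

Lemma bounded_infP (K : Pt R m.+1 -> Pt R m.+1 -> Pt R m.+1 -> Pt R m.+1 -> R[i])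
    (p2 a1 a2 b1 b2 c1 c2 al1 al2 k : R) : 1 < p2 ->
  (forall z w u e, cabs (K z w u e) = ker1 a1 b1 c1 z u * ker1 a2 b2 c2 w e) ->
  0 < k <= 1 ->
  (forall (s1 s2 : R) z u w e, 0 < s1 -> 0 < s2 ->
    box k s1 (s1 ^+ 2) z -> box k s1 (s1 ^+ 2) u ->
    box k s2 (s2 ^+ 2) w -> box k s2 (s2 ^+ 2) e ->
    ker1 a1 b1 c1 z u * ker1 a2 b2 c2 w e <= 2 * complex.Re (K z w u e)) ->
  bounded_inf K p2 al1 al2 <->
  (0 < a1 /\ 0 < a2 /\ -1 < b1 /\ al2 + 1 < p2 * (b2 + 1) /\
   c1 = N + 1 + a1 + b1 /\ c2 = N + 1 + a2 + b2 - (N + 1 + al2) / p2).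
Proof.
move=> p1 KE k01 KR; split=> [bK|[a10 [a20 [b11 [alb [c1E c2E]]]]]]; last first.
  exact: bounded_inf_sufficient KE a10 a20 b11 alb c1E c2E.
have [h1 h2 h3 h4] := bounded_inf_exponents p1 KE bK.
have [C1 [C2 [C10 HC]]] := bounded_inf_scaling p1 bK k01 KR.
(* The scaling inequality involves the squares of the scales, so the free parameter [D] is reached
   through a square root. Setting one scale to 1 isolates the exponent of the other. *)
have sq (D : R) : 0 < D -> Num.sqrt D ^+ 2 = D by move=> D0; rewrite sqr_sqrtr// ltW.
have x1 : N + 1 + a1 + b1 - c1 = 0.
  apply: (@powR_bounded_eq0 R _ (C2 / C1)) => D D0.
  have D0' : 0 < Num.sqrt D by rewrite sqrtr_gt0.
  have := HC (Num.sqrt D) 1 D0' ltr01.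
  by rewrite sq// expr1n powR1 /= !mulr1 ler_pdivlMr// mulrC.
have x2 : N + 1 + a2 + b2 - c2 - (N + 1 + al2) / p2 = 0.
  apply: (@powR_bounded_eq0 R _ (C2 / C1)) => D D0.
  have D0' : 0 < Num.sqrt D by rewrite sqrtr_gt0.
  have := HC 1 (Num.sqrt D) ltr01 D0'.
  rewrite sq// expr1n powR1 /= mulr1 => h.
  rewrite gt0_powRD// powRN ler_pdivlMr// mulrAC ler_pdivrMr ?powR_gt0// mulrC.
  exact: h.
(* Positivity of [a1] and [a2] comes from [h2] and [h4] combined with the identities [x1] and
   [x2]. *)
by do !split => //; lra.
Qed.

End characterization.

Theorem theorem6p12 (R : realType) (n : nat) (hn : (0 < n)%N)
    (p2 a1 a2 b1 b2 c1 c2 al1 al2 : R)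
    (hp2 : 1 < p2) (hal1 : -1 < al1) (hal2 : -1 < al2) :
  let N := (n%:R : R) in
  (bounded_inf (@kerS R n a1 a2 b1 b2 c1 c2) p2 al1 al2 <->
   bounded_inf (@kerT R n a1 a2 b1 b2 c1 c2) p2 al1 al2) /\
  (bounded_inf (@kerT R n a1 a2 b1 b2 c1 c2) p2 al1 al2 <->
   (0 < a1 /\ 0 < a2 /\ -1 < b1 /\ al2 + 1 < p2 * (b2 + 1) /\
    c1 = N + 1 + a1 + b1 /\
    c2 = N + 1 + a2 + b2 - (N + 1 + al2) / p2)).
Proof.
case: n hn => [|m] hn N; first by rewrite ltnn in hn.
(* The box size needed for the phase of T serves for S as well, whose kernel is nonnegative
   everywhere. *)
have [k k01 KT] := @kerT_diagonal_positive R m a1 a2 b1 b2 c1 c2.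
have hS := bounded_infP al1 al2 hp2 (@cabs_kerS R m.+1 a1 a2 b1 b2 c1 c2) k01
  (fun _ _ z u w e _ _ _ _ _ _ => kerS_diagonal_positive a1 a2 b1 b2 c1 c2 z u w e).
have hT := bounded_infP al1 al2 hp2 (@cabs_kerT R m.+1 a1 a2 b1 b2 c1 c2) k01 KT.
by split; [apply: iff_trans hS (iff_sym hT)|exact: hT].
Qed.
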